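(* There exists an explicit threshold $M_{\mathrm{LP}}\le10^{100}$ such that for every integer $m\ge M_{\mathrm{LP}}$ with $\gcd(m,9)=1$, the largest prime $p\le10^{2m/9}$ with $s(p)=m$ satisfies $$p\ \ge\ \frac{10^{2m/9}}{24\sqrt m}.$$ Concretely, one may take $M_{\mathrm{LP}}=10^{100}$. In particular, the bound applies to each of the three values $m=43917\cdot2^{430}+1$, $m=3557\cdot2^{431}+1$, $m=4027\cdot2^{426}+1$, which have at least $132$ decimal digits.
   Context: $s(n)$ is the sum of the decimal digits of $n$. The assertion includes the existence of a prime $p\le 10^{2m/9}$ with $s(p)=m$. *)

(* Defs.v *)
From mathcomp Require Import all_boot all_order all_algebra.
From mathcomp Require Import reals exp.
Set Implicit Arguments.
Unset Strict Implicit.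
Unset Printing Implicit Defensive.
Import Order.TTheory GRing.Theory Num.Theory.
Local Open Scope ring_scope.

(* Least significant digit first; trunc_log 10 n is the largest e such that
   10 ^ e <= n (and 0 for n = 0, so that 0 has the single digit 0). *)
Definition digits (n : nat) : seq nat :=
  mkseq (fun i => (n %/ 10 ^ i) %% 10)%N (trunc_log 10 n).+1.

Definition digit_sum (n : nat) : nat := sumn (digits n).

(* Real power: m need not be divisible by 9. *)
Definition cutoff (R : realType) (m : nat) : R := 10 `^ (2 * m%:R / 9).

Definition admissible_prime (R : realType) (m p : nat) : Prop :=
  [/\ prime p, p%:R <= cutoff R m & digit_sum p = m].

Definition largest_admissible_prime (R : realType) (m p : nat) : Prop :=
  admissible_prime R m p /\
  forall q : nat, admissible_prime R m q -> (q <= p)%N.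

(* Includes the existence of an admissible prime. *)
Definition large_prime_bound (R : realType) (m : nat) : Prop :=
  exists p : nat, largest_admissible_prime R m p /\
    p%:R >= cutoff R m / (24 * Num.sqrt m%:R).

(* Main.v *)
Require Import Defs.
From mathcomp Require Import all_boot all_order all_algebra.
From mathcomp Require Import boolp classical_sets functions topology normedtype.
From mathcomp Require Import sequences derive realfun reals exp trigo.
From mathcomp Require Import complex.
From mathcomp Require Import ring lra zify.
Set Implicit Arguments. Unset Strict Implicit. Unset Printing Implicit Defensive.
Import Order.TTheory GRing.Theory Num.Theory numFieldNormedType.Exports.
Local Open Scope ring_scope.
Local Open Scope complex_scope.

(** Among the integers n with k decimal digits the digit sum has mean 9 k / 2 and
  standard deviation of order sqrt k, so that about one integer in sqrt k has digit
  sum m when 2 m is close to 9 k. Primes behave in the same way inside the residue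
  class that the digit sum prescribes: n and its digit sum are congruent modulo 9,
  which is why m must be coprime to 3. For K = floor (2 m / 9) it is enough to find
  one prime with digit sum m in some decade [10^(k-1), 10^k) with K - 50 < k <= K:
  the cutoff lies between 10^K and 10^(K+1), and 24 sqrt m is at least 24 * 10^50.

  Such a decade is chosen by [exists_block]: a Mertens type estimate for one class
  modulo 9 ([class_mass]) shows that fifty consecutive decades carry a fixed amount
  of the sum of Lam n / n over n congruent to m, so that one of them is dense. Write
  wt for von Mangoldt's function restricted to this class and this decade, M for its
  total mass and s(n) for the digit sum. Fourier inversion over al = t / (9 Q)
  expresses the weight of the n with s(n) = m as the mean of
  Phi (al) = sum of wt n * cos (2 pi al (s(n) - m)); the congruence modulo 9 allows
  one to keep |al| <= 1 / 18. With b = floor (k ^ (1 / 12)) there are two regimes.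

  - |al| <= b^-5 ([near_value]). Only the middle digits of n are kept. A polynomial in
    those digits is a trigonometric polynomial in n whose frequencies have large
    denominators, where Vinogradov's method ([linear_exp_sum]) bounds the sums over
    primes. Hence the digits of primes have the same moments as independent uniform
    digits, and the Taylor polynomial of the cosine transfers this to Phi, up to an
    error of order M / b^2. For independent digits the mean is nonnegative, and it
    exceeds 1 / 2 when |al| <= b^-6 / 40.
  - |al| > b^-5 ([wt_far]). By the method of Mauduit and Rivat, the sum of
    Lam n * e (al s(n)) is small. [vaughan] reduces it to sums over multiples of D
    ([digital_typeI]) and to bilinear sums ([typeII_digital]); two uses of van der
    Corput's inequality cancel the high and the low digits, and the remaining window
    of digits is handled by Fourier analysis modulo a power of ten. All the saving
    comes from [digit_sup]: two consecutive digits cannot both be in phase with a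
    linear character unless 9 al is close to an integer.

  In [peak_sum_lower] the frequencies up to b^-6 / 40 then outweigh all the others,
  so that the integers with digit sum m carry a weight larger than what the proper
  prime powers can account for ([prime_with_digit_sum]). The bound 10^100 on m makes
  b >= 10^8, hence b^e <= 10^b for every exponent e that occurs. *)

(** * Moduli of complex numbers and the character e *)

Section Modulus.
Variable R : realType.
Notation C := R[i].
Implicit Types (x y : R) (z : C).

Definition cn (z : C) : R := Num.sqrt (complex.Re z ^+ 2 + complex.Im z ^+ 2).

Lemma normCE z : `|z| = (cn z)%:C.
Proof. by rewrite normc_def. Qed.

Lemma cn_ge0 z : 0 <= cn z. Proof. exact: sqrtr_ge0. Qed.

Lemma cn0 : cn 0 = 0.
Proof. by apply: complexI; rewrite -normCE normr0. Qed.

Lemma cn1 : cn 1 = 1.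
Proof. by apply: complexI; rewrite -normCE normr1. Qed.

Lemma cnN z : cn (- z) = cn z.
Proof. by apply: complexI; rewrite -!normCE normrN. Qed.

Lemma cnM z1 z2 : cn (z1 * z2) = cn z1 * cn z2.
Proof. by apply: complexI; rewrite rmorphM /= -!normCE normrM. Qed.

Lemma cnD z1 z2 : cn (z1 + z2) <= cn z1 + cn z2.
Proof. by rewrite -lecR rmorphD /= -!normCE ler_normD. Qed.

Lemma cnB z1 z2 : cn (z1 - z2) <= cn z1 + cn z2.
Proof. by rewrite -[cn z2]cnN cnD. Qed.

Lemma cnJ z : cn (z^*)%C = cn z.
Proof. by apply: complexI; rewrite -!normCE normcJ. Qed.

Lemma cn_real x : cn x%:C = `|x|.
Proof. by rewrite /cn /= expr0n addr0 sqrtr_sqr. Qed.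

Lemma cn_nat n : cn n%:R = n%:R.
Proof. by rewrite -(rmorph_nat (real_complex R)) /= cn_real ger0_norm. Qed.

Lemma cnX z n : cn (z ^+ n) = cn z ^+ n.
Proof. by elim: n => [|n IH]; rewrite ?cn1 // !exprS cnM IH. Qed.

Lemma cnV z : cn (z^-1) = (cn z)^-1.
Proof. by apply: complexI; rewrite fmorphV /= -!normCE normfV. Qed.

Lemma sqr_cn z : (cn z ^+ 2)%:C = z * (z^*)%C.
Proof. by rewrite -sqr_normc normCE rmorphXn. Qed.

Lemma Re_le_cn z : complex.Re z <= cn z.
Proof.
apply: le_trans (ler_norm _) _.
by rewrite -[X in X <= _]sqrtr_sqr ler_wsqrtr // lerDl sqr_ge0.
Qed.

Lemma cn_sum I (r : seq I) (P : pred I) (F : I -> C) :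
  cn (\sum_(i <- r | P i) F i) <= \sum_(i <- r | P i) cn (F i).
Proof.
elim/big_ind2: _ => //; first by rewrite cn0.
by move=> a b c d ab cd; apply: le_trans (cnD _ _) (lerD ab cd).
Qed.

Lemma cn_sqr_sum n (a : 'I_n -> C) :
  (cn (\sum_(i < n) a i) ^+ 2)%:C = \sum_(i < n) \sum_(j < n) a i * ((a j)^*)%C.
Proof.
rewrite sqr_cn rmorph_sum /= big_distrl /=.
by apply: eq_bigr => i _; rewrite big_distrr.
Qed.

(** Cauchy-Schwarz, from the Lagrange identity. *)
Lemma cauchy_schwarz I (r : seq I) (P : pred I) (a b : I -> R) :
  (\sum_(i <- r | P i) a i * b i) ^+ 2 <=
  (\sum_(i <- r | P i) a i ^+ 2) * (\sum_(i <- r | P i) b i ^+ 2).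
Proof.
have E : \sum_(i <- r | P i) \sum_(j <- r | P j) (a i * b j - a j * b i) ^+ 2
  = 2 * ((\sum_(i <- r | P i) a i ^+ 2) * (\sum_(i <- r | P i) b i ^+ 2)
         - (\sum_(i <- r | P i) a i * b i) ^+ 2).
  have -> : \sum_(i <- r | P i) \sum_(j <- r | P j) (a i * b j - a j * b i) ^+ 2
    = \sum_(i <- r | P i) \sum_(j <- r | P j)
       (a i ^+ 2 * b j ^+ 2 + b i ^+ 2 * a j ^+ 2 - 2 * ((a i * b i) * (a j * b j))).
    by apply: eq_bigr => i _; apply: eq_bigr => j _; ring.
  under eq_bigr => i _ do rewrite sumrB big_split /= -!mulr_sumr.
  rewrite sumrB big_split /= -!mulr_suml -mulr_sumr -mulr_suml; ring.
have : 0 <= \sum_(i <- r | P i) \sum_(j <- r | P j) (a i * b j - a j * b i) ^+ 2.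
  by apply: sumr_ge0 => i _; apply: sumr_ge0 => j _; apply: sqr_ge0.
by rewrite E pmulr_rge0 // subr_ge0.
Qed.

Lemma sum_le_const n (F : 'I_n -> R) B : (forall i, F i <= B) ->
  \sum_(i < n) F i <= n%:R * B.
Proof.
move=> FB; apply: (@le_trans _ _ (\sum_(i < n) B)); first by apply: ler_sum.
by rewrite sumr_const card_ord mulr_natl.
Qed.

Lemma sqr_sum_le n (a : 'I_n -> R) :
  (\sum_(i < n) a i) ^+ 2 <= n%:R * \sum_(i < n) a i ^+ 2.
Proof.
have := cauchy_schwarz (index_enum 'I_n) xpredT (fun=> 1) a.
rewrite (eq_bigr _ (fun i _ => mul1r (a i))) => /le_trans; apply.
by rewrite (eq_bigr (fun=> 1)) ?sumr_const ?card_ord // => i _; rewrite expr1n.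
Qed.

Lemma cn_sqr_sum_le n (a : 'I_n -> C) :
  cn (\sum_(i < n) a i) ^+ 2 <= n%:R * \sum_(i < n) cn (a i) ^+ 2.
Proof.
apply: le_trans (sqr_sum_le _).
by rewrite ler_pXn2r ?nnegrE ?cn_ge0 ?sumr_ge0 ?cn_sum // => i _; apply: cn_ge0.
Qed.

End Modulus.

Section Exponential.
Variable R : realType.
Notation C := R[i].
Implicit Types (x y : R) (z : int).

(** The additive character of the reals modulo one. *)
Definition e x : C := cos (2 * pi * x) +i* sin (2 * pi * x).

Lemma Re_e x : complex.Re (e x) = cos (2 * pi * x). Proof. by []. Qed.
Lemma Im_e x : complex.Im (e x) = sin (2 * pi * x). Proof. by []. Qed.

Lemma eD x y : e (x + y) = e x * e y.
Proof.
by apply/eqP; rewrite eq_complex /= mulrDr cosD sinD [X in _ && (X == _)]addrC eqxx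
  mulrC [X in _ + X]mulrC [sin _ * _ + _]addrC eqxx.
Qed.

Lemma e0 : e 0 = 1.
Proof. by rewrite /e mulr0 cos0 sin0. Qed.

Lemma eN x : e (- x) = ((e x)^*)%C.
Proof. by rewrite /e mulrN cosN sinN. Qed.

Lemma cn_e x : cn (e x) = 1.
Proof. by rewrite /cn /= cos2Dsin2 sqrtr1. Qed.

Lemma eJ x : e x * ((e x)^*)%C = 1.
Proof. by rewrite -eN -eD subrr e0. Qed.

Lemma e1 : e 1 = 1.
Proof. by rewrite /e mulr1 mulr_natl cos2pi sin2pi. Qed.

Lemma e_muln n x : e (n%:R * x) = e x ^+ n.
Proof.
by elim: n => [|n IH]; rewrite ?mul0r ?e0 // mulrSr mulrDl mul1r eD IH exprSr.
Qed.

Lemma e_int z : e z%:~R = 1.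
Proof.
case: z => n; first by rewrite -[_%:~R]mulr1 e_muln e1 expr1n.
by rewrite NegzE mulrNz eN -[_%:~R]mulr1 e_muln e1 expr1n conjc1.
Qed.

(** The distance from x to the nearest integer, up to bounded factors, but
  satisfying the triangle inequality and periodic by construction. *)
Definition nu x : R := cn (1 - e x).

Lemma nu_ge0 x : 0 <= nu x. Proof. exact: cn_ge0. Qed.

Lemma nuN x : nu (- x) = nu x.
Proof. rewrite /nu eN.
have -> : 1 - (e x)^*%C = ((1 - e x)^*)%C by rewrite rmorphB rmorph1.
exact: cnJ. Qed.

Lemma nuD x y : nu (x + y) <= nu x + nu y.
Proof.
rewrite /nu eD.
have -> : 1 - e x * e y = (1 - e x) + e x * (1 - e y) by ring.
by apply: le_trans (cnD _ _) _; rewrite cnM cn_e mul1r.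
Qed.

Lemma nu0 : nu 0 = 0. Proof. by rewrite /nu e0 subrr cn0. Qed.

Lemma nu_muln n x : nu (n%:R * x) <= n%:R * nu x.
Proof.
elim: n => [|n IH]; first by rewrite !mul0r nu0.
rewrite mulrSr !mulrDl !mul1r; apply: le_trans (nuD _ _) _; exact: lerD.
Qed.

Lemma nu_le2 x : nu x <= 2.
Proof. by apply: le_trans (cnB _ _) _; rewrite cn1 cn_e. Qed.

Lemma nuDint x z : nu (x + z%:~R) = nu x.
Proof. by rewrite /nu eD e_int mulr1. Qed.

Lemma nu_sqr x : nu x ^+ 2 = 2 - 2 * cos (2 * pi * x).
Proof.
rewrite /nu /cn sqr_sqrtr ?addr_ge0 ?sqr_ge0 //=.
have := cos2Dsin2 (2 * pi * x); set c := cos _; set s := sin _ => H.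
by transitivity (1 - 2 * c + (c ^+ 2 + s ^+ 2)); [ring | rewrite H; ring].
Qed.

Lemma cn1De_sqr x : cn (1 + e x) ^+ 2 = 4 - nu x ^+ 2.
Proof.
rewrite nu_sqr /cn sqr_sqrtr ?addr_ge0 ?sqr_ge0 //=.
have := cos2Dsin2 (2 * pi * x); set c := cos _; set s := sin _ => H.
by transitivity (1 + 2 * c + (c ^+ 2 + s ^+ 2)); [ring | rewrite H; ring].
Qed.

Lemma sin_lex x : 0 <= x -> sin x <= x.
Proof.
rewrite le_eqVlt => /orP[/eqP<-|x0]; first by rewrite sin0.
have H2 : {within `[0, x], continuous (@sin R)}%classic.
  by apply: continuous_subspaceT => t; exact: continuous_sin.
have [c cI] := MVT x0 (fun t _ => is_derive_sin t) H2.
rewrite sin0 !subr0 => ->; rewrite -[leRHS]mul1r ler_wpM2r ?cos_le1 //; exact: ltW.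
Qed.

Lemma nu_upper x : nu x <= 8 * `|x|.
Proof.
wlog x0 : x / 0 <= x.
  move=> H; case: (lerP 0 x) => x0; first exact: H.
  by rewrite -nuN -normrN; apply: H; rewrite ?oppr_ge0 ?ltW.
rewrite ger0_norm //.
have H : nu x ^+ 2 <= (8 * x) ^+ 2.
  rewrite nu_sqr.
  have -> : 2 * pi * x = (pi * x) *+ 2 by rewrite mulr2n; ring.
  rewrite cos_mulr2n mulr2n cos2sin2.
  rewrite [leLHS](_ : _ = (2 * sin (pi * x)) ^+ 2); last by ring.
  rewrite -[leLHS]real_normK ?num_real // ler_pXn2r ?nnegrE ?normr_ge0 ?mulr_ge0 //.
  rewrite normrM ger0_norm //.
  have pix : 0 <= pi * x by rewrite mulr_ge0 ?pi_ge0.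
  have pi4 : pi < 4 :> R by have := @pihalf_lt2 R; lra.
  have : `|sin (pi * x)| <= pi * x.
    have [s0|s0] := leP 0 (sin (pi * x)); first by rewrite ger0_norm // sin_lex.
    rewrite ltr0_norm //.
    have [x1|x1] := lerP x 1.
      have : 0 <= sin (pi * x).
        by apply: sin_ge0_pi; rewrite pix /= -[leRHS]mulr1 ler_wpM2l ?pi_ge0.
      by move/(lt_le_trans s0); rewrite ltxx.
    have := sin_geN1 (pi * x); have := @pi_ge2 R; move: s0; set s := sin _.
    have : pi * x >= pi by rewrite -[leLHS]mulr1 ler_wpM2l ?pi_ge0 // ltW.
    lra.
  have : pi * x <= 4 * x by rewrite ler_wpM2r // ltW.
  set s := `|_|; set t := pi * x; lra.
by move: H; rewrite ler_pXn2r ?nnegrE ?nu_ge0 ?mulr_ge0.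
Qed.

(** A real x in (0, 1/2] has a multiple 2^j x in [1/4, 1/2], where the cosine is
  nonpositive, and each doubling at most doubles nu. *)
Lemma nu_lower x : `|x| <= 1 / 2 -> 2 * `|x| <= nu x.
Proof.
wlog x0 : x / 0 <= x.
  move=> H; case: (lerP 0 x) => x0; first exact: H.
  by have := H (- x); rewrite nuN normrN oppr_ge0 => H'; apply: H'; exact: ltW.
rewrite ger0_norm // => x2.
move: x0; rewrite le_eqVlt => /orP[/eqP<-|x0]; first by rewrite mulr0 nu_ge0.
have base y : 1 / 4 <= y -> y <= 1 / 2 -> 2 * y <= nu y.
  move=> y4 y2.
  have c0 : cos (2 * pi * y) <= 0.
    have -> : 2 * pi * y = (2 * pi * y - pi / 2) + pi / 2 by rewrite subrK.
    rewrite cosDpihalf oppr_le0; apply: sin_ge0_pi.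
    have := @pi_ge2 R => p2.
    have : pi * y >= pi * (1 / 4) by rewrite ler_wpM2l ?pi_ge0.
    have : pi * y <= pi * (1 / 2) by rewrite ler_wpM2l ?pi_ge0.
    rewrite -mulrA; set t := pi * y; lra.
  have H := nu_sqr y; have := nu_ge0 y.
  have : 1 <= nu y ^+ 2 by rewrite H; lra.
  set n := nu y; nra.
have [j] : exists j, 1 / 4 <= 2 ^+ j * x.
  exists (Num.truncn x^-1).
  have : x^-1 < 2 ^+ (Num.truncn x^-1).+1.
    apply: lt_le_trans (truncnS_gt _) _.
    by rewrite -natrX ler_nat ltnW // ltn_expl.
  rewrite -(ltr_pM2r x0) mulVf ?gt_eqF // exprS; lra.
elim: j x x0 x2 => [|j IH] x x0 x2; first by rewrite expr0 (mul1r x) => H; apply: base.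
have [x4 _|x4] := lerP (1 / 4) x; first exact: base.
rewrite exprSr -mulrA => H.
have := IH (2 * x); have := nu_muln 2 x; lra.
Qed.

End Exponential.
#[global] Opaque e.

(** * Exponential sums modulo N and the large sieve *)

Section Characters.
Variable R : realType.
Notation C := R[i].

Definition w (N : nat) (z : int) : C := e (z%:~R / N%:R).

Lemma wD N a b : w N (a + b) = w N a * w N b.
Proof. by rewrite /w rmorphD mulrDl eD. Qed.

Lemma w0 N : w N 0 = 1.
Proof. by rewrite /w mul0r e0. Qed.

Lemma wN N a : w N (- a) = ((w N a)^*)%C.
Proof. by rewrite /w rmorphN mulNr eN. Qed.

Lemma wB N a b : w N (a - b) = w N a * ((w N b)^*)%C.
Proof. by rewrite wD wN. Qed.

Lemma cn_w N a : cn (w N a) = 1.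
Proof. exact: cn_e. Qed.

Lemma w_muln N (n : nat) z : w N (n%:Z * z) = w N z ^+ n.
Proof. by rewrite /w rmorphM /= -mulrA -e_muln. Qed.

Lemma w_dvd (N : nat) z : (0 < N)%N -> (N%:Z %| z)%Z -> w N z = 1.
Proof.
move=> N0 /dvdzP[k ->]; rewrite /w rmorphM /= mulfK ?e_int //.
by rewrite pnatr_eq0 -lt0n.
Qed.

Lemma w_per (N : nat) a k : (0 < N)%N -> w N (a + k * N%:Z) = w N a.
Proof. by move=> N0; rewrite wD (w_dvd N0 (dvdz_mull _ (dvdzz _))) mulr1. Qed.

Lemma w_mod (N : nat) a : (0 < N)%N -> w N (a %% N%:Z)%Z = w N a.
Proof. by move=> N0; rewrite [in RHS](divz_eq a N) addrC w_per. Qed.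

Lemma w_scale (N M : nat) z : (0 < M)%N -> w (N * M) (z * M%:Z) = w N z.
Proof.
move=> M0; rewrite /w rmorphM /= natrM -mulf_div divff ?mulr1 //.
by rewrite pnatr_eq0 -lt0n.
Qed.

Lemma nu_w_ge (N h : nat) : (0 < h < N)%N ->
  2 * (minn h (N - h))%:R / N%:R <= cn (1 - w N h).
Proof.
move=> /andP[h0 hN]; have N0 : 0 < N%:R :> R by rewrite ltr0n; lia.
have [hl|hl] := leqP h (N - h).
  have x0 : 0 <= (h%:R / N%:R : R) by rewrite divr_ge0.
  have := @nu_lower R (h%:R / N%:R); rewrite ger0_norm // mulrA; apply.
  by rewrite ler_pdivrMr // mulrC mul1r ler_pdivlMr // -natrM ler_nat; lia.
have x0 : 0 <= ((N - h)%:R / N%:R : R) by rewrite divr_ge0.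
have := @nu_lower R ((N - h)%:R / N%:R); rewrite ger0_norm // mulrA.
have -> : nu ((N - h)%:R / N%:R : R) = cn (1 - w N h).
  rewrite -nuN -(nuDint _ 1) /nu /w; congr (cn (1 - e _)).
  rewrite natrB 1?ltnW //= ; field; exact: lt0r_neq0.
by apply; rewrite ler_pdivrMr // mulrC mul1r ler_pdivlMr // -natrM ler_nat; lia.
Qed.

Lemma w_neq1 (N : nat) z : (0 < N)%N -> ~~ (N%:Z %| z)%Z -> w N z != 1.
Proof.
move=> N0 ndv; rewrite -w_mod //.
have : (z %% N)%Z != 0 by apply: contra ndv => /eqP/dvdz_mod0P.
have : 0 <= (z %% N)%Z by rewrite modz_ge0; lia.
have : (z %% N)%Z < N by rewrite ltz_pmod.
case: (z %% N)%Z => // h; rewrite ltz_nat => hN _ h0.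
have hh : (0 < h < N)%N by lia.
have := nu_w_ge hh; apply: contraTneq => ->; rewrite subrr cn0 -ltNge.
by rewrite !mulr_gt0 ?invr_gt0 ?ltr0n //; lia.
Qed.

Lemma geom_sum (t : C) n : (1 - t) * (\sum_(i < n) t ^+ i) = 1 - t ^+ n.
Proof. by rewrite -opprB mulNr -subrX1 opprB. Qed.

Lemma sum_w (N : nat) z : (0 < N)%N ->
  \sum_(x < N) w N (z * x%:Z) = if (N%:Z %| z)%Z then N%:R else 0.
Proof.
move=> N0; have [dv|ndv] := boolP (N%:Z %| z)%Z.
  rewrite (eq_bigr (fun=> 1)) ?sumr_const ?card_ord // => x _.
  by rewrite w_dvd // dvdz_mulr.

have t1 : 1 - w N z != 0 by rewrite subr_eq0 eq_sym w_neq1.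
apply: (mulfI t1); rewrite mulr0.
under eq_bigr => x _ do rewrite mulrC w_muln.
by rewrite geom_sum -w_muln w_dvd ?dvdz_mulr ?subrr.
Qed.

(** Orthogonality of the characters modulo q, in dispersion form. *)
Lemma dispersion (q Y : nat) (b : nat -> C) (phi : nat -> int) : (0 < q)%N ->
  ((\sum_(m < q) cn (\sum_(n < Y) b n * w q (phi n * m%:Z)) ^+ 2)%:C)%C =
  q%:R * \sum_(n < Y) \sum_(n' < Y | (q%:Z %| phi n - phi n')%Z) b n * ((b n')^*)%C.
Proof.
move=> q0; rewrite rmorph_sum /=.
under eq_bigr => m _ do rewrite cn_sqr_sum.
rewrite exchange_big mulr_sumr; apply: eq_bigr => n _ /=.
rewrite exchange_big [in RHS]big_mkcond mulr_sumr; apply: eq_bigr => n' _ /=.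
rewrite (eq_bigr (fun m : 'I_q => (b n * ((b n')^*)%C) * w q ((phi n - phi n') * m%:Z))).
  by rewrite -mulr_sumr sum_w //; case: ifP => _; rewrite ?mulr0 // mulrC.
move=> m _; rewrite mulrBl wB rmorphM /=; ring.
Qed.

Lemma dvdz_subn (q x y : nat) : (q%:Z %| x%:Z - y%:Z)%Z = (x == y %[mod q])%N.
Proof. by rewrite -eqz_mod_dvd !modz_nat eqz_nat. Qed.

Lemma count_congr (q Y : nat) (a : int) : (0 < q)%N ->
  (#|[pred n : 'I_Y | (q%:Z %| (a - n%:Z)%R)%Z]| <= Y %/ q + 1)%N.
Proof.
move=> q0; rewrite addn1.
have lt (n : 'I_Y) : (n %/ q < (Y %/ q).+1)%N.
  by rewrite ltnS leq_div2r // ltnW.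
pose f (n : 'I_Y) : 'I_(Y %/ q).+1 := Ordinal (lt n).
rewrite -[X in (_ <= X)%N]card_ord -(@card_in_image _ _ f) ?max_card //.
move=> n n'; rewrite !inE => dn dn' /(congr1 val) /= E.
have : (q%:Z %| n%:Z - n'%:Z)%Z.
  have -> : n%:Z - n'%:Z = (a - n'%:Z) - (a - n%:Z) by lia.
  by rewrite rpredB.
rewrite dvdz_subn => /eqP E1; apply/val_inj => /=.
by rewrite (divn_eq n q) (divn_eq n' q) E E1.
Qed.

(** Each class modulo q meets [0, Y) at most Y / q + 1 times. *)
Lemma dispersion_le (q Y : nat) (b : nat -> C) (phi : nat -> int) : (0 < q)%N ->
  (forall n, cn (b n) <= 1) ->
  (forall n n' : nat, (q%:Z %| phi n - phi n')%Z -> (q%:Z %| n%:Z - n'%:Z)%Z) ->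
  \sum_(m < q) cn (\sum_(n < Y) b n * w q (phi n * m%:Z)) ^+ 2 <=
  q%:R * (Y%:R * (Y%:R / q%:R + 1)).
Proof.
move=> q0 b1 phi1; set S := \sum_(m < q) _.
have S0 : 0 <= S by apply: sumr_ge0 => m _; apply: sqr_ge0.
rewrite -(ger0_norm S0) -cn_real dispersion // cnM cn_nat ler_wpM2l //.
apply: le_trans (cn_sum _ _ _) _.
apply: (@le_trans _ _ (\sum_(n < Y) (Y%:R / q%:R + 1))); last first.
  by rewrite sumr_const card_ord [leRHS]mulr_natl.
apply: ler_sum => n _; apply: le_trans (cn_sum _ _ _) _.
apply: (@le_trans _ _ (\sum_(n' < Y | (q%:Z %| n%:Z - n'%:Z)%Z) 1)).
  rewrite [leRHS]big_mkcond [leLHS]big_mkcond; apply: ler_sum => n' _.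
  case: ifP => [/phi1 ->|_]; last by case: ifP.
  by rewrite cnM cnJ -[1]mulr1 ler_pM ?cn_ge0.
rewrite sumr_const.
apply: (@le_trans _ _ ((Y %/ q + 1)%N%:R)); first by rewrite ler_nat count_congr.
rewrite natrD lerD2r ler_pdivlMr ?ltr0n // -natrM ler_nat; exact: leq_divM.
Qed.

Definition periodic (T : Type) (N : nat) (f : nat -> T) := forall x, f (x + N)%N = f x.

Lemma periodic_mod T N (f : nat -> T) x : periodic N f -> f x = f (x %% N)%N.
Proof.
move=> pf; rewrite {1}(divn_eq x N) addnC.
by elim: (x %/ N)%N => [|k IH]; rewrite ?addn0 // mulSn addnCA addnC pf.
Qed.

Lemma sum_shift (V : nmodType) N (f : nat -> V) a : periodic N f ->
  \sum_(x < N) f (x + a)%N = \sum_(x < N) f x.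
Proof.
move=> pf; elim: a => [|a IH]; first by apply: eq_bigr => x _; rewrite addn0.
rewrite -IH; case: N pf {IH} => [|N] pf; first by rewrite !big_ord0.
rewrite big_ord_recr big_ord_recl /= addrC; congr (_ + _).
  by rewrite add0n addnS -addSn addnC pf.
by apply: eq_bigr => x _; rewrite /bump /= add1n addnS.
Qed.

Lemma sum_blocks (V : nmodType) N (f : nat -> V) k : periodic N f ->
  \sum_(x < k * N) f x = (\sum_(x < N) f x) *+ k.
Proof.
move=> pf; elim: k => [|k IH]; first by rewrite big_ord0.
rewrite mulSn big_split_ord /= mulrS -IH; congr (_ + _).
by apply: eq_bigr => x _; rewrite addnC pf.
Qed.

(** A nonnegative periodic function, summed over an interval, is at most its sum
  over the periods that cover the interval. *)
Lemma sum_cover N (f : nat -> R) D a : (0 < N)%N -> periodic N f ->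
  (forall x, 0 <= f x) ->
  \sum_(x < D) f (a + x)%N <= (D%:R / N%:R + 1) * \sum_(x < N) f x.
Proof.
move=> N0 pf f0.
pose k := (D %/ N + 1)%N.
have Dk : (D <= k * N)%N by rewrite /k addn1 ltnW // ltn_ceil.
pose g x := f (x + a)%N.
have pg : periodic N g by move=> x; rewrite /g addnAC pf.
apply: (@le_trans _ _ (\sum_(x < k * N) g x)).
  rewrite -(subnKC Dk) big_split_ord /= -[leLHS]addr0 lerD //.
    by apply: ler_sum => x _; rewrite /g addnC.
  by apply: sumr_ge0 => x _; apply: f0.
rewrite sum_blocks // sum_shift // -[leLHS]mulr_natl ler_wpM2r ?sumr_ge0 //.
rewrite natrD lerD2r ler_pdivlMr ?ltr0n // -natrM ler_nat; exact: leq_divM.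
Qed.

(** For fixed coefficients b, the exponential sums attached to consecutive m are
  almost orthogonal; both type II estimates below rest on this. *)
Lemma large_sieve (N q : nat) (u : int) (D Y m0 : nat) (b : nat -> C) :
  (0 < N)%N -> q = (N %/ gcdn `|u|%N N)%N -> (forall n, cn (b n) <= 1) ->
  \sum_(m < D) cn (\sum_(n < Y) b n * w N (u * (m0 + m)%N%:Z * n%:Z)) ^+ 2 <=
  (D%:R + q%:R) * (Y%:R * (Y%:R / q%:R + 1)).
Proof.
move=> N0 qE b1.
pose g := gcdn `|u|%N N.
have g0 : (0 < g)%N by rewrite gcdn_gt0 N0 orbT.
have Nq : N = (q * g)%N by rewrite qE divnK // dvdn_gcdr.
have q0 : (0 < q)%N by move: N0; rewrite Nq muln_gt0 => /andP[].
have /dvdzP[u' uE] : (g%:Z %| u)%Z by rewrite dvdzE /= dvdn_gcdl.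
have cop : coprimez q u'.
  have : (g * gcdn `|u'| q = g)%N.
    rewrite muln_gcdr -{2}/g /g; congr gcdn; last by rewrite mulnC -Nq.
    by rewrite [in RHS]uE abszM mulnC.
  move=> /eqP; rewrite -{2}[g]muln1 eqn_pmul2l // => /eqP E.
  by rewrite /coprimez /gcdz /= gcdnC E.
have wE (m n : nat) : w N (u * m%:Z * n%:Z) = w q (u' * n%:Z * m%:Z).
  by rewrite Nq uE -[RHS](w_scale _ _ g0); congr w; ring.
pose F m := cn (\sum_(n < Y) b n * w q (u' * n%:Z * m%:Z)) ^+ 2.
have pF : periodic q F.
  move=> m; rewrite /F; congr (cn _ ^+ 2); apply: eq_bigr => n _; congr (_ * _).
  by rewrite PoszD mulrDr w_per.
have F0 x : 0 <= F x by apply: sqr_ge0.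
rewrite (eq_bigr (fun m : 'I_D => F (m0 + m)%N)); last first.
  move=> m _; rewrite /F; congr (cn _ ^+ 2); apply: eq_bigr => n _; congr (_ * _).
  exact: wE.
apply: le_trans (sum_cover _ _ q0 pF F0) _.
apply: le_trans (ler_wpM2l _ (@dispersion_le q Y b (fun n => u' * n%:Z) q0 b1 _)) _.
- by rewrite addr_ge0 ?divr_ge0.
- by move=> n n'; rewrite -mulrBr Gauss_dvdzr.
have q0' : q%:R != 0 :> R by rewrite pnatr_eq0 -lt0n.
by rewrite [leLHS](_ : _ = (D%:R + q%:R) * (Y%:R * (Y%:R / q%:R + 1))) //; field.
Qed.

Definition hat (N : nat) (f : nat -> C) (h : int) : C :=
  N%:R^-1 * \sum_(x < N) f x * w N (- (h * x%:Z)).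

Lemma hat_inv N (f : nat -> C) x : (0 < N)%N -> periodic N f ->
  f x = \sum_(h < N) hat N f h * w N (h%:Z * x%:Z).
Proof.
move=> N0 pf; 
rewrite /hat; under eq_bigr => h _ do rewrite -mulrA big_distrl /=.
rewrite -mulr_sumr exchange_big /=.
have N0' : N%:R != 0 :> C by rewrite pnatr_eq0 -lt0n.
have xN : (x %% N < N)%N by rewrite ltn_mod.
rewrite (bigD1 (Ordinal xN)) //= [X in _ + X]big1 ?addr0 => [|y yx].
  rewrite (eq_bigr (fun=> f x)); first by rewrite sumr_const card_ord -[f x *+ N]mulr_natl mulKf.
  move=> h _; rewrite -periodic_mod // -mulrA -wD w_dvd ?mulr1 //.
  rewrite addrC -mulrBr dvdz_mull //.
  by rewrite {1}(divn_eq x N) PoszD addrK PoszM dvdz_mull.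
rewrite (eq_bigr (fun h : 'I_N => f y * w N ((x%:Z - y%:Z) * h%:Z))); last first.
  by move=> h _; rewrite -mulrA -wD; congr (_ * w _ _); ring.
rewrite -mulr_sumr sum_w // ifF ?mulr0 //; apply/negP => dv.
case/eqP: yx; apply/val_inj => /=.
have /eqP -> : (x == y %[mod N])%N by rewrite -dvdz_subn.
by rewrite modn_small.
Qed.

Lemma parseval N (f : nat -> C) : (0 < N)%N ->
  \sum_(h < N) cn (hat N f h) ^+ 2 = N%:R^-1 * \sum_(x < N) cn (f x) ^+ 2.
Proof.
move=> N0; apply: (@complexI R).
have N0' : N%:R != 0 :> R by rewrite pnatr_eq0 -lt0n.
have -> : \sum_(h < N) cn (hat N f h) ^+ 2 =
  N%:R^-1 ^+ 2 * \sum_(h < N) cn (\sum_(x < N) f x * w N ((- x%:Z) * h%:Z)) ^+ 2.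
  rewrite mulr_sumr; apply: eq_bigr => h _; rewrite -exprMn /hat cnM cnV cn_nat.
  by congr ((_ * cn _) ^+ 2); apply: eq_bigr => x _; rewrite mulNr [x%:Z * _]mulrC.
rewrite rmorphM /= (dispersion N f (fun x => - x%:Z) N0) mulrA.
rewrite [in RHS]rmorphM rmorph_sum /=; congr (_ * _).
  rewrite -(rmorph_nat (real_complex R)) -rmorphM /=; congr (_%:C)%C.
  by rewrite expr2 mulfVK.
apply: eq_bigr => x _; rewrite sqr_cn (bigD1 x) /= ?subrr //.
rewrite big1 ?addr0 // => y /andP[dv yx]; case/eqP: yx; apply/val_inj.
have /eqP : (y == x %[mod N])%N.
  by rewrite -dvdz_subn; move: dv; rewrite opprK addrC.
by rewrite !modn_small.
Qed.

Lemma hat_le N (f : nat -> C) h B : (0 < N)%N -> (forall x, cn (f x) <= B) ->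
  cn (hat N f h) <= B.
Proof.
move=> N0 fB; have N0' : 0 < N%:R :> R by rewrite ltr0n.
rewrite cnM cnV cn_nat mulrC ler_pdivrMr //; apply: le_trans (cn_sum _ _ _) _.
apply: (@le_trans _ _ (\sum_(x < N) B)); last by rewrite sumr_const card_ord mulr_natr.
by apply: ler_sum => x _; rewrite cnM cn_w mulr1.
Qed.

(** Summation by parts: Fourier coefficients are controlled by the variation. *)
Lemma hat_variation N (f : nat -> C) (h : int) : (0 < N)%N -> periodic N f ->
  cn (hat N f h) * cn (1 - w N h) <=
  N%:R^-1 * \sum_(x < N) cn (f x.+1 - f x).
Proof.
move=> N0 pf; rewrite -cnM.
have -> : hat N f h * (1 - w N h) =
   - (N%:R^-1 * \sum_(x < N) (f x.+1 - f x) * w N (- (h * x%:Z))).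
  rewrite /hat -mulrA -mulrN; congr (_ * _).
  pose F x := f x * w N (- (h * x%:Z)).
  have pF : periodic N F.
    move=> x; rewrite /F pf; congr (_ * _).
    have -> : - (h * (x + N)%N%:Z) = - (h * x%:Z) + (- h) * N%:Z by rewrite PoszD; ring.
    exact: w_per.
  have E : \sum_(x < N) f x.+1 * w N (- (h * x%:Z)) = (\sum_(x < N) F x) * w N h.
    rewrite -(sum_shift 1 pF) big_distrl /=; apply: eq_bigr => x _.
    rewrite /F addn1 -mulrA -wD; congr (_ * w _ _); rewrite -addn1 PoszD; ring.
  have -> : \sum_(x < N) (f x.+1 - f x) * w N (- (h * x%:Z)) =
    \sum_(x < N) (f x.+1 * w N (- (h * x%:Z)) - F x).
    by apply: eq_bigr => x _; rewrite mulrBl.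
  by rewrite sumrB E mulrBr mulr1 opprB.
rewrite cnN cnM cnV cn_nat ler_wpM2l ?invr_ge0 //.
by apply: le_trans (cn_sum _ _ _) _; apply: ler_sum => x _; rewrite cnM cn_w mulr1.
Qed.

End Characters.

(** * Decimal digit sums *)

Section Digits.
Local Open Scope nat_scope.

(** Counting a fixed number of digits makes the digit sum additive under
  concatenation ([ds_add]) and periodic ([ds_per]). *)
Definition ds (k n : nat) : nat := \sum_(i < k) (n %/ 10 ^ i) %% 10.

Lemma ds0 n : ds 0 n = 0.
Proof. by rewrite /ds big_ord0. Qed.

Lemma ds_add a b n : ds (a + b) n = ds a n + ds b (n %/ 10 ^ a).
Proof.
rewrite /ds big_split_ord /=; congr (_ + _); apply: eq_bigr => i _.
by rewrite expnD divnMA.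
Qed.

Lemma ds1 n : ds 1 n = n %% 10.
Proof. by rewrite /ds big_ord1 expn0 divn1. Qed.

Lemma dsS k n : ds k.+1 n = n %% 10 + ds k (n %/ 10).
Proof. by rewrite -add1n ds_add ds1 expn1. Qed.

Lemma ds_modMl k n x : ds k (x * 10 ^ k + n) = ds k n.
Proof.
elim: k n => [|k IH] n; first by rewrite !ds0.
rewrite !dsS expnSr mulnA modnMDl; congr (_ + _).
by rewrite divnMDl // IH.
Qed.

Lemma ds_per k : periodic (10 ^ k) (ds k).
Proof. by move=> x; rewrite addnC -{1}[10 ^ k]mul1n ds_modMl. Qed.

Lemma ds_le k n : ds k n <= 9 * k.
Proof.
rewrite mulnC -{2}[k]card_ord -sum_nat_const; apply: leq_sum => i _.
by rewrite -ltnS ltn_pmod.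
Qed.

Lemma ds_mod9 k n : n < 10 ^ k -> ds k n = n %[mod 9].
Proof.
elim: k n => [|k IH] n nk; first by rewrite ds0; case: n nk.
rewrite dsS -modnDmr IH; last by rewrite ltn_divLR // -expnSr.
rewrite modnDmr {3}(divn_eq n 10); set a := n %/ 10; set r := n %% 10.
by rewrite (_ : a * 10 + r = a * 9 + (r + a)) ?modnMDl //; lia.
Qed.

Lemma ds_digit_sum k n : n < 10 ^ k -> digit_sum n = ds k n.
Proof.
move=> nk; rewrite /digit_sum /digits sumnE /mkseq big_map -(subn0 (trunc_log _ _).+1).
rewrite -/(index_iota 0 _) big_mkord.
have : ds (trunc_log 10 n).+1 n = ds k n; last by rewrite /ds.
have big j : n < 10 ^ j -> forall i, ds (j + i) n = ds j n.
  move=> nj i; rewrite ds_add divn_small // [X in _ + X]/ds big1 ?addn0 // => l _.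
  by rewrite div0n.
have nt : n < 10 ^ (trunc_log 10 n).+1 by apply: trunc_log_ltn.
case: (leqP k (trunc_log 10 n).+1) => [kt|/ltnW kt].
  by rewrite -(subnKC kt) big.
by rewrite -[in RHS](subnKC kt) big.
Qed.

Lemma sum_mul (V : nmodType) a b (F : nat -> V) :
  (\sum_(x < b * a) F x = \sum_(y < b) \sum_(z < a) F (y * a + z)%N)%R.
Proof.
elim: b => [|b IH]; first by rewrite !big_ord0.
by rewrite mulSnr big_split_ord big_ord_recr /= IH.
Qed.

(** The residues of m n advance by steps of m: each turn modulo P meets the window
  at most z / m + 1 times, and there are at most m Y / P + 1 turns. *)
Lemma count_window (m P z Y : nat) : 0 < m -> z <= P -> 0 < P ->
  #|[pred n : 'I_Y | P - z <= (m * n) %% P]| <= ((m * Y) %/ P + 1) * (z %/ m + 1).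
Proof.
move=> m0 zP P0.
pose i (n : nat) := (m * n) %/ P.
have iY (n : 'I_Y) : i n < (m * Y) %/ P + 1.
  by rewrite addn1 ltnS leq_div2r // leq_mul // ltnW.
pose f (n : 'I_Y) : nat := (m * n) %% P - (P - z).
have fz (n : 'I_Y) : (f n) %/ m < z %/ m + 1.
  rewrite addn1 ltnS leq_div2r //; have := ltn_pmod (m * n) P0; rewrite /f; lia.
pose F (n : 'I_Y) : 'I_((m * Y) %/ P + 1) * 'I_(z %/ m + 1) :=
  (Ordinal (iY n), Ordinal (fz n)).
rewrite -[X in _ <= X * _]card_ord -[X in _ <= _ * X]card_ord -card_prod.
rewrite -(@card_in_image _ _ F) ?max_card // => n n'; rewrite !inE => h h' [E1 E2].
apply/val_inj => /=.
have H1 := divn_eq (m * n) P; have H2 := divn_eq (m * n') P.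
have H3 := divn_eq (f n) m; have H4 := divn_eq (f n') m.
have L1 := ltn_pmod (f n) m0; have L2 := ltn_pmod (f n') m0.
rewrite /i in E1; rewrite -E1 in H2; rewrite -E2 in H4.
have near A B a b u v c : A = c + a -> B = c + b -> P - z <= a -> P - z <= b ->
    forall e', a - (P - z) = e' + u -> b - (P - z) = e' + v -> u < m -> v < m ->
    B < A + m.
  clear; lia.
have N1 := near _ _ _ _ _ _ _ H1 H2 h h' _ H3 H4 L1 L2.
have N2 := near _ _ _ _ _ _ _ H2 H1 h' h _ H4 H3 L2 L1.
case: (ltngtP n n') => // nn'.
  have : m * n + m <= m * n' by rewrite addnC -mulnS leq_mul2l nn' orbT.
  by rewrite leqNgt N1.
have : m * n' + m <= m * n by rewrite addnC -mulnS leq_mul2l nn' orbT.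
by rewrite leqNgt N2.
Qed.

End Digits.

Section DigitCharacter.
Variable R : realType.
Notation C := R[i].
Variable al : R.

Definition g (k n : nat) : C := e (al * (ds k n)%:R).

Lemma cn_g k n : cn (g k n) = 1. Proof. exact: cn_e. Qed.

Lemma g_per k : periodic (10 ^ k)%N (g k).
Proof. by move=> n; rewrite /g ds_per. Qed.

Lemma g_add a b n : g (a + b) n = g a n * g b (n %/ 10 ^ a)%N.
Proof. by rewrite /g ds_add natrD mulrDr eD. Qed.

(** The digits 0 and 1 alone already give the saving; the other eight are bounded
  trivially. *)
Lemma one_digit (be : R) : cn (\sum_(d < 10) e (be * d%:R)) <= 10 - nu be ^+ 2 / 4.
Proof.
rewrite big_ord_recl big_ord_recl /= mulr0 e0 mulr1 addrA.
apply: le_trans (cnD _ _) _.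
have n2 := nu_le2 be; have n0 := nu_ge0 be.
have H1 : cn (1 + e be) <= 2 - nu be ^+ 2 / 4.
  have p2 : 0 <= 2 - nu be ^+ 2 / 4 by nra.
  rewrite -(ler_pXn2r (n := 2)) ?nnegrE ?cn_ge0 //.
  rewrite cn1De_sqr; set t := nu be; nra.
have H2 : cn (\sum_(i < 8) e (be * (bump 0 (bump 0 i))%:R)) <= 8.
  apply: le_trans (cn_sum _ _ _) _.
  by rewrite (eq_bigr (fun=> 1)) ?sumr_const ?card_ord // => i _; rewrite cn_e.
apply: le_trans (lerD H1 H2) _; lra.
Qed.

(** The factor saved by a pair of digits. If x and y = 10 x - 9 al are the phases of
  two consecutive digits, then nu (9 al) <= 11 max (nu x, nu y), so one of the two
  digit sums is at most 10 (1 - nu (9 al)^2 / (40 * 121)). *)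
Definition save : R := 1 - nu (9 * al) ^+ 2 / 4840.

Lemma save_ge0 : 0 <= save.
Proof. rewrite /save; have := nu_le2 (9 * al); have := nu_ge0 (9 * al); nra. Qed.

Lemma save_le1 : save <= 1.
Proof. rewrite /save; have := nu_ge0 (9 * al); nra. Qed.

(** Pairing consecutive digits: their phases differ by the factor 10 and by 9 al, so
  they cannot both be close to integers unless 9 al is. *)
Lemma digit_sup W (th : R) :
  cn (\sum_(q < 10 ^ W) g W q * e (th * q%:R)) <= 10 ^+ W * save ^+ (W %/ 2).
Proof.
have step V t : cn (\sum_(q < 10 ^ V.+1) g V.+1 q * e (t * q%:R)) =
   cn (\sum_(d < 10) e ((al + t) * d%:R)) * cn (\sum_(q < 10 ^ V) g V q * e (10 * t * q%:R)).
  rewrite -cnM expnSr (sum_mul 10 _ (fun q => g V.+1 q * e (t * q%:R))).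
  rewrite mulrC big_distrl /=; congr cn.
  apply: eq_bigr => q _; rewrite big_distrr /=; apply: eq_bigr => d _.
  rewrite /g dsS modnMDl modn_small // divnMDl // divn_small // addn0.
  by rewrite -!eD; congr e; rewrite !natrD natrM; ring.
have pair t : cn (\sum_(d < 10) e ((al + t) * d%:R)) *
     cn (\sum_(d < 10) e ((al + 10 * t) * d%:R)) <= 100 * save.
  have h1 := one_digit (al + t); have h2 := one_digit (al + 10 * t).
  have := nuD (10 * (al + t)) (- (al + 10 * t)); rewrite nuN.
  have -> : 10 * (al + t) - (al + 10 * t) = 9 * al by ring.
  have := nu_muln 10 (al + t); rewrite /save.
  have := cn_ge0 (\sum_(d < 10) e ((al + t) * d%:R)).
  have := cn_ge0 (\sum_(d < 10) e ((al + 10 * t) * d%:R)).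
  move: h1 h2.
  have := nu_ge0 (al + t); have := nu_ge0 (al + 10 * t); have := nu_ge0 (9 * al).
  have := nu_le2 (al + t); have := nu_le2 (al + 10 * t).
  move: (nu (al + t)) (nu (al + 10 * t)) (nu (9 * al)) => x y z.
  move: (cn _) (cn _) => a b x2 y2 z0 y0 x0 ha hb a0 b0 k1 k2.
  have zx : z / 11 <= Num.max x y.
    by rewrite le_max; case: (lerP (z / 11) x) => // ?; lra.
  have m0 : 0 <= z / 11 by lra.
  move: zx; rewrite le_max => /orP[zx|zy].
    have : (z / 11) ^+ 2 <= x ^+ 2 by rewrite ler_pXn2r ?nnegrE.
    move=> s1; apply: (@le_trans _ _ ((10 - x ^+ 2 / 4) * 10)); last by lra.
    apply: ler_pM => //; nra.
  have : (z / 11) ^+ 2 <= y ^+ 2 by rewrite ler_pXn2r ?nnegrE.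
  move=> s1; apply: (@le_trans _ _ (10 * (10 - y ^+ 2 / 4))); last by lra.
  apply: ler_pM => //; nra.
have [n] := ubnP W; elim: n W th => // n IH [|[|W]] th Wn.
- by rewrite big_ord1 /g ds0 cnM !cn_e mulr1.
- rewrite mulr1 expn1; apply: le_trans (cn_sum _ _ _) _.
  by rewrite (eq_bigr (fun=> 1)) ?sumr_const ?card_ord // => i _; rewrite cnM cn_g cn_e mulr1.
rewrite !step mulrA.
have -> : (W.+2 %/ 2 = (W %/ 2).+1)%N by lia.
have -> : 10 ^+ W.+2 * save ^+ (W %/ 2).+1 = (100 * save) * (10 ^+ W * save ^+ (W %/ 2)) :> R.
  by rewrite !exprS; ring.
apply: ler_pM; [by rewrite mulr_ge0 ?cn_ge0 | exact: cn_ge0 | exact: pair | ].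
by apply: IH; lia.
Qed.

End DigitCharacter.

(** * Van der Corput's inequality and harmonic sums *)

Section VanDerCorput.
Variable R : realType.
Notation C := R[i].

Lemma sum_window (V : nmodType) M c L (G : nat -> V) : (c + L <= M)%N ->
  \sum_(N < M) (if (c <= N < c + L)%N then G (N - c)%N else 0) = \sum_(n < L) G n.
Proof.
move=> /subnKC <-; rewrite !big_split_ord /=.
rewrite big1 ?add0r => [|i _]; last by rewrite leqNgt ltn_ord.
rewrite [X in _ + X]big1 ?addr0 => [|i _]; last by rewrite ltnNge leq_addr andbF.
by apply: eq_bigr => i _; rewrite leq_addr ltn_add2l ltn_ord addnC addnK.
Qed.

(** Shifting n by H multiples of Z before applying Cauchy-Schwarz leaves only the
  correlations at these shifts; the average over m is taken inside. *)
Lemma vdc (D Y H Z : nat) (z : nat -> nat -> C) (A B : R) : (0 < H)%N -> 0 <= B ->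
  \sum_(m < D) \sum_(n < Y) cn (z m n) ^+ 2 <= A ->
  (forall s, (0 < s < H)%N ->
    cn (\sum_(m < D) \sum_(n < Y - s * Z) z m (n + s * Z)%N * ((z m n)^*)%C) <= B) ->
  \sum_(m < D) cn (\sum_(n < Y) z m n) ^+ 2 <= (Y + H * Z)%:R * (A / H%:R + B).
Proof.
move=> H0 B0 hA hB; pose M := (Y + H * Z)%N.
have HR : 0 < H%:R :> R by rewrite ltr0n.
pose zt s m N := if (s * Z <= N < s * Z + Y)%N then z m (N - s * Z)%N else 0.
have ztS s m : (s < H)%N -> \sum_(N < M) zt s m N = \sum_(n < Y) z m n.
  move=> sH; apply: sum_window.
  by rewrite addnC leq_add2l leq_mul2r ltnW ?orbT.
have step1 m : H%:R ^+ 2 * cn (\sum_(n < Y) z m n) ^+ 2 <=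
    M%:R * \sum_(N < M) cn (\sum_(s < H) zt s m N) ^+ 2.
  rewrite -exprMn -{1}(cn_nat R H) -cnM.
  apply: le_trans (cn_sqr_sum_le _).
  have -> : \sum_(N < M) \sum_(s < H) zt s m N = H%:R * \sum_(n < Y) z m n; last by [].
  rewrite exchange_big /= (eq_bigr (fun=> \sum_(n < Y) z m n)) => [|s _]; last exact: ztS.
  by rewrite sumr_const card_ord mulr_natl.
have corrB s s' : (s < s' < H)%N ->
    cn (\sum_(m < D) \sum_(N < M) zt s m N * ((zt s' m N)^*)%C) <= B.
  move=> /andP[ss' s'H]; have := hB (s' - s)%N.
  rewrite subn_gt0 ss' (leq_ltn_trans (leq_subr _ _) s'H) => /(_ isT); apply: le_trans.
  rewrite le_eqVlt; apply/orP; left; apply/eqP; congr cn; apply: eq_bigr => m _.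
  set L := (Y - _)%N.
  have cLM : (s' * Z + L <= M)%N.
    rewrite /L /M; have : (s' * Z <= H * Z)%N by rewrite leq_mul2r ltnW ?orbT.
    lia.
  rewrite -(sum_window (fun n => z m (n + (s' - s) * Z)%N * ((z m n)^*)%C) cLM).
  apply: eq_bigr => N _; rewrite /zt.
  have E : ((s' - s) * Z = s' * Z - s * Z)%N by rewrite mulnBl.
  have le : (s * Z <= s' * Z)%N by rewrite leq_mul2r ltnW ?orbT.
  rewrite /L E; move: (s * Z)%N (s' * Z)%N le => a b ab.
  case: ifP => c1; case: ifP => c2; case: ifP => c3; rewrite ?conjc0 ?mul0r ?mulr0 //;
    first [by exfalso; lia | by congr (z m _ * _); lia].
have corr s s' : (s < H)%N -> (s' < H)%N ->
    cn (\sum_(m < D) \sum_(N < M) zt s m N * ((zt s' m N)^*)%C) <=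
    (if s == s' then A else 0) + B.
  move=> sH s'H; case: (ltngtP s s') => ss'; rewrite ?add0r.
  - by apply: corrB; rewrite ss'.
  - rewrite -cnJ rmorph_sum /=.
    under eq_bigr => m _ do rewrite rmorph_sum /=.
    rewrite (eq_bigr (fun m : 'I_D => \sum_(N < M) zt s' m N * ((zt s m N)^*)%C)).
      by apply: corrB; rewrite ss'.
    by move=> m _; apply: eq_bigr => N _; rewrite rmorphM /= conjcK mulrC.
  rewrite ss' in sH *; apply: le_trans (_ : A <= _); last by rewrite lerDl.
  apply: le_trans hA; apply: le_trans (cn_sum _ _ _) _; apply: ler_sum => m _.
  apply: le_trans (cn_sum _ _ _) _.
  have c0 : (s' * Z + Y <= M)%N by rewrite addnC leq_add2l leq_mul2r ltnW ?orbT.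
  rewrite -(sum_window (fun n => cn (z m n) ^+ 2) c0); apply: ler_sum => N _.
  rewrite cnM cnJ /zt; case: ifP; rewrite ?cn0 ?mul0r //.
have step2 : H%:R ^+ 2 * \sum_(m < D) cn (\sum_(n < Y) z m n) ^+ 2 <=
    M%:R * (H%:R * A + H%:R ^+ 2 * B).
  rewrite mulr_sumr; apply: le_trans (ler_sum _ (fun (m : 'I_D) _ => step1 m)) _.
  rewrite -mulr_sumr ler_wpM2l //.
  set S := \sum_(m < D) _.
  have S0 : 0 <= S by apply: sumr_ge0 => m _; apply: sumr_ge0 => N _; apply: sqr_ge0.
  have SE : S%:C%C = \sum_(s < H) \sum_(s' < H) \sum_(m < D) \sum_(N < M)
       zt s m N * ((zt s' m N)^*)%C.
    rewrite /S rmorph_sum /=.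
    under eq_bigr => m _ do rewrite rmorph_sum /=.
    under eq_bigr => m _ do under eq_bigr => N _ do rewrite cn_sqr_sum.
    under eq_bigr => m _ do rewrite exchange_big /=.
    rewrite exchange_big /=; apply: eq_bigr => s _.
    under eq_bigr => m _ do rewrite exchange_big /=.
    by rewrite exchange_big.
  rewrite -(ger0_norm S0) -cn_real SE.
  apply: le_trans (cn_sum _ _ _) _.
  apply: (@le_trans _ _ (\sum_(s < H) (A + H%:R * B))); last first.
    by rewrite sumr_const card_ord -[leLHS]mulr_natl mulrDr mulrA expr2.
  apply: ler_sum => s _; apply: le_trans (cn_sum _ _ _) _.
  apply: le_trans (ler_sum _ (fun (s' : 'I_H) _ => corr s s' (ltn_ord s) (ltn_ord s'))) _.
  rewrite big_split /= sumr_const card_ord -[B *+ H]mulr_natl lerD2r.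
  rewrite (bigD1 s) //= eqxx big1 ?addr0 // => s' /negbTE.
  by rewrite eq_sym -(inj_eq val_inj) /= => ->.
rewrite -(ler_pM2l (_ : 0 < H%:R ^+ 2)) ?exprn_gt0 //; apply: le_trans step2 _.
rewrite le_eqVlt; apply/orP; left; apply/eqP; rewrite /M; field; exact: lt0r_neq0.
Qed.

End VanDerCorput.

Section Harmonic.
Variable R : realType.

(** Each decade contributes at most 9. *)
Lemma harmonic_pow10 (la : nat) :
  \sum_(h < 10 ^ la) h%:R^-1 <= (9 * la)%:R :> R.
Proof.
elim: la => [|la IH]; first by rewrite big_ord1 /= invr0 muln0.
have le : (10 ^ la <= 10 ^ la.+1)%N by rewrite leq_exp2l.
rewrite -(subnKC le) big_split_ord /= mulnS natrD addrC lerD //.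
apply: (@le_trans _ _ (\sum_(i < 10 ^ la.+1 - 10 ^ la) (10 ^ la)%:R^-1)).
  apply: ler_sum => i _.
  by rewrite lef_pV2 ?posrE ?ltr0n ?addn_gt0 ?expn_gt0 // ler_nat leq_addr.
rewrite sumr_const card_ord -[leLHS]mulr_natl.
have -> : (10 ^ la.+1 - 10 ^ la = 9 * 10 ^ la)%N by rewrite expnS; lia.
by rewrite natrM mulfK // pnatr_eq0 -lt0n expn_gt0.
Qed.

Lemma harmonic_sym (la : nat) :
  \sum_(h < 10 ^ la) (minn h (10 ^ la - h))%:R^-1 <= (18 * la + 1)%:R :> R.
Proof.
set P := (10 ^ la)%N; have P0 : (0 < P)%N by rewrite expn_gt0.
apply: (@le_trans _ _ (\sum_(h < P) (h%:R^-1 + (P - h)%:R^-1))).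
  apply: ler_sum => h _; rewrite /minn.
  by case: ifP => _; rewrite ?lerDl ?lerDr invr_ge0.
have H := harmonic_pow10 la; rewrite big_split /= -[18%N]/(9 + 9)%N mulnDl -addnA natrD.
rewrite lerD //.
rewrite (reindex_inj rev_ord_inj) /= (eq_bigr (fun i : 'I_P => (i.+1)%:R^-1)); last first.
  by move=> i _; rewrite subKn.
apply: (@le_trans _ _ (\sum_(h < P.+1) h%:R^-1)).
  by rewrite big_ord_recl /= invr0 add0r.
rewrite big_ord_recr /= natrD lerD // invf_le1 ?ltr0n // ler1n //.
Qed.
End Harmonic.

(** * Fourier analysis of a window of digits *)

Section WindowFourier.
Variable R : realType.
Notation C := R[i].

Lemma ortho_short (N Y : nat) (b : nat -> C) : (0 < N)%N -> (Y <= N)%N ->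
  \sum_(z < N) cn (\sum_(y < Y) b y * w R N (y%:Z * z%:Z)) ^+ 2 =
  N%:R * \sum_(y < Y) cn (b y) ^+ 2.
Proof.
move=> N0 YN; apply: (@complexI R).
rewrite (dispersion Y b (fun y => y%:Z) N0) [in RHS]rmorphM rmorph_sum /=.
rewrite rmorph_nat; congr (_ * _); apply: eq_bigr => y _.
rewrite sqr_cn (bigD1 y) /= ?subrr // big1 ?addr0 // => y' /andP[dv yy'].
case/eqP: yy'; apply/val_inj; move: dv; rewrite dvdz_subn => /eqP.
by rewrite !modn_small ?(leq_trans _ YN).
Qed.

Lemma partial_w (N Y : nat) (u : int) : (0 < N)%N -> ~~ (N%:Z %| u)%Z ->
  cn (\sum_(n < Y) w R N (u * n%:Z)) <= N%:R.
Proof.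
move=> N0 ndv; pose F n := w R N (u * n%:Z).
have pF : periodic N F by move=> n; rewrite /F PoszD mulrDr w_per.
rewrite (divn_eq Y N) big_split_ord /= (sum_blocks (f := F) _ pF) /F sum_w //.
rewrite (negbTE ndv) mul0rn add0r; apply: le_trans (cn_sum _ _ _) _.
rewrite (eq_bigr (fun=> 1)); last by move=> i _; rewrite cn_w.
by rewrite sumr_const card_ord ler_nat ltnW // ltn_mod.
Qed.

(** One of the primes 2 and 5 occurs fewer than v times in u, so at least la - v of
  its factors survive in the quotient. *)
Lemma pow10_quotient (u : int) (v la : nat) : (v <= la)%N -> ~~ ((10 ^ v)%N%:Z %| u)%Z ->
  (2 ^ (la - v) <= 10 ^ la %/ gcdn `|u| (10 ^ la))%N.
Proof.
move=> vla; set P := (10 ^ la)%N; have P0 : (0 < P)%N by rewrite expn_gt0.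
set gg := gcdn _ _; set q := (_ %/ _)%N; apply: contraR; rewrite -ltnNge => qs.
have Pq : P = (gg * q)%N by rewrite mulnC divnK // dvdn_gcdr.
have g0 : (0 < gg)%N by rewrite gcdn_gt0 P0 orbT.
have q0 : (0 < q)%N by move: P0; rewrite Pq muln_gt0 => /andP[].
have key p : prime p -> (2 <= p)%N -> logn p P = la -> (p ^ v %| gg)%N.
  move=> pp p2 lP; rewrite pfactor_dvdn //.
  have E : (logn p gg + logn p q = la)%N by rewrite -lognM // -Pq.
  have : (logn p q < la - v)%N; last by lia.
  rewrite -(ltn_exp2l _ _ (_ : 1 < 2)%N) //; apply: leq_ltn_trans qs.
  apply: (@leq_trans (p ^ logn p q)); first by case: (logn p q) => // j; rewrite leq_exp2r.
  by apply: dvdn_leq => //; rewrite pfactor_dvdnn.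
have lg p : logn p P = (la * logn p 10)%N by rewrite lognX.
have d2 : (2 ^ v %| gg)%N by apply: key => //; rewrite lg (_ : logn 2 10 = 1)%N ?muln1.
have d5 : (5 ^ v %| gg)%N by apply: key => //; rewrite lg (_ : logn 5 10 = 1)%N ?muln1.
have : (10 ^ v %| gg)%N.
  by rewrite -[10%N]/(2 * 5)%N expnMn Gauss_dvd ?d2 ?d5 // coprimeXl // coprimeXr.
by move=> d10; rewrite dvdzE /=; apply: dvdn_trans d10 (dvdn_gcdl _ _).
Qed.

Variable al : R.
Variables la W : nat.
Hypothesis W_la : (W <= la)%N.

Let P := (10 ^ la)%N.
Let Z := (10 ^ (la - W))%N.
Let Q := (10 ^ W)%N.

Let P0 : (0 < P)%N. Proof. by rewrite expn_gt0. Qed.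
Let Z0 : (0 < Z)%N. Proof. by rewrite expn_gt0. Qed.
Let Q0 : (0 < Q)%N. Proof. by rewrite expn_gt0. Qed.
Let PQZ : P = (Q * Z)%N. Proof. by rewrite -expnD subnKC. Qed.

(** The character of the digits in positions la - W to la - 1. *)
Definition win (x : nat) : C := g al W (x %/ Z).

Lemma win_per : periodic P win.
Proof. by move=> x; rewrite /win PQZ addnC divnMDl // addnC g_per. Qed.

Lemma cn_win x : cn (win x) = 1. Proof. exact: cn_g. Qed.

(** The function win is constant on blocks of length Z. *)
Lemma win_variation : \sum_(x < P) cn (win x.+1 - win x) <= (2 * Q)%:R.
Proof.
rewrite PQZ (sum_mul Z Q (fun x => cn (win x.+1 - win x))).
apply: (@le_trans _ _ (\sum_(y < Q) 2)); last first.
  by rewrite sumr_const card_ord -[leLHS]mulr_natl mulnC natrM.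
apply: ler_sum => y _.
have zl : (Z.-1 < Z)%N by rewrite prednK.
rewrite (bigD1 (Ordinal zl)) //= big1 ?addr0.
  by apply: le_trans (cnB _ _) _; rewrite !cn_win.
move=> z zZ'; rewrite /win -addnS !divnMDl //.
have zZ : (z.+1 < Z)%N.
  by move: zZ' (ltn_ord z); rewrite -(inj_eq val_inj) /=; move: Z0; lia.
by rewrite !divn_small ?subrr ?cn0 // ltnW.
Qed.

Definition wcorr (z x : nat) : C := win (x + z) * ((win x)^*)%C.

Lemma wcorr_per z : periodic P (wcorr z).
Proof. by move=> x; rewrite /wcorr addnAC !win_per. Qed.

Lemma cn_wcorr z x : cn (wcorr z x) = 1.
Proof. by rewrite cnM cnJ !cn_win mulr1. Qed.

Lemma wcorr_variation z : \sum_(x < P) cn (wcorr z x.+1 - wcorr z x) <= (4 * Q)%:R.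
Proof.
apply: (@le_trans _ _ (\sum_(x < P) (cn (win (x + z).+1 - win (x + z)%N) + cn (win x.+1 - win x)))).
  apply: ler_sum => x _; rewrite /wcorr addSn.
  set a := win (x + z).+1; set b := win (x + z)%N; set c := win x.+1; set d := win x.
  have -> : a * (c^*)%C - b * (d^*)%C = (a - b) * (c^*)%C + b * ((c - d)^*)%C.
    by rewrite rmorphB /=; ring.
  by apply: le_trans (cnD _ _) _; rewrite !cnM !cnJ !cn_win mulr1 mul1r.
rewrite big_split /=.
rewrite (sum_shift z (f := fun x => cn (win x.+1 - win x))); last first.
  by move=> x; rewrite -addSn !win_per.
by have := win_variation; rewrite -[4%N]/(2 + 2)%N mulnDl natrD => H; apply: lerD.
Qed.

Definition wcoef (z : nat) (l : int) : C := hat P (wcorr z) l.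

(** The bound that [hat_variation] gives for the coefficients of wcorr z, uniformly
  in z. *)
Definition cap (l : nat) : R := (l == 0)%:R + 2 * Q%:R * (minn l (P - l))%:R^-1.

Lemma cap_ge0 l : 0 <= cap l.
Proof. by rewrite addr_ge0 // mulr_ge0 // ?invr_ge0 // mulr_ge0. Qed.

Lemma wcoef_cap z l : (l < P)%N -> cn (wcoef z l) <= cap l.
Proof.
move=> lP; rewrite /cap; case: (posnP l) => [->|l0] /=.
  rewrite min0n invr0 mulr0 addr0; apply: hat_le => // x.
  by rewrite cn_wcorr.
rewrite add0r.
have lb : (0 < l < P)%N by rewrite l0.
have H1 := nu_w_ge R lb; have H2 := hat_variation l P0 (wcorr_per z).
have mR : 0 < (minn l (P - l))%:R :> R by rewrite ltr0n leq_min l0 subn_gt0.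
have PR : 0 < P%:R :> R by rewrite ltr0n.
rewrite ler_pdivlMr //.
have H3 : cn (wcoef z l) * (2 * (minn l (P - l))%:R / P%:R) <= P%:R^-1 * (4 * Q)%:R.
  apply: le_trans (ler_wpM2l (cn_ge0 _) H1) _; apply: le_trans H2 _.
  by rewrite ler_wpM2l ?invr_ge0 // wcorr_variation.
move: H3; rewrite mulrA ler_pdivrMr // natrM mulrAC mulVf ?lt0r_neq0 // mul1r.
move: (cn _) (minn _ _)%:R => a b; lra.
Qed.

Lemma sum_cap : \sum_(l < P) cap l <= 1 + 2 * Q%:R * (18 * la + 1)%:R.
Proof.
rewrite big_split /= -mulr_sumr lerD ?ler_wpM2l ?mulr_ge0 //; last exact: harmonic_sym.
rewrite (bigD1 (Ordinal P0)) //= big1 ?addr0 // => i; rewrite -(inj_eq val_inj) /=.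
by move=> /negbTE ->.
Qed.

Lemma wcoef_parseval z : \sum_(l < P) cn (wcoef z l) ^+ 2 = 1.
Proof.
rewrite parseval // (eq_bigr (fun=> 1)) => [|x _]; last by rewrite cn_wcorr expr1n.
by rewrite sumr_const card_ord mulVf // pnatr_eq0 -lt0n.
Qed.

(** As a function of z, wcoef z l has the Fourier coefficients
  hat win h * conj (hat win (h - l)); this is Parseval's identity for it. *)
Lemma wcoef_moment (l : int) :
  \sum_(z < P) cn (wcoef z l) ^+ 2 =
  P%:R * \sum_(h < P) cn (hat P win h) ^+ 2 * cn (hat P win (h%:Z - l)) ^+ 2.
Proof.
have E (z : nat) : wcoef z l =
    \sum_(h < P) (hat P win h * ((hat P win (h%:Z - l))^*)%C) * w R P (h%:Z * z%:Z).
  rewrite /wcoef {1}/hat /wcorr.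
  under eq_bigr => x _ do rewrite (hat_inv (x + z)%N P0 win_per) !big_distrl /=.
  rewrite exchange_big mulr_sumr /=; apply: eq_bigr => h _.
  rewrite [hat P win (h%:Z - l)]/hat rmorphM rmorph_sum fmorphV rmorph_nat /=.
  rewrite !mulr_sumr [in RHS]mulr_suml; apply: eq_bigr => x _.
  rewrite rmorphM /= -wN opprK PoszD.
  have E1 : w R P (h%:Z * (x%:Z + z%:Z)) * w R P (- (l * x%:Z)) =
      w R P ((h%:Z - l) * x%:Z) * w R P (h%:Z * z%:Z) by rewrite -!wD; congr w; ring.
  rewrite [RHS](_ : _ = P%:R^-1 * hat P win h * ((win x)^*)%C *
    (w R P ((h%:Z - l) * x%:Z) * w R P (h%:Z * z%:Z))); last by ring.
  rewrite -E1; ring.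
under eq_bigr => z _ do rewrite E.
rewrite (@ortho_short P P (fun h => hat P win h * ((hat P win (h%:Z - l))^*)%C)) //.
by congr (_ * _); apply: eq_bigr => h _; rewrite cnM cnJ exprMn.
Qed.

Definition block_hat (h : int) : C := Z%:R^-1 * \sum_(y < Z) w R P (- (h * y%:Z)).

(** The transform factors over quotient and remainder by Z, and the sum over
  quotients is the digit sum character of [digit_sup]. *)
Lemma win_hat_le (h : int) :
  cn (hat P win h) <= save al ^+ (W %/ 2) * cn (block_hat h).
Proof.
have -> : hat P win h = (Q%:R^-1 * \sum_(q < Q) g al W q * e (- (h%:~R / Q%:R) * q%:R))
   * block_hat h.
  rewrite /hat PQZ (sum_mul Z Q (fun x => win x * w R (Q * Z) (- (h * x%:Z)))) /block_hat -PQZ.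
  rewrite mulrACA -invfM -natrM -PQZ; congr (_ * _).
  rewrite big_distrl /=; apply: eq_bigr => q _; rewrite big_distrr /=; apply: eq_bigr => y _.
  rewrite /win divnMDl // divn_small ?addn0 // -mulrA; congr (_ * _).
  rewrite PoszD PoszM mulrDr opprD wD; congr (_ * _).
  have -> : - (h * (q%:Z * Z%:Z)) = (- (h * q%:Z)) * Z%:Z by ring.
  rewrite PQZ w_scale // /w; congr e; rewrite rmorphN rmorphM /=; ring.
rewrite cnM cnM cnV cn_nat ler_wpM2r ?cn_ge0 //.
rewrite ler_pdivrMl ?ltr0n //.
by apply: le_trans (digit_sup _ _ _) _; rewrite natrX.
Qed.

(** The frequencies l with Q dividing l s form an arithmetic progression of step
  Q / gcd (Q, s), on which characters of length Z are orthogonal. *)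
Lemma block_hat_moment (h : int) (s : nat) : (0 < s)%N ->
  \sum_(l < P | (Q %| l * s)%N) cn (block_hat (h - l%:Z)) ^+ 2 <= s%:R.
Proof.
move=> s0; pose d := gcdn Q s; pose q0 := (Q %/ d)%N.
have d0 : (0 < d)%N by rewrite gcdn_gt0 s0 orbT.
have Qd : Q = (q0 * d)%N by rewrite divnK // dvdn_gcdl.
have q00 : (0 < q0)%N by move: Q0; rewrite Qd muln_gt0 => /andP[].
have dvE l : (Q %| l * s)%N = (q0 %| l)%N.
  have [t sE] : exists t, s = (t * d)%N by apply/dvdnP; rewrite dvdn_gcdr.
  rewrite {1}sE mulnA {1}Qd dvdn_pmul2r // Gauss_dvdl //.
  have : (d * gcdn q0 t = d * 1)%N by rewrite muln_gcdr muln1 mulnC -Qd [(d * t)%N]mulnC -sE.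
  by move/eqP; rewrite eqn_pmul2l.
pose N := (d * Z)%N.
have PN : P = (N * q0)%N by rewrite PQZ Qd /N; lia.
have N0 : (0 < N)%N by rewrite muln_gt0 d0.
pose F (l : nat) : R := if (q0 %| l)%N then cn (block_hat (h - l%:Z)) ^+ 2 else 0.
rewrite big_mkcond (eq_bigr (fun l : 'I_P => F l)) => [|l _]; last by rewrite /F dvE.
rewrite PN (sum_mul q0 N F).
rewrite (eq_bigr (fun i : 'I_N => cn (block_hat (h - (i * q0)%N%:Z)) ^+ 2)); last first.
  move=> i _; rewrite -(prednK q00) big_ord_recl /= prednK // addn0 /F dvdn_mull // big1 ?addr0 //.
  move=> j _; rewrite dvdn_addr ?dvdn_mull // gtnNdvd //.
  by rewrite /bump /= add1n -[X in (_ < X)%N]prednK // ltnS ltn_ord.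
have -> : \sum_(i < N) cn (block_hat (h - (i * q0)%N%:Z)) ^+ 2 =
   Z%:R^-1 ^+ 2 * \sum_(i < N) cn (\sum_(y < Z) w R P (- (h * y%:Z)) * w R N (y%:Z * i%:Z)) ^+ 2.
  rewrite mulr_sumr; apply: eq_bigr => i _; rewrite -exprMn /block_hat cnM cnV cn_nat.
  congr ((_ * cn _) ^+ 2); apply: eq_bigr => y _.
  rewrite -[w R N _](w_scale _ _ _ q00) -PN -wD; congr w; rewrite PoszM; ring.
rewrite (@ortho_short N Z (fun y => w R P (- (h * y%:Z)))) ?leq_pmull //.
rewrite (eq_bigr (fun=> 1)) => [|y _]; last by rewrite cn_w expr1n.
rewrite sumr_const card_ord natrM.
have Z0' : Z%:R != 0 :> R by rewrite pnatr_eq0 -lt0n.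
rewrite (_ : _ * _ = d%:R); last by field.
by rewrite ler_nat dvdn_leq // dvdn_gcdr.
Qed.

(** The frequencies l for which l s / Q is an integer give no cancellation in n;
  the saving on them is that of [digit_sup]. *)
Lemma wcoef_resonant (s : nat) : (0 < s)%N ->
  \sum_(l < P | (Q %| l * s)%N) \sum_(z < P) cn (wcoef z l) ^+ 2 <=
  P%:R * (s%:R * save al ^+ (W %/ 2) ^+ 2).
Proof.
move=> s0; under eq_bigr => l _ do rewrite wcoef_moment.
rewrite -mulr_sumr ler_wpM2l // exchange_big /=.
apply: (@le_trans _ _ (\sum_(h < P) cn (hat P win h) ^+ 2 *
    (s%:R * save al ^+ (W %/ 2) ^+ 2))); last first.
  rewrite -mulr_suml parseval //.
  rewrite (eq_bigr (fun=> 1)) => [|x _]; last by rewrite cn_win expr1n.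
  by rewrite sumr_const card_ord mulVf ?mul1r // pnatr_eq0 -lt0n.
apply: ler_sum => h _; rewrite -mulr_sumr ler_wpM2l ?sqr_ge0 //.
apply: (@le_trans _ _ (\sum_(l < P | (Q %| l * s)%N)
    save al ^+ (W %/ 2) ^+ 2 * cn (block_hat (h%:Z - l%:Z)) ^+ 2)).
  apply: ler_sum => l _; rewrite -exprMn ler_pXn2r ?nnegrE ?cn_ge0 //.
    exact: win_hat_le.
  by rewrite mulr_ge0 ?cn_ge0 ?exprn_ge0 ?save_ge0.
rewrite -mulr_sumr mulrC ler_wpM2r ?sqr_ge0 //; exact: block_hat_moment.
Qed.

End WindowFourier.

(** * Correlations of the window character *)

Lemma congruent_far (P V x y : nat) : (0 < V)%N -> (V %| P)%N -> (x < P)%N -> (y < P)%N ->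
  (x == y %[mod V])%N -> y != x ->
  (V <= 2 * minn x (P - x) /\ 0 < x)%N \/ (V <= 2 * minn y (P - y) /\ 0 < y)%N.
Proof.
move=> V0 /dvdnP[t ->] xP yP /eqP E ne.
have H1 := divn_eq x V; have H2 := divn_eq y V; rewrite E in H1.
move: ne xP yP H1 H2 (ltn_pmod y V0).
move: (x %/ V)%N (y %/ V)%N (y %% V)%N => a b c ne xP yP Hx Hy cV.
have ab : (a < b)%N \/ (b < a)%N.
  by case: (ltngtP a b) => h; [left|right|move: ne; rewrite Hx Hy h eqxx].
have ta : (a.+1 <= t)%N by rewrite -(ltn_pmul2r V0); lia.
have tb : (b.+1 <= t)%N by rewrite -(ltn_pmul2r V0); lia.
have := leq_mul ta (leqnn V); have := leq_mul tb (leqnn V); rewrite !mulSn.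
case: ab => ab; have := leq_mul ab (leqnn V); rewrite mulSn; lia.
Qed.

Section CorrelationBound.
Variable R : realType.
Notation C := R[i].
Variable al : R.
Variables la W v : nat.
Hypothesis W_la : (W <= la)%N.
Hypothesis v_la : (v <= la)%N.

Let P := (10 ^ la)%N.
Let Z := (10 ^ (la - W))%N.
Let Q := (10 ^ W)%N.
Let P0 : (0 < P)%N. Proof. by rewrite expn_gt0. Qed.
Let Z0 : (0 < Z)%N. Proof. by rewrite expn_gt0. Qed.
Let Q0 : (0 < Q)%N. Proof. by rewrite expn_gt0. Qed.
Let PQZ : P = (Q * Z)%N. Proof. by rewrite -expnD subnKC. Qed.

Let wcap := cap R la W.
Let A1 : R := \sum_(l < P) wcap l.
Let K := wcorr al la W.

Let cap0 l : 0 <= wcap l. Proof. exact: cap_ge0. Qed.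
Let A10 : 0 <= A1. Proof. by apply: sumr_ge0 => l _. Qed.

(** Two distinct frequencies congruent modulo a high power of ten cannot both be
  small, and the larger one carries a small coefficient. *)
Lemma cap_congruent :
  \sum_(l < P) \sum_(l' < P | ((10 ^ v)%N%:Z %| l%:Z - l'%:Z)%Z && (l' != l)) wcap l * wcap l' <=
  16 * Q%:R * P%:R / (10 ^+ v) ^+ 2 * A1.
Proof.
set V := (10 ^ v)%N; have V0 : (0 < V)%N by rewrite expn_gt0.
have VR : 0 < V%:R :> R by rewrite ltr0n.
have -> : (10 ^+ v : R) = V%:R by rewrite /V natrX.
have VP : (V %| P)%N by rewrite dvdn_exp2l.
have small l : (0 < l < P)%N -> (V <= 2 * minn l (P - l))%N -> wcap l <= 4 * Q%:R / V%:R.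
  move=> /andP[l0 lP] h; rewrite /wcap /cap -/P -/Q gtn_eqF // add0r.
  have m0 : 0 < (minn l (P - l))%:R :> R by rewrite ltr0n leq_min l0 subn_gt0.
  rewrite ler_pdivrMr // mulrAC ler_pdivlMr //.
  have : V%:R <= 2 * (minn l (P - l))%:R :> R by rewrite -natrM ler_nat.
  have : 0 <= Q%:R :> R by [].
  move: (minn _ _)%:R V%:R Q%:R => a b c; nra.
have pair (l l' : 'I_P) : ((V%:Z %| l%:Z - l'%:Z)%Z && (l' != l)) ->
    wcap l * wcap l' <= 4 * Q%:R / V%:R * (wcap l + wcap l').
  move=> /andP[dv ne].
  have ne' : (l' : nat) != l by rewrite (inj_eq val_inj).
  have B0 : 0 <= 4 * Q%:R / V%:R :> R by rewrite divr_ge0 ?mulr_ge0 // ltW.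
  have : (V <= 2 * minn l (P - l) /\ 0 < l)%N \/ (V <= 2 * minn l' (P - l') /\ 0 < l')%N.
    by rewrite dvdz_subn in dv; exact: congruent_far V0 VP (ltn_ord l) (ltn_ord l') dv ne'.
  case=> [[h h0]|[h h0]].
    have c := small l _ h; rewrite h0 ltn_ord in c.
    apply: (@le_trans _ _ (4 * Q%:R / V%:R * wcap l')); first by rewrite ler_wpM2r // c.
    by rewrite ler_wpM2l // lerDr.
  have c := small l' _ h; rewrite h0 ltn_ord in c.
  apply: (@le_trans _ _ (4 * Q%:R / V%:R * wcap l)); first by rewrite mulrC ler_wpM2r // c.
  by rewrite ler_wpM2l // lerDl.
apply: (@le_trans _ _ (\sum_(l < P) \sum_(l' < P | (V%:Z %| l%:Z - l'%:Z)%Z)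
    4 * Q%:R / V%:R * (wcap l + wcap l'))).
  apply: ler_sum => l _; rewrite [leLHS]big_mkcond [leRHS]big_mkcond; apply: ler_sum => l' _.
  case: ifP => [h|_]; first by case/andP: (h) => -> _; apply: pair.
  by case: ifP => // _; rewrite mulr_ge0 ?addr_ge0 // divr_ge0 ?mulr_ge0 // ltW.
have cnt (l : nat) : (#|[pred l' : 'I_P | (V%:Z %| (l%:Z - l'%:Z)%R)%Z]|%:R <= 2 * P%:R / V%:R :> R).
  apply: le_trans (_ : (P %/ V + 1)%:R <= _); first by rewrite ler_nat count_congr.
  rewrite ler_pdivlMr // -!natrM ler_nat mulnDl divnK // mul1n mulSn mul1n leq_add2l.
  exact: dvdn_leq.
under eq_bigr => l _ do rewrite -mulr_sumr big_split /=.
rewrite -mulr_sumr big_split /=.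
have S1 : \sum_(l < P) \sum_(l' < P | (V%:Z %| l%:Z - l'%:Z)%Z) wcap l <= 2 * P%:R / V%:R * A1.
  rewrite mulr_sumr; apply: ler_sum => l _; rewrite sumr_const -[leLHS]mulr_natl.
  by rewrite ler_wpM2r //; exact: cnt.
have S2 : \sum_(l < P) \sum_(l' < P | (V%:Z %| l%:Z - l'%:Z)%Z) wcap l' <= 2 * P%:R / V%:R * A1.
  under eq_bigr => l _ do rewrite big_mkcond.
  rewrite exchange_big /=; apply: le_trans S1; apply: ler_sum => l _.
  rewrite -big_mkcond le_eqVlt; apply/orP; left; apply/eqP; apply: eq_bigl => l'.
  by rewrite -opprB rpredN.
apply: le_trans (ler_wpM2l _ (lerD S1 S2)) _; first by rewrite divr_ge0 ?mulr_ge0 // ltW.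
rewrite le_eqVlt; apply/orP; left; apply/eqP; field; exact: lt0r_neq0.
Qed.

Lemma sum_inj_le (D N : nat) (f : nat -> nat) (F : nat -> R) :
  (forall z, 0 <= F z) -> (forall M, (M < D)%N -> (f M < N)%N) ->
  (forall M M', (M < D)%N -> (M' < D)%N -> f M = f M' -> M = M') ->
  \sum_(M < D) F (f M) <= \sum_(z < N) F z.
Proof.
move=> F0 fN finj.
pose f' (M : 'I_D) : 'I_N := Ordinal (fN M (ltn_ord M)).
have f'inj : {in xpredT &, injective f'}.
  by move=> M M' _ _ /(congr1 val) /= /finj E; apply/val_inj/E.
rewrite (eq_bigr (fun M : 'I_D => F (f' M))) // -(big_imset (fun z : 'I_N => F z)) /=; last first.
  by move=> M M' _ _; apply: f'inj.
rewrite [leLHS]big_mkcond; apply: ler_sum => z _; by case: ifP.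
Qed.

(** Both factors are expanded in Fourier series. A pair of equal frequencies leaves a
  geometric sum of denominator dividing Q, which is at most Q outside the resonant
  frequencies of [wcoef_resonant]. A pair of distinct frequencies is handled by the
  large sieve, except when they are congruent modulo 10^v, where [cap_congruent]
  applies. *)
Lemma corr_bound (r s m0 D Y : nat) (E : R) : (0 < s)%N -> (0 < r)%N ->
  ((m0 + D + s * Z) * r <= P)%N -> 0 <= E ->
  D%:R * Y%:R * (D%:R * Y%:R / 2 ^+ (la - v) + D%:R + Y%:R + P%:R) <= E ^+ 2 ->
  \sum_(M < D) cn (\sum_(n < Y)
     K (r * (m0 + M + s * Z))%N ((m0 + M + s * Z) * n)%N *
     ((K (r * (m0 + M))%N ((m0 + M) * n)%N)^*)%C) <=
  D%:R * Q%:R + Y%:R * (P%:R * (s%:R * save al ^+ (W %/ 2) ^+ 2)) + A1 ^+ 2 * E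
  + D%:R * Y%:R * (16 * Q%:R * P%:R / (10 ^+ v) ^+ 2 * A1).
Proof.
move=> s0 r0 inj E0 hE.
pose m1 M := (m0 + M + s * Z)%N; pose m2 M := (m0 + M)%N.
pose a (M l : nat) := wcoef al la W (r * m1 M) l.
pose b (M l : nat) := wcoef al la W (r * m2 M) l.
pose T (M l l' : nat) := cn (\sum_(n < Y) w R P ((l%:Z * (m1 M)%:Z - l'%:Z * (m2 M)%:Z) * n%:Z)).
have T0 M l l' : 0 <= T M l l' by exact: cn_ge0.
have TY M l l' : T M l l' <= Y%:R.
  apply: le_trans (cn_sum _ _ _) _; rewrite (eq_bigr (fun=> 1)) => [|n _]; last by rewrite cn_w.
  by rewrite sumr_const card_ord.
have expand M : cn (\sum_(n < Y) K (r * m1 M)%N (m1 M * n)%N * ((K (r * m2 M)%N (m2 M * n)%N)^*)%C)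
   <= \sum_(l < P) \sum_(l' < P) cn (a M l) * cn (b M l') * T M l l'.
  have -> : \sum_(n < Y) K (r * m1 M)%N (m1 M * n)%N * ((K (r * m2 M)%N (m2 M * n)%N)^*)%C =
     \sum_(l < P) \sum_(l' < P) a M l * ((b M l')^*)%C *
       \sum_(n < Y) w R P ((l%:Z * (m1 M)%:Z - l'%:Z * (m2 M)%:Z) * n%:Z).
    under [RHS]eq_bigr => l _ do under eq_bigr => l' _ do rewrite mulr_sumr.
    under [RHS]eq_bigr => l _ do rewrite exchange_big /=.
    rewrite exchange_big /=; apply: eq_bigr => n _.
    have cj (x y : C) : ((x * y)^*)%C = (x^*)%C * (y^*)%C by rewrite rmorphM.
    have Kinv z x : K z x = \sum_(l < P) wcoef al la W z l * w R P (l%:Z * x%:Z).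
      exact: hat_inv (wcorr_per _ _ _).
    rewrite !Kinv.
    rewrite rmorph_sum big_distrl /=; apply: eq_bigr => l _.
    rewrite big_distrr /=; apply: eq_bigr => l' _.
    rewrite cj -wN mulrACA -wD; congr (_ * w _ _ _); rewrite !PoszM; ring.
  apply: le_trans (cn_sum _ _ _) _; apply: ler_sum => l _.
  apply: le_trans (cn_sum _ _ _) _; apply: ler_sum => l' _.
  by rewrite cnM (cnM (a M l)) cnJ.
have TE (M l l' : nat) : T M l l' = cn (\sum_(n < Y) w R P (l%:Z * (s * Z)%N%:Z * n%:Z) *
     w R P ((l%:Z - l'%:Z) * (m0 + M)%N%:Z * n%:Z)).
  congr cn; apply: eq_bigr => n _; rewrite -wD; congr w.
  by rewrite /m1 /m2 !PoszD !PoszM; ring.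
(* Equal frequencies: the phase is l s n / Q, so the sum over n is periodic in n of
   period dividing Q. *)
have diagT M l : T M l l <= Q%:R + (if (Q %| l * s)%N then Y%:R else 0).
  case: ifP => [_|/negbT nd]; first by apply: le_trans (TY _ _ _) _; rewrite lerDr.
  rewrite addr0 TE.
  rewrite (eq_bigr (fun n : 'I_Y => w R Q ((l * s)%N%:Z * n%:Z))) => [|n _].
    by apply: partial_w => //; rewrite dvdzE.
  rewrite -wD -[RHS](w_scale _ _ _ Z0) -PQZ; congr w; rewrite !PoszM; ring.
have amgm M l : cn (a M l) * cn (b M l) <= (cn (a M l) ^+ 2 + cn (b M l) ^+ 2) / 2.
  move: (cn _) (cn _) => x y; have := sqr_ge0 (x - y); nra.
have diag : \sum_(M < D) \sum_(l < P) cn (a M l) * cn (b M l) * T M l l <=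
    D%:R * Q%:R + Y%:R * (P%:R * (s%:R * save al ^+ (W %/ 2) ^+ 2)).
  pose h (M l : nat) := (cn (a M l) ^+ 2 + cn (b M l) ^+ 2) / 2.
  have h0 M l : 0 <= h M l by rewrite /h divr_ge0 ?addr_ge0 ?sqr_ge0.
  apply: (@le_trans _ _ (\sum_(M < D) \sum_(l < P)
     (h M l * Q%:R + (if (Q %| l * s)%N then Y%:R * h M l else 0)))).
    apply: ler_sum => M _; apply: ler_sum => l _.
    apply: le_trans (ler_pM _ (T0 _ _ _) (amgm M l) (diagT M l)) _; rewrite ?mulr_ge0 ?cn_ge0 //.
    by rewrite -/(h M l) mulrDr lerD2l; case: ifP; rewrite ?mulr0 // mulrC.
  under eq_bigr => M _ do rewrite big_split /=.
  rewrite big_split /= lerD //.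
    apply: sum_le_const => M.
    rewrite -mulr_suml -[leRHS]mul1r ler_wpM2r // /h -mulr_suml big_split /= !wcoef_parseval //; lra.
  rewrite exchange_big /=.
  apply: (@le_trans _ _ (\sum_(l < P | (Q %| l * s)%N)
      Y%:R * \sum_(z < P) cn (wcoef al la W z l) ^+ 2)).
    rewrite [leRHS]big_mkcond; apply: ler_sum => l _; case: ifP => _; last by rewrite big1.
    rewrite -mulr_sumr ler_wpM2l // /h -mulr_suml ler_pdivrMr // mulr_natr mulr2n big_split /=.
    have F0 z : 0 <= cn (wcoef al la W z l) ^+ 2 by apply: sqr_ge0.
    apply: lerD.
      apply: (@sum_inj_le D P (fun M => (r * m1 M)%N) _ F0) => M; rewrite /m1.
        by move=> MD; apply: leq_trans inj; rewrite mulnC ltn_pmul2r //; lia.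
      by move=> M' _ _ /eqP; rewrite eqn_pmul2l // => /eqP; lia.
    apply: (@sum_inj_le D P (fun M => (r * m2 M)%N) _ F0) => M; rewrite /m2.
      by move=> MD; apply: leq_trans inj; rewrite mulnC ltn_pmul2r //; lia.
    by move=> M' _ _ /eqP; rewrite eqn_pmul2l // => /eqP; lia.
  by rewrite -mulr_sumr ler_wpM2l // wcoef_resonant.
(* Distinct frequencies: unless 10^v divides l - l', the denominator of the phase is
   at least 2^(la - v). *)
have offT (l l' : 'I_P) : l' != l -> \sum_(M < D) T M l l' <=
    E + (if ((10 ^ v)%N%:Z %| l%:Z - l'%:Z)%Z then D%:R * Y%:R else 0).
  move=> ne; case: ifP => [_|/negbT nd].
    apply: le_trans (_ : D%:R * Y%:R <= _); last by rewrite lerDr.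
    by apply: sum_le_const.
  rewrite addr0 -(ler_pXn2r (n := 2)) ?nnegrE ?sumr_ge0 //.
  apply: le_trans hE; apply: le_trans (sqr_sum_le _) _.
  set q := (P %/ gcdn `|l%:Z - l'%:Z|%N P)%N.
  have qlow := pow10_quotient v_la nd; rewrite -/P -/q in qlow.
  have qP : (q <= P)%N by apply: leq_div.
  apply: le_trans (ler_wpM2l _ (_ : _ <= (D%:R + q%:R) * (Y%:R * (Y%:R / q%:R + 1)))) _ => //.
    rewrite (eq_bigr (fun M : 'I_D => cn (\sum_(n < Y) w R P (l%:Z * (s * Z)%N%:Z * n%:Z) *
      w R P ((l%:Z - l'%:Z) * (m0 + M)%N%:Z * n%:Z)) ^+ 2)) => [|M _]; last by rewrite TE.
    apply: (@large_sieve R P q _ D Y m0 (fun n => w R P (l%:Z * (s * Z)%N%:Z * n%:Z))) => // n.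
    by rewrite cn_w.
  have q0 : 0 < q%:R :> R by rewrite ltr0n (leq_trans _ qlow) // expn_gt0.
  have -> : D%:R * ((D%:R + q%:R) * (Y%:R * (Y%:R / q%:R + 1))) =
     D%:R * Y%:R * (D%:R * Y%:R / q%:R + D%:R + Y%:R + q%:R) :> R.
    by field; exact: lt0r_neq0.
  rewrite ler_wpM2l ?mulr_ge0 // lerD ?ler_nat // !lerD2r ler_wpM2l ?mulr_ge0 //.
  by rewrite lef_pV2 ?posrE ?exprn_gt0 // -natrX ler_nat.
have off : \sum_(M < D) \sum_(l < P) \sum_(l' < P | l' != l) cn (a M l) * cn (b M l') * T M l l' <=
    A1 ^+ 2 * E + D%:R * Y%:R * (16 * Q%:R * P%:R / (10 ^+ v) ^+ 2 * A1).
  rewrite exchange_big /=; under eq_bigr => l _ do rewrite exchange_big /=.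
  apply: (@le_trans _ _ (\sum_(l < P) \sum_(l' < P | l' != l) (wcap l * wcap l' * E +
     D%:R * Y%:R * (if ((10 ^ v)%N%:Z %| l%:Z - l'%:Z)%Z then wcap l * wcap l' else 0)))).
    apply: ler_sum => l _; apply: ler_sum => l' ne.
    apply: (@le_trans _ _ (wcap l * wcap l' * \sum_(M < D) T M l l')).
      rewrite mulr_sumr; apply: ler_sum => M _; rewrite ler_wpM2r // ler_pM ?cn_ge0 //.
        exact: wcoef_cap.
      exact: wcoef_cap.
    apply: le_trans (ler_wpM2l _ (offT l l' ne)) _; first by rewrite mulr_ge0.
    by rewrite mulrDr lerD2l; case: ifP; rewrite ?mulr0 // mulrC.
  under eq_bigr => l _ do rewrite big_split /=.
  rewrite big_split /= lerD //.
    rewrite expr2 -mulrA {1}/A1 mulr_suml; apply: ler_sum => l _.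
    rewrite {1}/A1 mulr_suml mulr_sumr [leLHS]big_mkcond; apply: ler_sum => l' _.
    by case: ifP => _; rewrite ?mulrA // !mulr_ge0.
  under eq_bigr => l _ do rewrite -mulr_sumr.
  rewrite -mulr_sumr ler_wpM2l ?mulr_ge0 //; apply: le_trans cap_congruent.
  apply: ler_sum => l _; rewrite -big_mkcondr le_eqVlt; apply/orP; left; apply/eqP.
  by apply: eq_bigl => l'; rewrite andbC.
apply: le_trans (ler_sum _ (fun (M : 'I_D) _ => expand M)) _.
rewrite -addrA; apply: le_trans (lerD diag off).
rewrite -big_split /=; apply: ler_sum => M _; rewrite -big_split /=; apply: ler_sum => l _.
by rewrite (bigD1 l).
Qed.

End CorrelationBound.

(** * The bilinear estimate for the digit character *)

Section TypeTwo.
Variable R : realType.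
Notation C := R[i].
Variable al : R.

(** When adding y does not carry past position la, the digits above that position
  cancel in the correlation. *)
Lemma truncate_top (k la x y : nat) : (la <= k)%N -> (x %% 10 ^ la + y < 10 ^ la)%N ->
  g al k (x + y) * ((g al k x)^*)%C = g al la (x + y) * ((g al la x)^*)%C.
Proof.
move=> lak nc; rewrite -(subnKC lak) !g_add rmorphM /=.
have -> : ((x + y) %/ 10 ^ la = x %/ 10 ^ la)%N.
  by rewrite {1}(divn_eq x (10 ^ la)) -addnA divnMDl ?expn_gt0 // (divn_small nc) addn0.
by rewrite mulrACA eJ mulr1.
Qed.

(** Adding multiples of 10^(la - W) leaves the lowest la - W digits unchanged. *)
Lemma cancel_low (la W x y u z : nat) : (W <= la)%N ->
  (exists a, x = u + a * 10 ^ (la - W))%N -> (exists a, y = z + a * 10 ^ (la - W))%N ->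
  (g al la x * ((g al la y)^*)%C) * ((g al la u * ((g al la z)^*)%C)^*)%C =
  (win al la W x * ((win al la W y)^*)%C) * ((win al la W u * ((win al la W z)^*)%C)^*)%C.
Proof.
move=> Wla [a xu] [b yz].
have ga X : g al la X = g al (la - W) X * win al la W X.
  by rewrite -{1}(subnK Wla) g_add.
have E1 : g al (la - W) x = g al (la - W) u.
  by rewrite xu /g addnC ds_modMl.
have E2 : g al (la - W) y = g al (la - W) z.
  by rewrite yz /g addnC ds_modMl.
rewrite !ga E1 E2 !rmorphM /= !conjcK.
have h1 : g al (la - W) u * ((g al (la - W) u)^*)%C = 1 by exact: eJ.
have h2 : g al (la - W) z * ((g al (la - W) z)^*)%C = 1 by exact: eJ.
set p := g al _ u in h1 *; set q := g al _ z in h2 *.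
rewrite [LHS](_ : _ = (p * (p^*)%C) * (q * (q^*)%C) * (win al la W x * ((win al la W y)^*)%C
  * (((win al la W u)^*)%C * win al la W z))); last by ring.
by rewrite h1 h2 !mul1r.
Qed.

(* The variable m0 + m runs over a block of integers with leading digits c, and the
   shifts r of n are below H; so a product m r stays below 10^(j + 2 rho), and the
   remaining rho digits below position la absorb almost all carries. *)
Variables k t W j c Y : nat.
Let rho := (4 * t)%N.
Let la := (j + 3 * rho)%N.
Let H := (10 ^ rho)%N.
Let D := (10 ^ j)%N.
Let m0 := (c * D)%N.
Let P := (10 ^ la)%N.
Let Z := (10 ^ (la - W))%N.
Let v := (la - la %/ 4)%N.

Hypothesis t0 : (0 < t)%N.
Hypothesis c_lo : (H <= 10 * c)%N.
Hypothesis c_hi : (c < H)%N.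
Hypothesis la_k : (la <= k)%N.
Hypothesis W_lo : (16 * t < W)%N.
Hypothesis W_hi : (160 * W + 12 <= la)%N.
Hypothesis W_ln : (36 * la + 3 <= 10 ^ W)%N.
Hypothesis j_lo : (10 * W + 1 <= j)%N.
Hypothesis Y_lo : (10 ^ (10 * W + 12 * t + 1) <= Y)%N.
Hypothesis save_lo : 4 * save al ^+ (W %/ 2) ^+ 2 * 10 ^+ (20 * t) <= 1.

Let W_la : (W <= la)%N. Proof. by move: W_hi; clear; lia. Qed.
Let D0 : (0 < D)%N. Proof. by rewrite expn_gt0. Qed.
Let H0 : (0 < H)%N. Proof. by rewrite expn_gt0. Qed.
Let Y0 : (0 < Y)%N. Proof. by apply: leq_trans Y_lo; rewrite expn_gt0. Qed.
Let DR : 0 < D%:R :> R. Proof. by rewrite ltr0n. Qed.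
Let YR : 0 < Y%:R :> R. Proof. by rewrite ltr0n. Qed.
Let HR : 0 < H%:R :> R. Proof. by rewrite ltr0n. Qed.
Let PDH : P = (D * H ^ 3)%N. Proof. by rewrite -expnM -expnD mulnC. Qed.
Let rho_half : rho = (2 * t * 2)%N. Proof. by rewrite /rho mulnAC. Qed.
Let shift_small : (H * Z <= D)%N.
Proof. by rewrite -expnD leq_exp2l //; move: W_lo W_la; rewrite /la /rho; clear; lia. Qed.
Let m0D : (m0 + D <= D * H)%N.
Proof. by rewrite /m0 -mulSnr mulnC leq_mul2l c_hi orbT. Qed.

Lemma pow10_le_pow2 : (10 ^ (10 * W) * 4 <= 2 ^ (la %/ 4))%N.
Proof.
apply: (@leq_trans (2 ^ (40 * W + 2))).
  rewrite expnD leq_mul2r /=.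
  by rewrite -[40%N]/(4 * 10)%N -mulnA (expnM 2 4) leq_exp2r //; move: W_lo; clear; lia.
by rewrite leq_exp2l //; move: W_hi; clear; lia.
Qed.

(** [corr_bound] with E = D Y / 10^(5 W): each of its four terms is then at most
  D Y / (4 H). *)
Lemma window_corr (r s : nat) : (0 < r < H)%N -> (0 < s < H)%N ->
  \sum_(M < D - s * Z) cn (\sum_(n < Y)
     wcorr al la W (r * (m0 + M + s * Z))%N ((m0 + M + s * Z) * n)%N *
     ((wcorr al la W (r * (m0 + M))%N ((m0 + M) * n)%N)^*)%C) <=
  D%:R * Y%:R / H%:R.
Proof.
move=> /andP[r0 rH] /andP[s0 sH].
have v_la : (v <= la)%N by apply: leq_subr.
have DsD : (D - s * Z <= D)%N by apply: leq_subr.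
pose E : R := D%:R * Y%:R / 10 ^+ (5 * W).
have X0 n : 0 < 10 ^+ n :> R by rewrite exprn_gt0.
have E0 : 0 <= E by rewrite divr_ge0 ?mulr_ge0 // ltW.
have inj : ((m0 + (D - s * Z) + s * Z) * r <= P)%N.
  have sZ : (s * Z <= D)%N by apply: leq_trans shift_small; rewrite leq_mul2r ltnW ?orbT.
  rewrite -addnA subnK // PDH; apply: (@leq_trans (D * H * H)).
    by apply: leq_mul; rewrite // ltnW.
  by rewrite -mulnA leq_mul2l -[(H * H)%N]/(H ^ 2)%N leq_pexp2l ?orbT.
have bD : D%:R^-1 <= (4 * 10 ^+ (5 * W) ^+ 2)^-1 :> R.
  rewrite lef_pV2 ?posrE ?mulr_gt0 // -exprM -natrX -natrM ler_nat.
  apply: (@leq_trans (10 ^ (5 * W * 2 + 1))).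
    by rewrite addn1 expnS leq_mul2r orbT.
  by rewrite leq_exp2l //; move: j_lo; clear; lia.
have bY : (H%:R ^+ 3) / Y%:R <= (4 * 10 ^+ (5 * W) ^+ 2)^-1 :> R.
  rewrite -[leRHS]mul1r ler_pdivlMr ?mulr_gt0 // mulrAC ler_pdivrMr // mul1r.
  rewrite -exprM -!natrX -!natrM ler_nat; apply: leq_trans Y_lo.
  rewrite -expnM [(10 * W + _ + 1)%N](_ : _ = rho * 3 + (1 + 5 * W * 2))%N; last first.
    by rewrite /rho; clear; lia.
  by rewrite !expnD !leq_mul.
have b2 : (2 ^+ (la - v))^-1 <= (4 * 10 ^+ (5 * W) ^+ 2)^-1 :> R.
  rewrite lef_pV2 ?posrE ?mulr_gt0 ?exprn_gt0 // -exprM -!natrX -natrM ler_nat.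
  rewrite (_ : la - v = la %/ 4)%N; last by rewrite /v subKn // leq_div.
  by apply: leq_trans pow10_le_pow2; rewrite mulnC leq_mul2r leq_exp2l //; clear; lia.
have b1Y : Y%:R^-1 <= (4 * 10 ^+ (5 * W) ^+ 2)^-1 :> R.
  apply: le_trans bY; rewrite -[leLHS]mul1r ler_wpM2r ?invr_ge0 //.
  by rewrite -natrX ler1n expn_gt0 H0.
have hE : (D - s * Z)%:R * Y%:R * ((D - s * Z)%:R * Y%:R / 2 ^+ (la - v) + (D - s * Z)%:R
    + Y%:R + P%:R) <= E ^+ 2.
  apply: (@le_trans _ _ (D%:R * Y%:R * (D%:R * Y%:R / 2 ^+ (la - v) + D%:R + Y%:R + P%:R))).
    have d : (D - s * Z)%:R <= D%:R :> R by rewrite ler_nat.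
    have p2 : 0 <= (2 ^+ (la - v))^-1 :> R by rewrite invr_ge0 exprn_ge0.
    apply: ler_pM; rewrite ?mulr_ge0 ?addr_ge0 ?mulr_ge0 //; first by rewrite ler_wpM2r // ltW.
    by rewrite !lerD2r lerD // ler_wpM2r // ler_wpM2r // ltW.
  have -> : D%:R * Y%:R * (D%:R * Y%:R / 2 ^+ (la - v) + D%:R + Y%:R + P%:R) =
     (D%:R * Y%:R) ^+ 2 * ((2 ^+ (la - v))^-1 + Y%:R^-1 + D%:R^-1 + H%:R ^+ 3 / Y%:R) :> R.
    rewrite PDH natrM natrX; by field; rewrite !lt0r_neq0 ?exprn_gt0.
  have -> : E ^+ 2 = (D%:R * Y%:R) ^+ 2 * (10 ^+ (5 * W) ^+ 2)^-1 by rewrite /E exprMn exprVn.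
  rewrite ler_wpM2l ?sqr_ge0 //.
  have : (10 ^+ (5 * W) ^+ 2)^-1 = 4 * (4 * 10 ^+ (5 * W) ^+ 2)^-1 :> R.
    by field; rewrite lt0r_neq0.
  move=> ->; move: bD bY b2 b1Y; set q := (4 * _)^-1.
  move: (_ ^-1) (_ ^-1) (_ ^-1) (_ / _) => A1 A2 A3 A4; lra.
apply: le_trans (corr_bound al W_la v_la s0 r0 inj E0 hE) _.
set A1 := \sum_(l < _) _.
have A1b : A1 <= 10 ^+ (2 * W).
  apply: le_trans (sum_cap _ _ _) _.
  have : (1 + 2 * 10 ^ W * (18 * la + 1) <= 10 ^ (2 * W))%N.
    rewrite [in leqRHS]mul2n -addnn expnD; have := leq_mul W_ln (leqnn (10 ^ W)).
    have : (0 < 10 ^ W)%N by rewrite expn_gt0.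
    move: (10 ^ W)%N => q; rewrite mulnDl; clear; lia.
  by rewrite -(ler_nat R) natrD !natrM !natrX.
have A10 : 0 <= A1 by apply: sumr_ge0 => l _; apply: cap_ge0.
have sR : s%:R <= H%:R :> R by rewrite ler_nat ltnW.
have dR : (D - s * Z)%:R <= D%:R :> R by rewrite ler_nat.
pose U : R := D%:R * Y%:R / H%:R / 4.
have U0 : 0 <= U by rewrite !divr_ge0 // mulr_ge0 // ltW.
have t1 : (D - s * Z)%:R * (10 ^ W)%:R <= U.
  apply: (@le_trans _ _ (D%:R * (10 ^ W)%:R)); first by rewrite ler_wpM2r.
  rewrite /U ler_pdivlMr // ler_pdivlMr // -!natrM ler_nat -!mulnA leq_mul2l.
  rewrite orbC [(4 * H)%N]mulnC; apply/orP; left; apply: leq_trans Y_lo; apply: (@leq_trans (10 ^ W * (10 ^ rho * 10))); last first.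
    by rewrite -expnSr -expnD leq_exp2l //; rewrite /rho; clear; lia.
  by rewrite leq_mul2l leq_mul2l orbC /= orbT.
have t2 : Y%:R * ((10 ^ la)%:R * (s%:R * save al ^+ (W %/ 2) ^+ 2)) <= U.
  set sv := save al ^+ _ ^+ 2; have sv0 : 0 <= sv by apply: sqr_ge0.
  apply: (@le_trans _ _ (Y%:R * (P%:R * (H%:R * sv)))).
    by rewrite !ler_wpM2l // ler_wpM2r.
  rewrite /U ler_pdivlMr // ler_pdivlMr // PDH natrM natrX.
  have h : 4 * sv * H%:R ^+ 5 <= 1.
    move: save_lo; rewrite -/sv; apply: le_trans; apply: ler_wpM2l; first by apply: mulr_ge0 sv0.
    by rewrite natrX -exprM ler_eXn2l ?ltr1n // /rho; clear; lia.
  rewrite [leLHS](_ : _ = D%:R * Y%:R * (4 * sv * H%:R ^+ 5)); last by ring.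
  by rewrite -[leRHS]mulr1 ler_wpM2l // mulr_ge0 // ltW.
have t3 : A1 ^+ 2 * E <= U.
  apply: (@le_trans _ _ (10 ^+ (2 * W) ^+ 2 * E)).
    by rewrite ler_wpM2r // ler_pXn2r ?nnegrE // ltW.
  rewrite /E /U [leLHS](_ : _ = D%:R * Y%:R * (10 ^+ (2 * W) ^+ 2 / 10 ^+ (5 * W))); last by ring.
  rewrite -[leRHS]mulrA -invfM; apply: ler_wpM2l; first by rewrite mulr_ge0.
  rewrite ler_pdivrMr // mulrC ler_pdivlMr ?mulr_gt0 // -!natrX -!natrM ler_nat -expnM mulnC.
  apply: (@leq_trans (10 ^ rho * 10 * 10 ^ (2 * W * 2))).
    by rewrite !leq_mul.
  by rewrite -expnSr -expnD leq_exp2l // /rho; move: W_lo; clear; lia.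
have t4 : (D - s * Z)%:R * Y%:R * (16 * (10 ^ W)%:R * (10 ^ la)%:R / (10 ^+ v) ^+ 2 * A1) <= U.
  have q0 : 0 <= (10 ^+ v ^+ 2)^-1 :> R by rewrite invr_ge0 sqr_ge0.
  apply: (@le_trans _ _ (D%:R * Y%:R * (16 * (10 ^ W)%:R * (10 ^ la)%:R / (10 ^+ v) ^+ 2
     * 10 ^+ (2 * W)))).
    apply: ler_pM; rewrite ?mulr_ge0 //; first by rewrite ler_wpM2r.
    by rewrite ler_wpM2l // !mulr_ge0.
  rewrite /U -[leRHS]mulrA -invfM; apply: ler_wpM2l; first by rewrite mulr_ge0.
  rewrite mulrAC ler_pdivrMr ?exprn_gt0 // [leRHS]mulrC ler_pdivlMr ?mulr_gt0 //.
  rewrite -!natrX -!natrM ler_nat -expnM.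
  apply: (@leq_trans (100 * (10 ^ W * 10 ^ la * 10 ^ (2 * W) * 10 ^ rho))).
    rewrite -/H; move: (10 ^ W)%N (10 ^ la)%N (10 ^ (2 * W))%N H => x1 x2 x3 x4.
    by rewrite [leqLHS](_ : _ = 64 * (x1 * x2 * x3 * x4))%N ?leq_mul //; ring.
  rewrite -[100%N]/(10 ^ 2)%N -!expnD leq_exp2l // /rho /v; move: W_lo W_hi; rewrite /la /rho; clear; lia.
have -> : D%:R * Y%:R / H%:R = U + U + U + U by rewrite /U; field; exact: lt0r_neq0.
by rewrite !lerD.
Qed.

(** The second use of van der Corput's inequality, in m and with shifts by multiples
  of Z, which removes the digits below the window. *)
Lemma window_sum (r : nat) : (0 < r < H)%N ->
  \sum_(n < Y) cn (\sum_(m < D) g al la ((m0 + m) * (n + r))%N *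
     ((g al la ((m0 + m) * n)%N)^*)%C) <= 2 * (D%:R * Y%:R) / 10 ^+ (2 * t).
Proof.
move=> rH; pose z (n m : nat) : C := g al la ((m0 + m) * (n + r))%N * ((g al la ((m0 + m) * n)%N)^*)%C.
have cz n m : cn (z n m) = 1 by rewrite cnM cnJ !cn_g mulr1.
pose B : R := D%:R * Y%:R / H%:R.
have B0 : 0 <= B by rewrite divr_ge0 ?mulr_ge0.
have hA : \sum_(n < Y) \sum_(m < D) cn (z n m) ^+ 2 <= D%:R * Y%:R.
  rewrite mulrC; apply: sum_le_const => n; rewrite -[leRHS]mulr1; apply: sum_le_const => m.
  by rewrite cz expr1n.
have hB s : (0 < s < H)%N ->
    cn (\sum_(n < Y) \sum_(m < D - s * Z) z n (m + s * Z)%N * ((z n m)^*)%C) <= B.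
  move=> sH; apply: le_trans (window_corr rH sH).
  rewrite exchange_big /=; apply: le_trans (cn_sum _ _ _) _; apply: ler_sum => m _.
  rewrite le_eqVlt; apply/orP; left; apply/eqP; congr cn; apply: eq_bigr => n _.
  rewrite /z /wcorr -addnA.
  have dist x : ((m0 + (m + s * Z)) * x = (m0 + m) * x + (s * x) * Z)%N by ring.
  rewrite (cancel_low (u := ((m0 + m) * (n + r))%N) (z := ((m0 + m) * n)%N) W_la); last first.
  - by exists (s * n)%N.
  - by exists (s * (n + r))%N.
  congr (_ * _); rewrite ?rmorphM /=.
    by congr (win _ _ _ _ * _); rewrite mulnDr [(r * _)%N]mulnC.
  by congr ((win _ _ _ _)^* * _)%C; rewrite mulnDr [(r * _)%N]mulnC.
have S1 := vdc (z := z) H0 B0 hA hB.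
have S2 : \sum_(n < Y) cn (\sum_(m < D) z n m) ^+ 2 <= 4 * D%:R ^+ 2 * Y%:R / H%:R.
  apply: le_trans S1 _.
  apply: (@le_trans _ _ ((2 * D%:R) * (D%:R * Y%:R / H%:R + B))).
    by rewrite ler_wpM2r ?addr_ge0 // -natrM ler_nat mul2n -addnn leq_add2l.
  by rewrite /B le_eqVlt; apply/orP; left; apply/eqP; field; exact: lt0r_neq0.
rewrite -(ler_pXn2r (n := 2)) ?nnegrE ?sumr_ge0 ?divr_ge0 ?mulr_ge0 ?exprn_ge0 //; last first.
  by move=> n _; apply: cn_ge0.
apply: le_trans (sqr_sum_le _) _; apply: le_trans (ler_wpM2l _ S2) _ => //.
have -> : H%:R = 10 ^+ (2 * t) ^+ 2 :> R by rewrite natrX -exprM -rho_half.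
by rewrite le_eqVlt; apply/orP; left; apply/eqP; field; rewrite lt0r_neq0 ?exprn_gt0.
Qed.

(** A carry past position la forces the residue of (m0 + m) n modulo P into a window
  of proportion 1 / H at the end of the period. *)
Lemma bad_pairs (r : nat) : (0 < r < H)%N ->
  \sum_(m < D) #|[pred n : 'I_Y | (P <= ((m0 + m) * n) %% P + (m0 + m) * r)%N]|%:R <=
  22 * (D%:R * Y%:R) / H%:R :> R.
Proof.
move=> /andP[r0 rH]; rewrite -[22 * _]mulrCA -mulrA; apply: sum_le_const => m.
set M := (m0 + m)%N.
have MDH : (M <= D * H)%N by apply: leq_trans m0D; rewrite leq_add2l ltnW.
have c0 : (0 < c)%N by move: c_lo H0; lia.
have M0 : (0 < M)%N by rewrite addn_gt0 muln_gt0 c0 D0.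
have DHM : (D * H <= 10 * M)%N.
  by rewrite /M /m0 mulnDr; apply: leq_trans (leq_addr _ _); rewrite mulnA mulnC leq_mul2r c_lo orbT.
pose z := (D * H * H)%N.
have P0 : (0 < P)%N by rewrite expn_gt0.
have zP : (z <= P)%N by rewrite PDH /z -mulnA leq_mul2l -[(H * H)%N]/(H ^ 2)%N leq_pexp2l ?orbT.
have rz : (M * r <= z)%N by apply: leq_mul => //; rewrite ltnW.
apply: (@le_trans _ _ (#|[pred n : 'I_Y | (P - z <= (M * n) %% P)%N]|%:R)).
  rewrite ler_nat -!sum1_card [X in (X <= _)%N]big_mkcond [X in (_ <= X)%N]big_mkcond.
  apply: leq_sum => n _; rewrite !inE; case: ifP => // h.
  by rewrite leq_subLR (leq_trans h) // addnC leq_add2r.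
apply: (@le_trans _ _ ((((M * Y) %/ P + 1) * (z %/ M + 1))%N%:R)).
  by rewrite ler_nat; apply: count_window.
have h1 : (z %/ M <= 10 * H)%N.
  by rewrite -ltnS ltn_divLR // /z mulSn; apply: (@leq_ltn_trans (10 * M * H)); 
     [rewrite leq_mul2r DHM orbT | rewrite mulnAC; lia].
have h2 : ((M * Y) %/ P)%N%:R <= Y%:R / H%:R ^+ 2 :> R.
  rewrite ler_pdivlMr ?exprn_gt0 // -natrX -natrM ler_nat.
  rewrite -(leq_pmul2r (_ : 0 < D * H)%N) ?muln_gt0 ?D0 //.
  rewrite -mulnA [(H ^ 2 * _)%N](_ : _ = P)%N; last by rewrite PDH; ring.
  apply: leq_trans (leq_divM _ _) _; by rewrite mulnC leq_mul2l MDH orbT.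
have h3 : 1 <= Y%:R / H%:R ^+ 2 :> R.
  rewrite ler_pdivlMr ?exprn_gt0 // mul1r -natrX ler_nat; apply: leq_trans Y_lo.
  by rewrite -expnM leq_exp2l // /rho; clear; lia.
have h4 : (z %/ M + 1)%:R <= 11 * H%:R :> R.
  by rewrite -natrM ler_nat; move: h1 H0; lia.
rewrite natrM; apply: (@le_trans _ _ ((2 * (Y%:R / H%:R ^+ 2)) * (11 * H%:R))).
  by apply: ler_pM => //; rewrite natrD mulr_natl mulr2n lerD.
by rewrite le_eqVlt; apply/orP; left; apply/eqP; field; exact: lt0r_neq0.
Qed.

(** The bilinear estimate for the digit character: two applications of van der
  Corput's inequality confine the problem to the window of W digits below
  position la, where Fourier analysis modulo 10^la applies. *)
Lemma typeII_digital (a b : nat -> C) :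
  (forall m, cn (a m) <= 1) -> (forall n, cn (b n) <= 1) ->
  cn (\sum_(m < D) \sum_(n < Y) a m * b n * g al k ((m0 + m) * n)%N) <=
  10 * (D%:R * Y%:R) / 10 ^+ t.
Proof.
move=> a1 b1; pose z (m n : nat) : C := b n * g al k ((m0 + m) * n)%N.
have cz m n : cn (z m n) <= 1 by rewrite cnM cn_g mulr1.
set S := \sum_(m < D) _.
have S1 : cn S ^+ 2 <= D%:R * \sum_(m < D) cn (\sum_(n < Y) z m n) ^+ 2.
  apply: le_trans (cn_sqr_sum_le _) _; rewrite ler_wpM2l //; apply: ler_sum => m _.
  rewrite ler_pXn2r ?nnegrE ?cn_ge0 //.
  under eq_bigr => n _ do rewrite -mulrA.
  by rewrite -mulr_sumr cnM -[leRHS]mul1r ler_wpM2r ?cn_ge0.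
have hA : \sum_(m < D) \sum_(n < Y) cn (z m n) ^+ 2 <= D%:R * Y%:R.
  apply: sum_le_const => m; rewrite -[leRHS]mulr1; apply: sum_le_const => n.
  by rewrite expr_le1 ?cn_ge0.
have T0 : 0 < 10 ^+ (2 * t) :> R by rewrite exprn_gt0.
pose B : R := 46 * (D%:R * Y%:R) / 10 ^+ (2 * t).
have B0 : 0 <= B by rewrite divr_ge0 ?mulr_ge0 // ltW.
have HT : (10 ^+ (2 * t)) ^+ 2 = H%:R :> R.
  by rewrite natrX -exprM -rho_half.
have T1 : 1 <= 10 ^+ (2 * t) :> R by rewrite exprn_ege1 // ler1n.
have hB r : (0 < r < H)%N ->
    cn (\sum_(m < D) \sum_(n < Y - r * 1) z m (n + r * 1)%N * ((z m n)^*)%C) <= B.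
  move=> rH; rewrite muln1 exchange_big /=.
  pose V n := cn (\sum_(m < D) g al la ((m0 + m) * (n + r))%N * ((g al la ((m0 + m) * n)%N)^*)%C).
  pose bad n : R := (#|[pred m : 'I_D | (P <= ((m0 + m) * n) %% P + (m0 + m) * r)%N]|)%:R.
  have Vn n : cn (\sum_(m < D) z m (n + r)%N * ((z m n)^*)%C) <= V n + 2 * bad n.
    have -> : \sum_(m < D) z m (n + r)%N * ((z m n)^*)%C = b (n + r)%N * ((b n)^*)%C *
       \sum_(m < D) g al k ((m0 + m) * (n + r))%N * ((g al k ((m0 + m) * n)%N)^*)%C.
      by rewrite mulr_sumr; apply: eq_bigr => m _; rewrite /z rmorphM /=; ring.
    rewrite cnM; set X := cn (\sum_(m < D) _); apply: (@le_trans _ _ (1 * X)).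
      by rewrite ler_wpM2r ?cn_ge0 // cnM cnJ -[1]mulr1 ler_pM ?cn_ge0.
    rewrite mul1r -lerBlDl /X.
    apply: le_trans (_ : cn (\sum_(m < D) (g al k ((m0 + m) * (n + r))%N *
      ((g al k ((m0 + m) * n)%N)^*)%C - g al la ((m0 + m) * (n + r))%N *
      ((g al la ((m0 + m) * n)%N)^*)%C)) <= _).
      rewrite lerBlDl /V sumrB; apply: le_trans (cnD _ _).
      by rewrite addrC subrK.
    apply: le_trans (cn_sum _ _ _) _; rewrite /bad mulrC -sum1_card natr_sum mulr_suml.
    rewrite [leRHS]big_mkcond; apply: ler_sum => m _; case: ifPn; rewrite inE => h.
      by rewrite mul1r; apply: le_trans (cnB _ _) _; rewrite !cnM !cnJ !cn_g mulr1.
    by rewrite mulnDr (truncate_top la_k) ?subrr ?cn0 // ltnNge.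
  apply: le_trans (cn_sum _ _ _) _.
  apply: (@le_trans _ _ (\sum_(n < Y) (V n + 2 * bad n))).
    have YrY : (Y - r <= Y)%N by apply: leq_subr.
    have pos n : 0 <= V n + 2 * bad n by rewrite addr_ge0 ?cn_ge0 ?mulr_ge0.
    rewrite -(subnKC YrY) big_split_ord /= -[leLHS]addr0 lerD ?sumr_ge0 //.
      by rewrite subnKC //; apply: ler_sum => n _; apply: Vn.
  rewrite big_split /= -mulr_sumr.
  have b1' : \sum_(n < Y) bad n <= 22 * (D%:R * Y%:R) / H%:R.
    apply: le_trans (bad_pairs rH); rewrite /bad.
    under eq_bigr => n _ do rewrite -sum1_card natr_sum big_mkcond.
    rewrite exchange_big /=; apply: ler_sum => m _; rewrite -sum1_card natr_sum [leRHS]big_mkcond.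
    by apply: ler_sum => n _.
  have b2 : \sum_(n < Y) V n <= 2 * (D%:R * Y%:R) / 10 ^+ (2 * t) by apply: window_sum.
  have b3 : 22 * (D%:R * Y%:R) / H%:R <= 22 * (D%:R * Y%:R) / 10 ^+ (2 * t) :> R.
    rewrite -HT ler_wpM2l ?mulr_ge0 // lef_pV2 ?posrE ?exprn_gt0 // expr2.
    by rewrite -[leLHS]mulr1 ler_wpM2l // ltW.
  have -> : B = 2 * (D%:R * Y%:R) / 10 ^+ (2 * t) + 2 * (22 * (D%:R * Y%:R) / 10 ^+ (2 * t)).
    by rewrite /B; field; exact: lt0r_neq0.
  by rewrite lerD // ler_wpM2l // (le_trans b1').
have S2 := vdc (z := z) H0 B0 hA hB.
have Hb : D%:R * Y%:R / H%:R <= (D%:R * Y%:R) / 10 ^+ (2 * t) :> R.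
  rewrite -HT ler_wpM2l ?mulr_ge0 // lef_pV2 ?posrE ?exprn_gt0 // expr2.
  by rewrite -[leLHS]mulr1 ler_wpM2l // ltW.
have HY : (H <= Y)%N.
  by apply: leq_trans Y_lo; rewrite leq_exp2l // /rho; clear; lia.
have S3 : cn S ^+ 2 <= D%:R * ((2 * Y%:R) * (47 * ((D%:R * Y%:R) / 10 ^+ (2 * t)))).
  apply: le_trans S1 _; rewrite ler_wpM2l //; apply: le_trans S2 _.
  apply: ler_pM; rewrite ?addr_ge0 ?divr_ge0 ?mulr_ge0 ?exprn_ge0 //.
    by rewrite -natrM ler_nat muln1 mul2n -addnn leq_add2l.
  have -> : 47 * (D%:R * Y%:R / 10 ^+ (2 * t)) = D%:R * Y%:R / 10 ^+ (2 * t) + B.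
    by rewrite /B; field; exact: lt0r_neq0.
  by rewrite lerD2r.
rewrite -(ler_pXn2r (n := 2)) ?nnegrE ?cn_ge0 ?divr_ge0 ?mulr_ge0 ?exprn_ge0 //.
apply: le_trans S3 _; rewrite mulnC exprM.
have t10 : 10 ^+ t != 0 :> R by rewrite lt0r_neq0 ?exprn_gt0.
have -> : (10 * (D%:R * Y%:R) / 10 ^+ t) ^+ 2 = D%:R * (2 * Y%:R * (50 * (D%:R * Y%:R / (10 ^+ t) ^+ 2))) :> R.
  by field.
have X0 : 0 <= D%:R * Y%:R / (10 ^+ t) ^+ 2 :> R by rewrite divr_ge0 ?sqr_ge0 ?mulr_ge0.
by rewrite ler_wpM2l // ler_wpM2l ?mulr_ge0 //; move: (_ / _) X0 => x; lra.
Qed.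

End TypeTwo.

(** * The functions of von Mangoldt and Moebius *)

Section ArithmeticFunctions.
Variable R : realType.
Notation C := R[i].

Lemma sum_multiples (V : nmodType) N d (F : nat -> V) : (0 < d)%N ->
  \sum_(e < N | (d %| e)%N) F e = \sum_(f < N | (d * f < N)%N) F (d * f)%N.
Proof.
move=> d0.
have lt (e : 'I_N) : (e %/ d < N)%N by apply: leq_ltn_trans (leq_div _ _) (ltn_ord e).
have [N0|N0] := posnP N; first by move: F; rewrite N0 => F; rewrite !big_ord0.
pose h (f : 'I_N) : 'I_N := insubd f (d * f)%N.
pose h' (e : 'I_N) : 'I_N := Ordinal (lt e).
have hE (f : 'I_N) : (d * f < N)%N -> h f = (d * f)%N :> nat.
  by move=> lf; rewrite /h val_insubd lf.
rewrite (reindex_onto h h') /=; last first.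
  move=> e de; apply/val_inj; have E : (d * h' e = e)%N by rewrite /= mulnC divnK.
  by apply: (etrans (hE (h' e) _) E); rewrite E.
apply: eq_big => [f|f /andP[df /eqP E]].
  apply/andP/idP => [[df /eqP E]|lf].
    have := ltn_ord (h f); rewrite -{2}E /= mulnC divnK //.
  rewrite hE // dvdn_mulr //; split => //; apply/eqP/val_inj => /=.
  by rewrite hE // mulKn.
by rewrite -{2}E /= mulnC divnK.
Qed.

(** Von Mangoldt's function, as a sum over the representations p ^ j = n. *)
Definition Lam (n : nat) : R :=
  \sum_(p < n.+1 | prime p) \sum_(j < n | (p ^ j.+1 == n)%N) ln p%:R.

Lemma ln_nat_ge0 n : 0 <= ln n%:R :> R.
Proof. by case: n => [|n]; [rewrite ln0 | rewrite ln_ge0 // ler1n]. Qed.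

Lemma ln_nat_le m n : (0 < m)%N -> (m <= n)%N -> ln m%:R <= ln n%:R :> R.
Proof. by move=> m0 mn; rewrite ler_ln ?posrE ?ltr0n ?ler_nat // (leq_trans m0). Qed.

Lemma Lam_ge0 n : 0 <= Lam n.
Proof. by apply: sumr_ge0 => p _; apply: sumr_ge0 => j _; apply: ln_nat_ge0. Qed.

Lemma Lam_widen n N : (n < N)%N ->
  Lam n = \sum_(p < N | prime p) \sum_(j < N | (p ^ j.+1 == n)%N) ln p%:R.
Proof.
move=> nN; rewrite /Lam.
have inner (p : nat) : prime p -> \sum_(j < n | (p ^ j.+1 == n)%N) ln p%:R =
   \sum_(j < N | (p ^ j.+1 == n)%N) ln p%:R :> R.
  move=> pp; rewrite (big_ord_widen_cond N (fun j => p ^ j.+1 == n)%N (fun=> ln p%:R)) ?(ltnW nN) //.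
  apply: eq_bigl => j; case: eqP => //= E; rewrite -E.
  by rewrite (leq_trans (ltn_expl j (prime_gt1 pp))) // leq_exp2l ?prime_gt1.
rewrite (eq_bigr (fun p : 'I_n.+1 => \sum_(j < N | (p ^ j.+1 == n)%N) ln p%:R)); last first.
  by move=> p /inner.
rewrite (big_ord_widen_cond N (fun p => prime p)
  (fun p => \sum_(j < N | (p ^ j.+1 == n)%N) ln p%:R)) //.
rewrite [RHS]big_mkcond [LHS]big_mkcond; apply: eq_bigr => p _.
case: (boolP (prime p)) => //= pp; case: ifP => // /negbT; rewrite -leqNgt => np.
rewrite big_pred0 // => j; apply/negbTE/negP => /eqP E; move: np; rewrite -E.
apply/negP; rewrite -leqNgt -{1}[p : nat]expn1.
by rewrite leq_exp2l ?prime_gt1.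
Qed.

Lemma ln_factor n : (0 < n)%N -> ln n%:R = \sum_(p < n.+1) (logn p n)%:R * ln p%:R :> R.
Proof.
move=> n0; rewrite -{1}(partnT n0) /partn big_mkord natr_prod.
have [_ ->] // : 0 < \prod_(p < n.+1 | (p : nat) \in predT) (p ^ logn p n)%:R :> R /\
  ln (\prod_(p < n.+1 | (p : nat) \in predT) (p ^ logn p n)%:R) =
  \sum_(p < n.+1) (logn p n)%:R * ln p%:R :> R.
elim/big_rec2: _ => [|p y x _ [IH0 IH]]; first by rewrite ln1.
have [lp|lp] := posnP (logn p n).
  by rewrite lp expn0 mul1r mul0r add0r.
have pp : (0 < p)%N by move: lp; rewrite logn_gt0 mem_primes => /andP[/prime_gt0].
have p1 : 0 < (p ^ logn p n)%:R :> R by rewrite ltr0n expn_gt0 pp.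
by rewrite mulr_gt0 // lnM ?posrE // IH natrX lnXn ?ltr0n // mulr_natl.
Qed.

Lemma sum_Lam n N : (0 < n < N)%N -> \sum_(c < N | (c %| n)%N) Lam c = ln n%:R.
Proof.
move=> /andP[n0 nN].
under eq_bigr => c _ do rewrite (Lam_widen (ltn_ord c)).
rewrite exchange_big /=.
transitivity (\sum_(p < N | prime p) (logn p n)%:R * ln p%:R : R).
  apply: eq_bigr => p pp.
  under eq_bigr => c _ do rewrite big_mkcond.
  rewrite exchange_big /=.
  transitivity (\sum_(j < N | (j < logn p n)%N) ln p%:R : R).
    rewrite [RHS]big_mkcond; apply: eq_bigr => j _.
    rewrite -big_mkcondr /=.
    have [jl|jl] := ltnP j (logn p n); last first.
      rewrite big_pred0 // => c; apply/negbTE/negP => /andP[cn /eqP E]; move: cn.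
      by rewrite -E pfactor_dvdn // ltnNge jl.
    have dv : (p ^ j.+1 %| n)%N by rewrite pfactor_dvdn.
    have lt : (p ^ j.+1 < N)%N by apply: leq_ltn_trans nN; apply: dvdn_leq.
    rewrite (big_pred1 (Ordinal lt)) // => c /=.
    rewrite -(inj_eq val_inj) /= eq_sym; case: eqP => [->|]; rewrite ?dv ?andbF //.
  have lN : (logn p n <= N)%N.
    by apply: leq_trans (ltnW nN); apply: ltnW; apply: ltn_logl.
  rewrite -(big_ord_widen _ (fun=> ln p%:R)) // sumr_const card_ord mulr_natl //.
rewrite ln_factor // (big_ord_widen_cond N xpredT (fun p => (logn p n)%:R * ln p%:R)) //.
rewrite [LHS]big_mkcond [RHS]big_mkcond; apply: eq_bigr => p _ /=.
case: ifP => pp; case: ifP => // pn.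
  have -> : logn p n = 0%N; last by rewrite mul0r.
  apply/eqP; rewrite -leqn0 leqNgt logn_gt0 mem_primes; apply/negP => /and3P[_ _ /dvdn_leq].
  by rewrite n0 => /(_ isT); rewrite leqNgt; move/negbT: pn; rewrite -leqNgt => ->.
by rewrite lognE pp mul0r.
Qed.

(** Moebius' function. *)
Definition mu (n : nat) : R :=
  if all (fun p => logn p n == 1)%N (primes n) then (-1) ^+ size (primes n) else 0.

Lemma mu_le1 n : `|mu n| <= 1.
Proof. by rewrite /mu; case: ifP => _; rewrite ?normr0 // normrX normrN1 expr1n. Qed.

Lemma mu1 : mu 1 = 1.
Proof. by rewrite /mu /=. Qed.

Lemma mu_mulp p d : prime p -> (0 < d)%N -> mu (p * d) = if (p %| d)%N then 0 else - mu d.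
Proof.
move=> pp d0; have p0 := prime_gt0 pp.
have pd0 : (0 < p * d)%N by rewrite muln_gt0 p0.
case: ifP => [pd|/negbT pd].
  rewrite /mu ifF //; apply/negbTE/allPn; exists p.
    by rewrite mem_primes pp pd0 dvdn_mulr.
  rewrite lognM // logn_prime // eqxx; have : (0 < logn p d)%N by rewrite logn_gt0 mem_primes pp d0.
  by case: (logn p d).
have ps : perm_eq (primes (p * d)) (p :: primes d).
  apply: uniq_perm; rewrite /= ?primes_uniq ?andbT //; first by rewrite mem_primes pp d0.
  by move=> q; rewrite primesM // primes_prime // !inE.
rewrite /mu (perm_all _ ps) (perm_size ps) /= exprS mulN1r.
have lp : logn p d = 0%N by apply/eqP; rewrite -leqn0 leqNgt logn_gt0 mem_primes pp d0.
rewrite lognM // logn_prime // eqxx lp /=.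
rewrite (_ : all _ (primes d) = all (fun q => logn q d == 1)%N (primes d)).
  by case: ifP; rewrite ?oppr0.
apply: eq_in_all => q; rewrite mem_primes => /and3P[qp _ qd].
rewrite lognM // logn_prime //; case: (q =P p) => // E.
by move: pd; rewrite -E qd.
Qed.

(** For a prime p dividing n, the divisors d prime to p cancel against p d. *)
Lemma sum_mu n N : (0 < n < N)%N -> \sum_(d < N | (d %| n)%N) mu d = (n == 1)%:R.
Proof.
move=> /andP[n0 nN]; case: eqP => [n1|/eqP n1].
  rewrite n1 in n0 nN *; rewrite (big_pred1 (Ordinal nN)) ?mu1 // => d.
  by rewrite dvdn1 /= -(inj_eq val_inj).
have pp : prime (pdiv n) by rewrite pdiv_prime //; lia.
set p := pdiv n in pp; have pn : (p %| n)%N by apply: pdiv_dvd.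
have p0 := prime_gt0 pp.
rewrite (bigID (fun d : 'I_N => (p %| d)%N)) /=.
have -> : \sum_(d < N | (d %| n)%N && (p %| d)%N) mu d =
  \sum_(d < N | (p %| d)%N) (if (d %| n)%N then mu d else 0) by rewrite big_andbC big_mkcondr.
rewrite (sum_multiples N (fun d => if (d %| n)%N then mu d else 0) p0).
rewrite big_mkcond [X in _ + X]big_mkcond /= -big_split big1 //= => d _.
have [m nE] : exists m, n = (p * m)%N by exists (n %/ p)%N; rewrite mulnC divnK.
have m0 : (0 < m)%N by move: n0; rewrite nE muln_gt0 => /andP[].
case: (boolP (p %| d)%N) => pd /=.
  rewrite andbF addr0; case: ifP => // _; case: ifP => // dn.
  have d0 : (0 < d)%N.
    by rewrite lt0n; apply: contraTneq dn => ->; rewrite muln0 dvd0n -lt0n.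
  by rewrite mu_mulp // pd.
rewrite andbT.
have E : (d %| n)%N = (p * d %| n)%N.
  rewrite nE dvdn_pmul2l // Gauss_dvdr // coprime_sym prime_coprime //.
rewrite -E; case: (boolP (d %| n)%N) => dn; last by case: ifP; rewrite addr0.
have d0 : (0 < d)%N by apply: dvdn_gt0 dn.
rewrite ifT; first by rewrite mu_mulp // (negbTE pd) addNr.
by apply: leq_ltn_trans nN; apply: dvdn_leq => //; rewrite -E.
Qed.

End ArithmeticFunctions.

(** * Vaughan's identity *)

Ltac nneg := repeat first [done | apply: addr_ge0 | apply: mulr_ge0 | rewrite invr_ge0
  | apply: exprn_ge0 | apply: ler0n | apply: cn_ge0 | apply: ltW].

Section VaughanTools.
Variable R : realType.
Notation C := R[i].

(** Divisor sums, organised by the quotient. *)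
Lemma dirichlet (A : comNzRingType) x (a Phi : nat -> A) : Phi 0%N = 0 -> (forall n, (x <= n)%N -> Phi n = 0) ->
  \sum_(c < x) a c * (\sum_(f < x) Phi (c * f)%N) =
  \sum_(n < x) (\sum_(c < x | (c %| n)%N) a c) * Phi n.
Proof.
move=> P0 Px.
have E (c : 'I_x) : \sum_(f < x) Phi (c * f)%N = \sum_(n < x | (c %| n)%N) Phi n.
  have [c0|c0] := posnP c.
    rewrite c0 big1 => [|f _]; last by rewrite mul0n.
    by rewrite big1 // => n; rewrite dvd0n => /eqP ->.
  rewrite (sum_multiples x Phi c0) [RHS]big_mkcond; apply: eq_bigr => f _.
  by case: ltnP => // /Px.
under eq_bigr => c _ do rewrite E mulr_sumr big_mkcond.
rewrite exchange_big; apply: eq_bigr => n _.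
by rewrite -big_mkcond mulr_suml.
Qed.

Lemma dirichlet_mu x (Phi : nat -> C) : Phi 0%N = 0 -> (forall n, (x <= n)%N -> Phi n = 0) ->
  \sum_(d < x) (mu R d)%:C * (\sum_(f < x) Phi (d * f)%N) = Phi 1%N.
Proof.
move=> P0 Px; rewrite (@dirichlet _ _ (fun d => (mu R d)%:C) Phi) //.
have E (n : 'I_x) : (\sum_(d < x | (d %| n)%N) (mu R d)%:C) * Phi n =
    if (n : nat) == 1%N then Phi 1%N else 0.
  have [n0|n0] := posnP n; first by rewrite n0 P0 mulr0.
  rewrite -rmorph_sum /= sum_mu ?n0 ?ltn_ord //.
  by case: eqP => [->|_]; rewrite ?mul1r ?mul0r.
under eq_bigr => n _ do rewrite E.
have [x1|x1] := leqP x 1.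
  rewrite (Px 1%N) //; apply: big1 => n _; by case: ifP.
by rewrite -big_mkcond (big_pred1 (Ordinal x1)).
Qed.

(** Summation by parts; the increments of l add up to l N - l 0. *)
Lemma abel (l : nat -> R) (h : nat -> C) N B : (forall n, l n <= l n.+1) ->
  (forall t, cn (\sum_(n < t) h n) <= B) ->
  cn (\sum_(n < N.+1) (l n)%:C * h n - (l N)%:C * \sum_(n < N.+1) h n) <= (l N - l 0%N) * B.
Proof.
move=> lm hB; elim: N => [|N IH].
  by rewrite !big_ord1 subrr cn0 subrr mul0r.
rewrite big_ord_recr [X in _ - _ * X]big_ord_recr /=.
set S := \sum_(i < N.+1) h i in IH *; set A := \sum_(i < N.+1) _ in IH *.
have -> : A + (l N.+1)%:C * h N.+1 - (l N.+1)%:C * (S + h N.+1) =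
   (A - (l N)%:C * S) - (l N.+1 - l N)%:C * S by rewrite rmorphB /=; ring.
apply: le_trans (cnB _ _) _; rewrite cnM cn_real ger0_norm ?subr_ge0 //.
have -> : (l N.+1 - l 0%N) * B = (l N - l 0%N) * B + (l N.+1 - l N) * B by ring.
by apply: lerD => //; apply: ler_wpM2l; rewrite ?subr_ge0 // /S hB.
Qed.

Lemma ln10_le3 : ln 10 <= 3 :> R.
Proof.
rewrite -[leRHS]expRK ler_ln ?posrE ?expR_gt0 //.
have -> : 3 = 6%:R * 2^-1 :> R by lra.
rewrite expRM_natl; apply: (@le_trans _ _ ((1 + 2^-1) ^+ 6)); first by rewrite !exprS expr0; lra.
by rewrite lerXn2r ?nnegrE ?expR_ge0 ?expR_ge1Dx //; lra.
Qed.

Lemma ln_pow10 n k : (n <= 10 ^ k)%N -> ln n%:R <= (3 * k)%:R :> R.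
Proof.
case: n => [|n] nk; first by rewrite ln0.
apply: le_trans (ln_nat_le R _ nk) _ => //.
rewrite natrX lnXn // -[ln 10 *+ k]mulr_natr natrM; apply: ler_wpM2r => //.
exact: ln10_le3.
Qed.

(** Splitting [10 ^ u, 10 ^ v) into blocks of integers that share their leading
  t digits. *)
Lemma sum_decades (V : zmodType) (F : nat -> V) u v t : (0 < t <= u.+1)%N -> (u <= v)%N ->
  \sum_(d < 10 ^ v) (if (10 ^ u <= d)%N then F d else 0) =
  \sum_(i < v | (u <= i)%N) \sum_(c < 10 ^ t | (10 ^ t <= 10 * c)%N)
     \sum_(m < 10 ^ (i.+1 - t)) F (c * 10 ^ (i.+1 - t) + m)%N.
Proof.
move=> /andP[t0 tu].
pose A i := \sum_(d < 10 ^ i) F d.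
have lo i : (u <= i)%N -> \sum_(d < 10 ^ i) (if (10 ^ u <= d)%N then F d else 0) = A i - A u.
  move=> ui; have le : (10 ^ u <= 10 ^ i)%N by rewrite leq_exp2l.
  rewrite /A -(subnKC le) !big_split_ord /= big1 ?add0r => [|d _]; last first.
    by rewrite leqNgt ltn_ord.
  rewrite [X in _ = X - _]addrC addrK; apply: eq_bigr => d _; by rewrite leq_addr.
have block i : (u <= i)%N -> \sum_(c < 10 ^ t | (10 ^ t <= 10 * c)%N)
     \sum_(m < 10 ^ (i.+1 - t)) F (c * 10 ^ (i.+1 - t) + m)%N = A i.+1 - A i.
  move=> ui; set j := (i.+1 - t)%N; have ij : (t + j = i.+1)%N by rewrite subnKC //; lia.
  have ES : A i.+1 = \sum_(c < 10 ^ t) \sum_(m < 10 ^ j) F (c * 10 ^ j + m)%N.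
    by rewrite -(sum_mul (10 ^ j) (10 ^ t) F) -expnD ij.
  have -> : A i = \sum_(c < 10 ^ t | ~~ (10 ^ t <= 10 * c)%N) \sum_(m < 10 ^ j) F (c * 10 ^ j + m)%N.
    have -> : A i = \sum_(c < 10 ^ t.-1) \sum_(m < 10 ^ j) F (c * 10 ^ j + m)%N.
      by rewrite -(sum_mul (10 ^ j) (10 ^ t.-1) F) -expnD (_ : t.-1 + j = i)%N //; lia.
    have le : (10 ^ t.-1 <= 10 ^ t)%N by rewrite leq_exp2l // leq_pred.
    rewrite (big_ord_widen _ (fun c => \sum_(m < 10 ^ j) F (c * 10 ^ j + m)%N) le).
    apply: eq_bigl => c; rewrite -ltnNge.
    have T : (10 * 10 ^ t.-1 = 10 ^ t)%N by rewrite -expnS prednK.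
    by rewrite -(@ltn_pmul2l 10) // T.
  by rewrite ES [X in X - _](bigID (fun c : 'I_(10 ^ t) => 10 ^ t <= 10 * c)%N) /= addrK.
elim: v => [|v IH] uv.
  by move: uv; rewrite leqn0 => /eqP ->; rewrite big_ord1 big_ord0.
have [E|uv'] := eqVneq u v.+1.
  rewrite lo // -E subrr big1 //= => i; by rewrite leqNgt ltn_ord.
have {}uv : (u <= v)%N by lia.
rewrite [RHS]big_mkcond big_ord_recr /= uv -[X in _ = X + _]big_mkcond /= -IH // block // !lo ?(leq_trans uv) //.
by rewrite [RHS]addrC addrA subrK.
Qed.

End VaughanTools.

Section Vaughan.
Variable R : realType.
Notation C := R[i].
Variables (k u t x : nat) (G : nat -> C) (E1 eps : R).
Hypothesis G1 : forall n, cn (G n) <= 1.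
Hypothesis xk : (x <= 10 ^ k)%N.
Hypothesis tu : (0 < t <= u.+1)%N.
Hypothesis u0 : (0 < u)%N.
Hypothesis uk : (2 * u <= k)%N.
Hypothesis E10 : 0 <= E1.
Hypothesis eps0 : 0 <= eps.
Hypothesis typeI : forall D s, (0 < D <= 10 ^ (2 * u))%N -> (D * s < 10 ^ k)%N ->
  cn (\sum_(f < s) G (D * f.+1)%N) <= E1 / D%:R.
Hypothesis typeII : forall j c Y (a b : nat -> C),
  (forall n, cn (a n) <= 1) -> (forall n, cn (b n) <= 1) ->
  (10 ^ t <= 10 * c)%N -> (c < 10 ^ t)%N -> (u.+1 <= j + t)%N -> (j + t <= k - u)%N ->
  (10 ^ u <= Y)%N -> (c * 10 ^ j * Y <= 10 ^ k)%N ->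
  cn (\sum_(m < 10 ^ j) \sum_(n < Y) a m * b n * G ((c * 10 ^ j + m) * n)%N) <=
  eps * (10 ^+ k / c%:R).

Let H n : C := if (0 < n < x)%N then G n else 0.
Let L : R := (3 * k)%:R.
Let U := (10 ^ u)%N.

Let H0 : H 0 = 0. Proof. by []. Qed.
Let Hx n : (x <= n)%N -> H n = 0.
Proof. by move=> xn; rewrite /H [(n < x)%N]ltnNge xn andbF. Qed.
Let H1 n : cn (H n) <= 1.
Proof. by rewrite /H; case: ifP; rewrite ?cn0. Qed.
Let L0 : 0 <= L. Proof. by []. Qed.

Lemma partial_cut D s : (0 < D)%N ->
  \sum_(f < s.+1) H (D * f)%N = \sum_(f < minn s (x.-1 %/ D)) G (D * f.+1)%N.
Proof.
move=> D0; elim: s => [|s IH].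
  by rewrite min0n big_ord1 big_ord0 muln0.
rewrite big_ord_recr {}IH /=.
have [sx|sx] := ltnP s (x.-1 %/ D).
  rewrite (minn_idPl sx) big_ord_recr /=; congr (_ + _).
  rewrite /H muln_gt0 D0 /=; move: sx; rewrite leq_divRL // mulnC.
  by case: (x) => [|y] /=; rewrite ?leqn0 ?muln_eq0 ?ltnS => sx; [case: (D) sx D0 | rewrite sx].
rewrite (minn_idPr (leqW sx)) Hx ?addr0 //.
by move: sx; rewrite -ltnS ltn_divLR // mulnC; case: (x).
Qed.

Lemma partial_le D s : (0 < D <= 10 ^ (2 * u))%N ->
  cn (\sum_(f < s) H (D * f)%N) <= E1 / D%:R.
Proof.
move=> DU; case: s => [|s]; first by rewrite big_ord0 cn0 divr_ge0.
case/andP: (DU) => D0 _; rewrite partial_cut // typeI //.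
apply: (@leq_ltn_trans x.-1).
  by apply: leq_trans (leq_divM x.-1 D); rewrite mulnC leq_mul2r geq_minr orbT.
by case: (x) xk => [|y] yk; rewrite ?expn_gt0.
Qed.

Lemma Lam_le n : (n <= 10 ^ k)%N -> Lam R n <= L.
Proof.
move=> nk; have [n0|n0] := posnP n.
  by rewrite n0 /Lam big1 // => p; case: p => [[|p] //].
apply: le_trans (ln_pow10 R nk); rewrite -(@sum_Lam R n n.+1) ?n0 ?leqnn //.
rewrite (bigD1 ord_max) //= lerDl; apply: sumr_ge0 => c _; exact: Lam_ge0.
Qed.

(** Moebius inversion over the cofactor f isolates the terms with f = 1. *)
Lemma vaughan_identity :
  \sum_(c < x | (U <= c)%N) (Lam R c)%:C * G c =
  \sum_(d < x) (mu R d)%:C * (\sum_(c < x | (U <= c)%N) (Lam R c)%:C * (\sum_(f < x) H (d * (c * f))%N)).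
Proof.
transitivity (\sum_(c < x | (U <= c)%N) (Lam R c)%:C *
   (\sum_(d < x) (mu R d)%:C * (\sum_(f < x) H (c * (d * f))%N))).
  apply: eq_bigr => c Uc; congr (_ * _).
  have c0 : (0 < c)%N by apply: leq_trans Uc; rewrite expn_gt0.
  rewrite (@dirichlet_mu _ x (fun n => H (c * n)%N)) ?muln0 // ?muln1.
    by rewrite /H c0 ltn_ord.
  move=> n xn; apply: Hx; apply: leq_trans xn _; exact: leq_pmull.
under eq_bigr => c _ do rewrite mulr_sumr.
rewrite exchange_big; apply: eq_bigr => d _; rewrite mulr_sumr; apply: eq_bigr => c _.
rewrite mulrCA; congr (_ * (_ * _)); apply: eq_bigr => f _; by rewrite mulnCA.
Qed.

Lemma sum_lt_le (F : nat -> R) y N : (forall n, 0 <= F n) ->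
  \sum_(d < y | (d < N)%N) F d <= \sum_(d < N) F d.
Proof.
move=> F0; have [yN|Ny] := leqP y N.
  rewrite (eq_bigl xpredT) => [|d]; last by rewrite (leq_trans (ltn_ord d)).
  rewrite (big_ord_widen _ F yN) big_mkcond; apply: ler_sum => d _.
  by case: ifP.
by rewrite (big_ord_widen _ F (ltnW Ny)).
Qed.

Lemma log_sum_le d : (d <= 10 ^ (2 * u))%N ->
  cn (\sum_(n < x) (ln n%:R)%:C * H (d * n)%N) <= 2 * L * (E1 / d%:R).
Proof.
move=> dU; have B0 : 0 <= E1 / d%:R by rewrite divr_ge0.
have [d0|d0] := posnP d.
  rewrite [X in cn X]big1 => [|n _]; last by rewrite d0 mul0n H0 mulr0.
  by rewrite cn0 mulr_ge0 // mulr_ge0.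
have hB s : cn (\sum_(n < s) H (d * n)%N) <= E1 / d%:R by rewrite partial_le // d0.
have [x0|x0] := posnP x.
  rewrite [X in cn X]big1 ?cn0 => [|[n nx] _]; first by rewrite mulr_ge0 // mulr_ge0.
  by exfalso; move: nx; rewrite x0.
have lm n : ln n%:R <= ln n.+1%:R :> R.
  by case: n => [|n]; [rewrite ln0 // ln1 | apply: ln_nat_le].
have := @abel R (fun n => ln n%:R) (fun n => H (d * n)%N) x.-1 _ lm hB.
rewrite [ln 0%:R]ln0 // subr0 prednK //; set A := \sum_(_ < _) _; set S := \sum_(_ < _) _ => le.
have ly : ln x.-1%:R <= L by apply: ln_pow10; apply: leq_trans (leq_pred _) xk.
have -> : A = (A - (ln x.-1%:R)%:C * S) + (ln x.-1%:R)%:C * S by rewrite subrK.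
apply: le_trans (cnD _ _) _.
rewrite cnM cn_real ger0_norm ?ln_nat_ge0 //.
have -> : 2 * L * (E1 / d%:R) = L * (E1 / d%:R) + L * (E1 / d%:R) by ring.
rewrite lerD //; first by apply: le_trans le _; rewrite ler_wpM2r.
by apply: ler_pM => //; rewrite ?ln_nat_ge0 ?cn_ge0 // /S.
Qed.

(** Since the divisor sum of Lam is ln, the sum over c >= U is a sum with the smooth
  weight ln minus a sum over c < U, and both run over all multiples of integers up to
  U^2. *)
Lemma typeI_part :
  cn (\sum_(d < x | (d < U)%N) (mu R d)%:C *
    (\sum_(c < x | (U <= c)%N) (Lam R c)%:C * (\sum_(f < x) H (d * (c * f))%N))) <=
  (9 * u)%:R * ((9 * u).+2%:R * L * E1).
Proof.
have UU : (10 ^ (2 * u) = U * U)%N by rewrite -expnD addnn mul2n.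
have U0 : (0 < U)%N by rewrite expn_gt0.
apply: le_trans (cn_sum _ _ _) _.
apply: (@le_trans _ _ (\sum_(d < x | (d < U)%N) d%:R^-1 * ((9 * u).+2%:R * L * E1))); last first.
  rewrite -mulr_suml ler_wpM2r ?mulr_ge0 //.
  apply: le_trans (@sum_lt_le (fun d => d%:R^-1) _ _ _) (harmonic_pow10 R u) => n; by rewrite invr_ge0.
apply: ler_sum => d dU; rewrite cnM cn_real -[leRHS]mul1r.
apply: ler_pM; rewrite ?cn_ge0 ?mu_le1 //.
have -> : \sum_(c < x | (U <= c)%N) (Lam R c)%:C * (\sum_(f < x) H (d * (c * f))%N) =
  \sum_(n < x) (ln n%:R)%:C * H (d * n)%N -
  \sum_(c < x | (c < U)%N) (Lam R c)%:C * (\sum_(f < x) H (d * (c * f))%N).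
  have -> : \sum_(n < x) (ln n%:R)%:C * H (d * n)%N =
    \sum_(c < x) (Lam R c)%:C * (\sum_(f < x) H (d * (c * f))%N).
    rewrite (@dirichlet _ x (fun c => (Lam R c)%:C) (fun n => H (d * n)%N)) ?muln0 //; last first.
      move=> n xn; have [d0|d0] := posnP d; first by rewrite d0 mul0n.
      by apply: Hx; apply: leq_trans xn _; exact: leq_pmull.
    apply: eq_bigr => n _; have [n0|n0] := posnP n; first by rewrite n0 muln0 H0 !mulr0.
    by rewrite -rmorph_sum /= sum_Lam // n0 ltn_ord.
  rewrite [in RHS](bigID (fun c : 'I_x => U <= c)%N) /=.
  rewrite [X in _ + X - _](eq_bigl (fun c : 'I_x => (c < U)%N)) ?addrK // => c.
  by rewrite ltnNge.
apply: le_trans (cnB _ _) _.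
apply: (@le_trans _ _ (2 * L * (E1 / d%:R) + (9 * u)%:R * L * (E1 / d%:R))); last first.
  by rewrite -[in leRHS](addn2 (9 * u)) natrD le_eqVlt; apply/orP; left; apply/eqP; ring.
apply: lerD.
  by apply: log_sum_le; rewrite UU; apply: leq_trans (ltnW dU) _; exact: leq_pmulr.
apply: le_trans (cn_sum _ _ _) _.
apply: (@le_trans _ _ (\sum_(c < x | (c < U)%N) c%:R^-1 * (L * (E1 / d%:R)))); last first.
  rewrite -mulr_suml -mulrA ler_wpM2r //; first by rewrite mulr_ge0 // divr_ge0.
  apply: le_trans (@sum_lt_le (fun d => d%:R^-1) _ _ _) (harmonic_pow10 R u) => n; by rewrite invr_ge0.
apply: ler_sum => c cU; rewrite cnM cn_real ger0_norm ?Lam_ge0 // mulrCA.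
apply: ler_pM; rewrite ?cn_ge0 ?Lam_ge0 ?Lam_le //.
  by apply: leq_trans xk; rewrite ltnW.
under eq_bigr => f _ do rewrite mulnA.
have -> : c%:R^-1 * (E1 / d%:R) = E1 / (d * c)%:R by rewrite natrM invfM; ring.
have [dc|dc] := posnP (d * c).
  by rewrite dc invr0 mulr0 big1 ?cn0 // => f _; rewrite mul0n.
by apply: partial_le; rewrite dc UU leq_mul // ltnW.
Qed.

Lemma sum_support (V : nmodType) (F : nat -> V) A B :
  (forall d, (A <= d)%N -> F d = 0) -> (forall d, (B <= d)%N -> F d = 0) ->
  \sum_(d < A) F d = \sum_(d < B) F d.
Proof.
wlog AB : A B / (A <= B)%N => [wl FA FB|FA _].
  by case/orP: (leq_total A B) => AB; [exact: wl | symmetry; exact: wl].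
rewrite (big_ord_widen _ F AB) big_mkcond; apply: eq_bigr => d _.
by case: ltnP => // /FA.
Qed.

Section TypeIIPart.
Variable b : nat -> C.
Hypothesis b1 : forall n, cn (b n) <= 1.
Hypothesis bU : forall n, (n < U)%N -> b n = 0.

Let F d : C := (mu R d)%:C * (\sum_(n < x) b n * H (d * n)%N).

(** Inside a block with leading digits c the condition d n < x becomes n < Y, up to a
  proportion of order 1 / c of the range, which is bounded trivially. *)
Lemma typeII_block j c : (10 ^ t <= 10 * c)%N -> (c < 10 ^ t)%N -> (u.+1 <= j + t)%N ->
  (j + t <= k - u)%N ->
  cn (\sum_(m < 10 ^ j) F (c * 10 ^ j + m)%N) <=
  10 ^+ k * (10 / 10 ^+ t * (eps + 10 / 10 ^+ t)) + 2 * 10 ^+ j.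
Proof.
move=> tc ct ju jk; set X := (10 ^ j)%N.
have X0 : (0 < X)%N by rewrite expn_gt0.
have c0 : (0 < c)%N by move: tc; have := expn_gt0 10 t; lia.
have cX0 : (0 < c * X)%N by rewrite muln_gt0 c0.
set Y := (x %/ (c.+1 * X))%N; set Z := (x %/ (c * X)).+1.
have YZ : (Y <= Z)%N by apply: leqW; apply: leq_div2l => //; rewrite leq_mul2r leqnSn orbT.
have YX : (Y * (c.+1 * X) <= x)%N by exact: leq_divM.
have F1 m : F (c * X + m)%N = (mu R (c * X + m)%N)%:C * (\sum_(n < Y) b n * H ((c * X + m) * n)%N) +
   (mu R (c * X + m)%N)%:C * (\sum_(n < Z - Y) b (Y + n)%N * H ((c * X + m) * (Y + n))%N).
  rewrite -mulrDr /F; congr (_ * _).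
  rewrite (@sum_support _ (fun n => b n * H ((c * X + m) * n)%N) x Z); first by have := @big_split_ord C 0 +%R Y (Z - Y) xpredT (fun n : 'I_(Y + (Z - Y)) => b n * H ((c * X + m) * n)%N); rewrite /= subnKC.
    by move=> n xn; rewrite Hx ?mulr0 //; apply: leq_trans xn _; rewrite leq_pmull // addn_gt0 cX0.
  move=> n; rewrite /Z ltn_divLR // => xn; rewrite Hx ?mulr0 //.
  apply: leq_trans (ltnW xn) _; rewrite mulnC leq_mul2r leq_addr orbT //.
under eq_bigr => m _ do rewrite F1.
rewrite big_split /=; apply: le_trans (cnD _ _) _.
have xR : x%:R <= 10 ^+ k :> R by rewrite -natrX ler_nat.
have cR : 0 < c%:R :> R by rewrite ltr0n.
have XR : 0 < X%:R :> R by rewrite ltr0n.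
have TR : 0 < 10 ^+ t :> R by rewrite exprn_gt0.
have ci : c%:R^-1 <= 10 / 10 ^+ t :> R.
  rewrite ler_pdivlMr // mulrC ler_pdivrMr //.
  by rewrite -natrX -natrM ler_nat.
have cge : 0 <= c%:R^-1 :> R by rewrite invr_ge0 ltW.
have part1 : cn (\sum_(m < X) (mu R (c * X + m)%N)%:C * (\sum_(n < Y) b n * H ((c * X + m) * n)%N)) <=
    10 ^+ k * (10 / 10 ^+ t * eps).
  have -> : \sum_(m < X) (mu R (c * X + m)%N)%:C * (\sum_(n < Y) b n * H ((c * X + m) * n)%N) =
    \sum_(m < X) \sum_(n < Y) (mu R (c * X + m)%N)%:C * b n * G ((c * X + m) * n)%N.
    apply: eq_bigr => m _; rewrite mulr_sumr; apply: eq_bigr => n _; rewrite mulrA.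
    have [n0|n0] := posnP n; first by rewrite n0 bU ?expn_gt0 // mulr0 !mul0r.
    rewrite /H muln_gt0 n0 addn_gt0 cX0 /= ifT //.
    apply: (@leq_trans (c.+1 * X * n)).
      by rewrite ltn_pmul2r // mulSn addnC ltn_add2r.
    by apply: leq_trans YX; rewrite mulnC leq_mul2r ltnW ?orbT.
  have [UY|YU] := leqP U Y; last first.
    rewrite [X in cn X]big1 ?cn0 => [|m _]; first by nneg.
    by rewrite big1 // => n _; rewrite bU ?mulr0 ?mul0r // (ltn_trans _ YU).
  apply: (le_trans (@typeII j c Y (fun m => (mu R (c * X + m)%N)%:C) b _ _ _ _ _ _ _ _)) => //.
  - by move=> n; rewrite cn_real mu_le1.
  - apply: leq_trans xk; apply: leq_trans YX.
    by rewrite [X in (_ <= X)%N]mulnC leq_mul2r leq_mul2r leqnSn !orbT.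
  have -> : 10 ^+ k * (10 / 10 ^+ t * eps) = eps * (10 ^+ k * (10 / 10 ^+ t)) by ring.
  by rewrite !ler_wpM2l // exprn_ge0.
have part2 : cn (\sum_(m < X) (mu R (c * X + m)%N)%:C *
    (\sum_(n < Z - Y) b (Y + n)%N * H ((c * X + m) * (Y + n))%N)) <= X%:R * (Z - Y)%:R.
  apply: le_trans (cn_sum _ _ _) _; apply: sum_le_const => m.
  rewrite cnM cn_real -[leRHS]mul1r; apply: ler_pM; rewrite ?cn_ge0 ?mu_le1 //.
  apply: le_trans (cn_sum _ _ _) _; rewrite -[leRHS]mulr1; apply: sum_le_const => n.
  by rewrite cnM mulr_ile1 ?cn_ge0.
have part3 : X%:R * (Z - Y)%:R <= 10 ^+ k * (10 / 10 ^+ t * (10 / 10 ^+ t)) + 2 * X%:R :> R.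
  have c1R : 0 < c.+1%:R :> R by [].
  have Zle : X%:R * Z%:R <= x%:R / c%:R + X%:R :> R.
    rewrite /Z -addn1 natrD mulrDr mulr1 lerD2r ler_pdivlMr // -!natrM ler_nat.
    have := leq_divM x (c * X); set q := (x %/ (c * X))%N.
    by rewrite (_ : q * (c * X) = X * q * c)%N //; ring.
  have Yge : x%:R / c.+1%:R - X%:R <= X%:R * Y%:R :> R.
    rewrite lerBlDr ler_pdivrMr // -!natrM -natrD -natrM ler_nat.
    have cX : (0 < c.+1 * X)%N by rewrite muln_gt0.
    have := ltnW (ltn_ceil x cX); rewrite -/Y.
    by rewrite (_ : Y.+1 * (c.+1 * X) = (X * Y + X) * c.+1)%N //; ring.
  have cc : x%:R / c%:R - x%:R / c.+1%:R <= x%:R * (c%:R^-1 * c%:R^-1) :> R.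
    rewrite -mulrBr ler_wpM2l //.
    have -> : c%:R^-1 - c.+1%:R^-1 = c%:R^-1 * c.+1%:R^-1 :> R.
      by rewrite -natr1; field; rewrite ?natr1 ?pnatr_eq0 -?lt0n ?c0.
    rewrite ler_wpM2l // lef_pV2 ?posrE // ler_nat //.
  have ccc : x%:R * (c%:R^-1 * c%:R^-1) <= 10 ^+ k * (10 / 10 ^+ t * (10 / 10 ^+ t)) :> R.
    by apply: ler_pM; rewrite ?mulr_ge0 // ler_pM.
  rewrite natrB // mulrBr; move: (le_trans cc ccc) Zle Yge.
  move: (x%:R / c%:R) (x%:R / c.+1%:R) (10 ^+ k * _) (X%:R * Z%:R) (X%:R * Y%:R).
  by move=> r1 r2 r3 r4 r5; lra.
apply: le_trans (lerD part1 part2) (le_trans (lerD (lexx _) part3) _).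
by rewrite le_eqVlt; apply/orP; left; apply/eqP; rewrite /X natrX; ring.
Qed.

Lemma typeII_part : cn (\sum_(d < x | (U <= d)%N) F d) <=
  k%:R * 10 ^+ k * (10 * eps + 100 / 10 ^+ t + 2 / 10 ^+ u).
Proof.
have uv : (u <= k - u)%N by lia.
have -> : \sum_(d < x | (U <= d)%N) F d = \sum_(d < 10 ^ (k - u)) (if (U <= d)%N then F d else 0).
  rewrite big_mkcond (@sum_support _ (fun d => if (U <= d)%N then F d else 0) x (10 ^ (k - u))) // => d dle.
    case: ifP => // _; rewrite /F big1 ?mulr0 // => n _.
    have [n0|n0] := posnP n; first by rewrite n0 muln0 H0 mulr0.
    by rewrite Hx ?mulr0 //; apply: leq_trans dle _; exact: leq_pmulr.
  case: ifP => // _; rewrite /F big1 ?mulr0 // => n _.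
  have [nU|nU] := ltnP n U; first by rewrite bU // mul0r.
  rewrite Hx ?mulr0 //; apply: leq_trans xk _.
  by rewrite -(subnK (_ : u <= k)%N) ?expnD ?leq_mul //; lia.
rewrite (sum_decades F tu uv).
apply: le_trans (cn_sum _ _ _) _.
have T0 : 0 < 10 ^+ t :> R by rewrite exprn_gt0.
pose B : R := 10 ^+ k * (10 * (eps + 10 / 10 ^+ t) + 2 / 10 ^+ u).
have B0 : 0 <= B by rewrite /B; nneg.
apply: (@le_trans _ _ (\sum_(i < k - u) B)); last first.
  rewrite sumr_const card_ord -[leLHS]mulr_natl -mulrA.
  have -> : B = 10 ^+ k * (10 * eps + 100 / 10 ^+ t + 2 / 10 ^+ u) by rewrite /B; congr (_ * _); ring.
  rewrite ler_wpM2r ?ler_nat ?leq_subr // mulr_ge0 ?exprn_ge0 //.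
  by nneg.
rewrite big_mkcond; apply: ler_sum => i _; case: ifP => // ui.
apply: le_trans (cn_sum _ _ _) _.
have ik := ltn_ord i.
set j := (i.+1 - t)%N; have jt : (j + t = i.+1)%N by rewrite subnK //; lia.
apply: (@le_trans _ _ (\sum_(c < 10 ^ t) (10 ^+ k * (10 / 10 ^+ t * (eps + 10 / 10 ^+ t)) + 2 * 10 ^+ j))).
  rewrite big_mkcond; apply: ler_sum => c _; case: ifP => tc.
    by apply: typeII_block => //; rewrite jt; lia.
  by nneg.
rewrite sumr_const card_ord -[leLHS]mulr_natl natrX [leLHS]mulrDr /B [leRHS]mulrDr; apply: lerD.
  by rewrite le_eqVlt; apply/orP; left; apply/eqP; field; rewrite gt_eqF.
rewrite mulrCA -exprD addnC jt mulrCA ler_wpM2l // ler_pdivlMr ?exprn_gt0 // -exprD.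
by rewrite ler_weXn2l ?ler1n //; lia.
Qed.

End TypeIIPart.

(** The terms n < 10^u are bounded trivially; in [vaughan_identity] the range
  d < 10^u is of type I and the range d >= 10^u of type II. *)
Theorem vaughan : cn (\sum_(n < x) (Lam R n)%:C * G n) <=
  10 ^+ u * L + (9 * u)%:R * ((9 * u).+2%:R * L * E1) +
  L * (k%:R * 10 ^+ k * (10 * eps + 100 / 10 ^+ t + 2 / 10 ^+ u)).
Proof.
have L1 : 0 < L by rewrite /L ltr0n; lia.
rewrite (bigID (fun n : 'I_x => (U <= n)%N)) /= addrC.
apply: le_trans (cnD _ _) _; rewrite -addrA; apply: lerD.
  apply: le_trans (cn_sum _ _ _) _.
  apply: (@le_trans _ _ (\sum_(n < U) L)); last by rewrite sumr_const card_ord -[leLHS]mulr_natl natrX.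
  apply: le_trans (@sum_lt_le (fun=> L) x U _) => //.
  rewrite (eq_bigl (fun n : 'I_x => (n < U)%N)) => [|n]; last by rewrite ltnNge.
  apply: ler_sum => n nU; rewrite cnM cn_real ger0_norm ?Lam_ge0 // -[leRHS]mulr1.
  by apply: ler_pM; rewrite ?Lam_ge0 ?cn_ge0 ?Lam_le // (leq_trans _ xk) // ltnW.
rewrite vaughan_identity (bigID (fun d : 'I_x => (d < U)%N)) /=.
apply: le_trans (cnD _ _) _; apply: lerD; first exact: typeI_part.
rewrite (eq_bigl (fun d : 'I_x => (U <= d)%N)) => [|d]; last by rewrite -leqNgt.
pose be n : R := \sum_(c < x | (U <= c)%N && (c %| n)%N) Lam R c.
pose b n : C := if (0 < n < x)%N then (be n / L)%:C else 0.
have be0 n : 0 <= be n by apply: sumr_ge0 => c _; apply: Lam_ge0.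
have beL n : (0 < n < x)%N -> be n <= L.
  move=> /andP[n0 nx]; apply: le_trans (ln_pow10 R (_ : n <= 10 ^ k)%N).
    rewrite -(@sum_Lam R n x) ?n0 // /be big_andbC big_mkcondr; apply: ler_sum => c _.
    by case: ifP => // _; apply: Lam_ge0.
  by apply: leq_trans xk; apply: ltnW.
have b1 n : cn (b n) <= 1.
  rewrite /b; case: ifP => nx; last by rewrite cn0.
  by rewrite cn_real ger0_norm ?divr_ge0 // ler_pdivrMr // mul1r beL.
have bU n : (n < U)%N -> b n = 0.
  move=> nU; rewrite /b; case: ifP => // /andP[n0 nx]; rewrite /be big1 ?mul0r // => c /andP[Uc cn].
  by have := dvdn_leq n0 cn; rewrite leqNgt (leq_trans nU Uc).
have -> : \sum_(d < x | (U <= d)%N) (mu R d)%:C *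
   (\sum_(c < x | (U <= c)%N) (Lam R c)%:C * (\sum_(f < x) H (d * (c * f))%N)) =
   L%:C * (\sum_(d < x | (U <= d)%N) (mu R d)%:C * (\sum_(n < x) b n * H (d * n)%N)).
  rewrite mulr_sumr; apply: eq_bigr => d Ud; rewrite mulrCA; congr (_ * _).
  have d0 : (0 < d)%N by apply: leq_trans Ud; rewrite expn_gt0.
  rewrite big_mkcond.
  have := @dirichlet _ x (fun c => if (U <= c)%N then (Lam R c)%:C else 0) (fun n => H (d * n)%N).
  rewrite muln0 => /(_ H0) dir.
  transitivity (\sum_(c < x) (if (U <= c)%N then (Lam R c)%:C else 0) * (\sum_(f < x) H (d * (c * f))%N)).
    by apply: eq_bigr => c _; case: ifP; rewrite ?mul0r.
  rewrite dir; last by move=> n xn; apply: Hx; apply: leq_trans xn _; exact: leq_pmull.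
  rewrite mulr_sumr; apply: eq_bigr => n _.
  have [n0|n0] := posnP n; first by rewrite n0 muln0 H0 !mulr0.
  rewrite mulrA; congr (_ * _); rewrite /b n0 ltn_ord /= -rmorphM /= mulrC divfK ?gt_eqF //.
  rewrite /be rmorph_sum /= big_andbC big_mkcondr /=.
  by apply: eq_bigr => c _; case: ifP.
rewrite cnM cn_real ger0_norm //; apply: ler_wpM2l => //; exact: typeII_part.
Qed.

End Vaughan.

(** * Linear exponential sums over primes *)

Section LinearSums.
Variable R : realType.
Notation C := R[i].

Lemma big_ord_cat (V : nmodType) (F : nat -> V) a n : (a <= n)%N ->
  \sum_(i < n) F i = \sum_(i < a) F i + \sum_(i < n - a) F (a + i)%N.
Proof.
move=> an; have := @big_split_ord V 0 +%R a (n - a) xpredT (fun i : 'I_(a + (n - a)) => F i).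
by rewrite /= subnKC.
Qed.

(** A nontrivial geometric progression of roots of unity sums to zero over a
  period. *)
Lemma periodic_sum_le (r : C) q n : (0 < q)%N -> r ^+ q = 1 -> r != 1 -> cn r = 1 ->
  cn (\sum_(f < n) r ^+ f) <= q%:R.
Proof.
move=> q0 rq r1 cr.
have per : periodic q (fun f => r ^+ f) by move=> f /=; rewrite exprD rq mulr1.
have z : \sum_(f < q) r ^+ f = 0.
  have := geom_sum r q; rewrite rq subrr => /eqP; rewrite mulf_eq0 subr_eq0 eq_sym (negbTE r1) /=.
  by move/eqP.
have -> : \sum_(f < n) r ^+ f = \sum_(f < n %% q) r ^+ f.
  rewrite (big_ord_cat (fun f => r ^+ f) (leq_divM n q)) (sum_blocks (n %/ q) per) z mul0rn add0r.
  have -> : (n - n %/ q * q = n %% q)%N by rewrite {1}(divn_eq n q) addKn.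
  by apply: eq_bigr => f _; rewrite exprD mulnC exprM rq expr1n mul1r.
apply: le_trans (cn_sum _ _ _) _; apply: (@le_trans _ _ (n %% q)%:R); last first.
  by rewrite ler_nat ltnW // ltn_pmod.
rewrite -[leRHS]mulr1; apply: sum_le_const => f; by rewrite cnX cr expr1n.
Qed.

(** At a rational point of denominator q, not too small and not too close to 10^k,
  the type I sums are geometric and the type II sums fall under [large_sieve]. *)
Theorem linear_exp_sum (k s N q x : nat) (u : int) : (0 < s)%N -> (32 * s <= k)%N -> (0 < N)%N ->
  q = (N %/ gcdn `|u| N)%N -> (10 ^ (8 * s) < q)%N -> (q * 10 ^ (30 * s) <= 10 ^ k)%N ->
  (x <= 10 ^ k)%N ->
  cn (\sum_(n < x) (Lam R n)%:C * w R N (u * n%:Z)) <= 100 * k%:R ^+ 2 * 10 ^+ k / 10 ^+ s.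
Proof.
move=> s0 sk N0 qE qlo qhi xk.
have q0 : (0 < q)%N by apply: leq_ltn_trans qlo.
have g0 : (0 < gcdn `|u| N)%N by rewrite gcdn_gt0 N0 orbT.
have NE : N = (q * gcdn `|u| N)%N by rewrite qE divnK // dvdn_gcdr.
have qdvd (D : nat) : (N%:Z %| u * D%:Z)%Z -> (q %| D)%N.
  rewrite dvdzE abszM /= => ND; rewrite -(dvdn_pmul2r g0) -NE.
  apply: dvdn_trans (_ : gcdn (`|u| * D) (N * D) %| _)%N.
    by rewrite dvdn_gcd ND dvdn_mulr.
  by rewrite muln_gcdr ![(D * _)%N]mulnC.
have typeI (D y : nat) : (0 < D <= 10 ^ (2 * (4 * s)))%N -> (D * y < 10 ^ k)%N ->
    cn (\sum_(f < y) w R N (u * (D * f.+1)%N%:Z)) <= (q * 10 ^ (8 * s))%:R / D%:R :> R.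
  move=> /andP[D0 DU] _.
  have -> : \sum_(f < y) w R N (u * (D * f.+1)%N%:Z) =
    w R N (u * D%:Z) * \sum_(f < y) w R N (u * D%:Z) ^+ f :> C.
    rewrite mulr_sumr; apply: eq_bigr => f _; rewrite -w_muln -wD; congr (w R N _); lia.
  rewrite cnM cn_w mul1r ler_pdivlMr ?ltr0n // natrM.
  apply: ler_pM; rewrite ?cn_ge0 ?ler_nat //; last by rewrite mulnA in DU.
  apply: periodic_sum_le; rewrite ?cn_w //.
    rewrite -w_muln w_dvd //.
    by rewrite dvdzE !abszM {1}NE dvdn_mul // dvdn_mulr // dvdn_gcdl.
  apply: w_neq1 => //; apply/negP => /qdvd /(dvdn_leq D0); rewrite leqNgt.
  by rewrite mulnA in DU; rewrite (leq_ltn_trans DU qlo).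
pose eps : R := 2 / 10 ^+ s.
have T0 n : 0 < 10 ^+ n :> R by rewrite exprn_gt0.
have typeII j c Y (a b : nat -> C) :
  (forall n, cn (a n) <= 1) -> (forall n, cn (b n) <= 1) ->
  (10 ^ (2 * s) <= 10 * c)%N -> (c < 10 ^ (2 * s))%N -> ((4 * s).+1 <= j + 2 * s)%N ->
  (j + 2 * s <= k - 4 * s)%N ->
  (10 ^ (4 * s) <= Y)%N -> (c * 10 ^ j * Y <= 10 ^ k)%N ->
  cn (\sum_(m < 10 ^ j) \sum_(n < Y) a m * b n * w R N (u * ((c * 10 ^ j + m) * n)%N%:Z)) <=
  eps * (10 ^+ k / c%:R).
  move=> a1 b1 tc ct ju jk UY cY; set X := (10 ^ j)%N.
  have c0 : (0 < c)%N by move: tc; have := expn_gt0 10 (2 * s); lia.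
  have cR : 0 < c%:R :> R by rewrite ltr0n.
  have Y0 : (0 < Y)%N by apply: leq_trans UY; rewrite expn_gt0.
  have YR : 0 < Y%:R :> R by rewrite ltr0n.
  have qR : 0 < q%:R :> R by rewrite ltr0n.
  have XR : 0 < X%:R :> R by rewrite ltr0n expn_gt0.
  rewrite -(ler_pXn2r (ltn0Sn 1)) ?nnegrE ?cn_ge0 //; last by rewrite /eps; nneg.
  have sq : cn (\sum_(m < X) \sum_(n < Y) a m * b n * w R N (u * ((c * X + m) * n)%N%:Z)) ^+ 2 <=
     X%:R * ((X%:R + q%:R) * (Y%:R * (Y%:R / q%:R + 1))).
    apply: le_trans (cn_sqr_sum_le _) _; rewrite ler_wpM2l //.
    apply: le_trans (@large_sieve R N q u X Y (c * X)%N b N0 qE b1).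
    apply: ler_sum => m _; rewrite ler_pXn2r ?nnegrE ?cn_ge0 //.
    have -> : \sum_(n < Y) a m * b n * w R N (u * ((c * X + m) * n)%N%:Z) =
      a m * (\sum_(n < Y) b n * w R N (u * (c * X + m)%N%:Z * n%:Z)).
      by rewrite mulr_sumr; apply: eq_bigr => n _; rewrite PoszM !mulrA.
    by rewrite -[leRHS]mul1r cnM ler_wpM2r ?cn_ge0.
  apply: le_trans sq _.
  set Z : R := 10 ^+ k / c%:R; have Z0 : 0 < Z by rewrite divr_gt0.
  have XYZ : X%:R * Y%:R <= Z by rewrite /Z ler_pdivlMr // -!natrM -natrX ler_nat mulnC mulnA.
  set P : R := (10 ^+ (2 * s))^-1; have P0 : 0 < P by rewrite invr_gt0.
  have inv (n : nat) : (10 ^ (2 * s).+1 <= n)%N -> n%:R^-1 <= P / 4.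
    move=> sn; have n0 : 0 < n%:R :> R by rewrite ltr0n (leq_trans _ sn) // expn_gt0.
    rewrite /P -invfM lef_pV2 ?posrE ?mulr_gt0 //.
    apply: le_trans (_ : (10 ^ (2 * s).+1)%:R <= _); last by rewrite ler_nat.
    by rewrite natrX exprS mulrC ler_wpM2r ?exprn_ge0 ?ler_nat.
  have frac (n : nat) : (10 ^ (2 * s).+1 <= n)%N -> (X%:R * Y%:R) ^+ 2 / n%:R <= Z ^+ 2 * P / 4.
    move=> sn; rewrite -mulrA; apply: ler_pM; rewrite ?sqr_ge0 ?invr_ge0 ?inv //.
    by rewrite lerXn2r ?nnegrE ?(ltW Z0) ?mulr_ge0.
  have e1 : (X%:R * Y%:R) ^+ 2 / q%:R <= Z ^+ 2 * P / 4.
    apply: frac; apply: leq_trans (ltnW qlo); rewrite leq_exp2l //; clear - s0 ju; lia.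
  have e2 : (X%:R * Y%:R) ^+ 2 / Y%:R <= Z ^+ 2 * P / 4.
    apply: frac; apply: leq_trans UY; rewrite leq_exp2l //; clear - s0 ju; lia.
  have e3 : (X%:R * Y%:R) ^+ 2 / X%:R <= Z ^+ 2 * P / 4.
    apply: frac; rewrite leq_exp2l //; clear - s0 ju; lia.
  have e4 : (X%:R * Y%:R) * q%:R <= Z ^+ 2 * P.
    have -> : Z ^+ 2 * P = Z * (Z * P) by rewrite expr2 mulrA.
    apply: ler_pM; rewrite ?mulr_ge0 //.
    have -> : Z * P = 10 ^+ k / (c%:R * 10 ^+ (2 * s)) by rewrite /Z /P invfM mulrA.
    rewrite ler_pdivlMr ?mulr_gt0 // -!natrX -!natrM ler_nat.
    apply: leq_trans qhi; rewrite leq_mul2l; apply/orP; right.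
    apply: (@leq_trans (10 ^ (2 * s) * 10 ^ (2 * s))); first by rewrite leq_mul2r ltnW ?orbT.
    by rewrite -expnD leq_exp2l //; clear - s0; lia.
  have -> : X%:R * ((X%:R + q%:R) * (Y%:R * (Y%:R / q%:R + 1))) =
     (X%:R * Y%:R) ^+ 2 / q%:R + (X%:R * Y%:R) ^+ 2 / Y%:R +
     (X%:R * Y%:R) ^+ 2 / X%:R + (X%:R * Y%:R) * q%:R :> R.
    by field; rewrite !gt_eqF.
  have -> : (eps * Z) ^+ 2 = Z ^+ 2 * P * 4 :> R.
    by rewrite /P /eps mulnC exprM; field; rewrite gt_eqF.
  have ZP0 : 0 <= Z ^+ 2 * P by rewrite mulr_ge0 ?sqr_ge0 ?ltW.
  move: e1 e2 e3 e4 ZP0; move: (Z ^+ 2 * P) (_ / q%:R) (_ / Y%:R) (_ / X%:R) (_ * q%:R).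
  by move=> r0 r1 r2 r3 r4; lra.
have G1 n : cn (w R N (u * n%:Z)) <= 1 by rewrite cn_w.
have := @vaughan R k (4 * s) (2 * s) x (fun n => w R N (u * n%:Z)) (q * 10 ^ (8 * s))%:R eps
  G1 xk _ _ _ _ _ typeI typeII.
set S := cn _; move=> vau; apply: le_trans (vau _ _ _ _ _) _; rewrite ?ler0n ?divr_ge0 ?exprn_ge0 //; try (clear - s0 sk; lia).
set A : R := 10 ^+ k; set B := A / 10 ^+ s.
have A0 : 0 < A by apply: T0.
have B0 : 0 < B by rewrite divr_gt0.
have sle : (s < 10 ^ s)%N by apply: ltn_expl.
have k32 : (32 <= k)%N by clear - s0 sk; lia.
have t1 : 10 ^+ (4 * s) * (3 * k)%:R <= k%:R ^+ 2 * B.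
  rewrite mulrC; apply: ler_pM; rewrite ?exprn_ge0 //.
    by rewrite -natrX ler_nat -mulnn leq_mul //; clear - k32; lia.
  rewrite /B ler_pdivlMr // -exprD /A ler_weXn2l ?ler1n //.
  by clear - sk; lia.
have t2 : (9 * (4 * s))%:R * ((9 * (4 * s)).+2%:R * (3 * k)%:R * (q * 10 ^ (8 * s))%:R) <=
    k%:R ^+ 2 * B.
  have h1 : (q * 10 ^ (8 * s))%:R <= A / 10 ^+ (22 * s) :> R.
    rewrite ler_pdivlMr // /A -!natrX -natrM ler_nat -mulnA -expnD.
    by rewrite (_ : 8 * s + 22 * s = 30 * s)%N //; clear; lia.
  have h2 : (9 * (4 * s))%:R * ((9 * (4 * s)).+2%:R * (3 * k)%:R) <= k%:R ^+ 2 * 10 ^+ (21 * s) :> R.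
    have -> : k%:R ^+ 2 * 10 ^+ (21 * s) = (k * (10 ^ (21 * s) * k))%:R :> R.
      by rewrite !natrM natrX; ring.
    rewrite -!natrM ler_nat.
    rewrite (_ : 9 * (4 * s) * ((9 * (4 * s)).+2 * (3 * k)) = (27 * s) * ((4 * (36 * s).+2) * k))%N; last by ring.
    apply: leq_mul; first by clear - sk; lia.
    rewrite leq_mul2r; apply/orP; right.
    apply: (@leq_trans (10 ^ s * 10 ^ (3 * s))); last by rewrite -expnD leq_exp2l //; clear; lia.
    apply: (@leq_trans (s * 1000)); first by clear - s0; lia.
    by apply: leq_mul; [exact: ltnW | rewrite expnM -[leqLHS]expn1 leq_exp2l].
  have -> : k%:R ^+ 2 * B = k%:R ^+ 2 * 10 ^+ (21 * s) * (A / 10 ^+ (22 * s)).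
    have -> : 10 ^+ (22 * s) = 10 ^+ (21 * s) * 10 ^+ s :> R.
      by rewrite -exprD; congr (_ ^+ _); clear; lia.
    by rewrite /B; field; rewrite !gt_eqF.
  have -> : (9 * (4 * s))%:R * ((9 * (4 * s)).+2%:R * (3 * k)%:R * (q * 10 ^ (8 * s))%:R) =
    (9 * (4 * s))%:R * ((9 * (4 * s)).+2%:R * (3 * k)%:R) * (q * 10 ^ (8 * s))%:R :> R.
    by rewrite -[RHS]mulrA; congr (_ * _); rewrite -mulrA.
  by apply: ler_pM; rewrite ?mulr_ge0 ?ler0n.
have t3 : 10 * eps + 100 / 10 ^+ (2 * s) + 2 / 10 ^+ (4 * s) <= 32 / 10 ^+ s.
  set p : R := (10 ^+ s)^-1.
  have p0 : 0 <= p by rewrite invr_ge0 ltW.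
  have p1 : p <= 10^-1.
    by rewrite lef_pV2 ?posrE // -[leLHS]expr1 ler_weXn2l ?ler1n.
  have -> : (10 ^+ (2 * s))^-1 = p ^+ 2 by rewrite mulnC exprM exprVn.
  have -> : (10 ^+ (4 * s))^-1 = (p ^+ 2) ^+ 2 by rewrite -exprM [(4 * s)%N]mulnC exprM exprVn.
  rewrite /eps -/p; move: p0 p1; clear.
  move: p => p p0 p1; have p2 : p ^+ 2 <= p / 10 by nra.
  have p4 : (p ^+ 2) ^+ 2 <= p ^+ 2.
    by rewrite expr2 -[leRHS]mul1r ler_wpM2r ?sqr_ge0 //; lra.
  by lra.
have t4 : (3 * k)%:R * (k%:R * A * (10 * eps + 100 / 10 ^+ (2 * s) + 2 / 10 ^+ (4 * s))) <=
   98 * (k%:R ^+ 2 * B).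
  apply: (@le_trans _ _ ((3 * k)%:R * (k%:R * A * (32 / 10 ^+ s)))).
    by rewrite !ler_wpM2l // mulr_ge0 // ltW.
  have -> : (3 * k)%:R * (k%:R * A * (32 / 10 ^+ s)) = 96 * (k%:R ^+ 2 * B) :> R.
    by rewrite /B natrM; ring.
  have KB : 0 <= k%:R ^+ 2 * B by rewrite mulr_ge0 ?sqr_ge0 // ltW.
  by apply: ler_wpM2r KB _ _ _; rewrite ler_nat.
have -> : 100 * k%:R ^+ 2 * A / 10 ^+ s = k%:R ^+ 2 * B + k%:R ^+ 2 * B + 98 * (k%:R ^+ 2 * B).
  by rewrite /B; ring.
by rewrite !lerD.
Qed.

End LinearSums.

(** * Digital exponential sums over primes *)

Section DigitalTypeI.
Variable R : realType.
Notation C := R[i].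
Variable al : R.

(** Restricting to integers coprime to 10 lets the divisor D in the sums below be
  assumed coprime to 10 as well. *)
Definition gc (k n : nat) : C := (coprime n 10)%:R * g al k n.

Lemma cn_gc k n : cn (gc k n) <= 1.
Proof. by rewrite cnM cn_g mulr1; case: coprime; rewrite ?cn1 ?cn0. Qed.

Lemma coprime_low a q z : (0 < a)%N -> coprime (q * 10 ^ a + z) 10 = coprime z 10.
Proof.
move=> a0; rewrite -coprime_modl -[RHS]coprime_modl; congr coprime.
by case: a a0 => // a _; rewrite expnSr mulnA modnMDl.
Qed.

(** Divisibility by D is detected by the characters modulo D, which factor over three
  ranges of digits. The lowest k1 and the highest digits are treated by
  Cauchy-Schwarz and [dispersion_le], the k2 digits in between by [digit_sup]. *)
Lemma digital_full (k k1 k2 D Q : nat) : (0 < D <= 10 ^ k1)%N -> coprime D 10 -> (0 < k1)%N ->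
  (k1 + k2 <= k)%N -> (D <= 10 ^ (k - (k1 + k2)))%N -> (Q <= 10 ^ (k - (k1 + k2)))%N ->
  cn (\sum_(q < Q) \sum_(r < 10 ^ (k1 + k2))
     (if (D %| q * 10 ^ (k1 + k2) + r)%N then gc k (q * 10 ^ (k1 + k2) + r)%N else 0)) <=
  2 * 10 ^+ k * save al ^+ (k2 %/ 2) / D%:R.
Proof.
move=> /andP[D0 D1] cD k10 kk Dk Qk; set k' := (k1 + k2)%N; set k3 := (k - k')%N.
have kE : (k' + k3 = k)%N by rewrite subnKC.
have k'X : (10 ^ k' = 10 ^ k2 * 10 ^ k1)%N by rewrite -expnD addnC.
have DR : 0 < D%:R :> R by rewrite ltr0n.
pose A (h : nat) : C := \sum_(z < 10 ^ k1) ((coprime z 10)%:R * g al k1 z) * w R D (z%:Z * h%:Z).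
pose B (h : nat) : C := \sum_(y < 10 ^ k2) g al k2 y * w R D ((10 ^ k1 * y)%N%:Z * h%:Z).
pose Cc (h : nat) : C := \sum_(q < Q) g al k3 q * w R D ((10 ^ k' * q)%N%:Z * h%:Z).
have -> : \sum_(q < Q) \sum_(r < 10 ^ k')
     (if (D %| q * 10 ^ k' + r)%N then gc k (q * 10 ^ k' + r)%N else 0) =
   D%:R^-1 * \sum_(h < D) Cc h * (B h * A h).
  have step (h : 'I_D) : Cc h * (B h * A h) = \sum_(q < Q) \sum_(y < 10 ^ k2) \sum_(z < 10 ^ k1)
     gc k (q * 10 ^ k' + (y * 10 ^ k1 + z))%N * w R D ((q * 10 ^ k' + (y * 10 ^ k1 + z))%N%:Z * h%:Z).
    rewrite mulr_suml; apply: eq_bigr => q _; rewrite [B h * _]mulr_suml mulr_sumr; apply: eq_bigr => y _.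
    rewrite [_ * A h]mulr_sumr mulr_sumr; apply: eq_bigr => z _.
    rewrite /gc coprime_low ?addn_gt0 ?k10 // coprime_low //.
    have -> : g al k (q * 10 ^ k' + (y * 10 ^ k1 + z))%N = g al k1 z * g al k2 y * g al k3 q.
      have lz : (z %/ 10 ^ k1 = 0)%N by rewrite divn_small.
      have lyz : (y * 10 ^ k1 + z < 10 ^ k')%N.
        rewrite k'X; apply: (@leq_trans (y.+1 * 10 ^ k1)).
          by rewrite mulSn addnC ltn_add2r.
        by rewrite leq_mul2r ltn_ord orbT.
      rewrite -kE g_add divnMDl ?expn_gt0 // divn_small // addn0; congr (_ * _).
      have -> : g al k' (q * 10 ^ k' + (y * 10 ^ k1 + z))%N = g al k' (y * 10 ^ k1 + z)%N.
        by rewrite /g ds_modMl.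
      rewrite /k' g_add divnMDl ?expn_gt0 // lz addn0; congr (_ * _).
      by rewrite /g ds_modMl.
    have -> : (q * 10 ^ k' + (y * 10 ^ k1 + z))%N%:Z * h%:Z =
       (10 ^ k' * q)%N%:Z * h%:Z + (10 ^ k1 * y)%N%:Z * h%:Z + z%:Z * h%:Z by lia.
    rewrite !wD; ring.
  under [in RHS]eq_bigr => h _ do rewrite step.
  rewrite [in RHS]exchange_big [RHS]mulr_sumr; apply: eq_bigr => q _.
  have := sum_mul (10 ^ k1) (10 ^ k2) (fun r => if (D %| q * 10 ^ k' + r)%N
     then gc k (q * 10 ^ k' + r)%N else 0).
  rewrite -k'X => ->.
  rewrite [in RHS]exchange_big [RHS]mulr_sumr; apply: eq_bigr => y _.
  rewrite [in RHS]exchange_big [RHS]mulr_sumr; apply: eq_bigr => z _ /=.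
  set n := (q * _ + _)%N; rewrite -mulr_sumr.
  rewrite (sum_w R n%:Z D0) dvdzE /=; case: ifP => _; rewrite ?mulr0 //.
  by rewrite mulrCA mulVf ?mulr1 // pnatr_eq0 -lt0n.
rewrite cnM cnV cn_nat mulrC ler_wpM2r ?invr_ge0 ?(ltW DR) //.
have Bh (h : 'I_D) : cn (B h) <= 10 ^+ k2 * save al ^+ (k2 %/ 2).
  apply: le_trans (digit_sup al k2 ((10 ^ k1)%N%:R * h%:R / D%:R)).
  rewrite le_eqVlt; apply/orP; left; apply/eqP; congr cn; apply: eq_bigr => y _; congr (_ * _).
  by rewrite /w rmorphM /= -!pmulrn natrM; congr (e _); ring.
have Ah : \sum_(h < D) cn (A h) ^+ 2 <= 2 * (10 ^+ k1) ^+ 2.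
  apply: (le_trans (@dispersion_le R D (10 ^ k1) (fun z => (coprime z 10)%:R * g al k1 z)
    (fun z => z%:Z) D0 (cn_gc k1) (fun _ _ => id))).
  rewrite natrX; set Y : R := 10 ^+ k1; have DY : D%:R <= Y by rewrite /Y -natrX ler_nat.
  have -> : D%:R * (Y * (Y / D%:R + 1)) = Y * (Y + D%:R) by field; rewrite gt_eqF.
  by have Y0 : 0 <= Y by [rewrite exprn_ge0]; move: DY Y0; clear; nra.
have Ch : \sum_(h < D) cn (Cc h) ^+ 2 <= 2 * (10 ^+ k3) ^+ 2.
  have := @dispersion_le R D Q (fun q => g al k3 q) (fun q => (10 ^ k' * q)%N%:Z) D0.
  move=> /(_ (fun n => _)) H; apply: le_trans (H _ _) _.
  - by move=> n; rewrite cn_g.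
  - move=> n n'; rewrite !PoszM -mulrBr Gauss_dvdzr // coprimezE /= coprime_sym.
    by rewrite coprimeXl // coprime_sym.
  have QR : Q%:R <= 10 ^+ k3 :> R by rewrite -natrX ler_nat.
  have DR' : D%:R <= 10 ^+ k3 :> R by rewrite -natrX ler_nat.
  have -> : D%:R * (Q%:R * (Q%:R / D%:R + 1)) = Q%:R * (Q%:R + D%:R) :> R by field; rewrite gt_eqF.
  have Q0 : 0 <= Q%:R :> R by [].
  move: QR DR' Q0 (ltW DR); move: (10 ^+ k3) (Q%:R) (D%:R) => x y z; clear; nra.
have AC : \sum_(h < D) cn (Cc h) * cn (A h) <= 2 * (10 ^+ k1 * 10 ^+ k3).
  rewrite -(ler_pXn2r (ltn0Sn 1)) ?nnegrE ?mulr_ge0 ?exprn_ge0 //; last first.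
    by apply: sumr_ge0 => h _; rewrite mulr_ge0 ?cn_ge0.
  apply: le_trans (cauchy_schwarz _ _ _ _) _.
  have -> : (2 * (10 ^+ k1 * 10 ^+ k3)) ^+ 2 = (2 * (10 ^+ k3) ^+ 2) * (2 * (10 ^+ k1) ^+ 2) :> R by ring.
  by apply: ler_pM => //; apply: sumr_ge0 => h _; rewrite sqr_ge0.
apply: le_trans (cn_sum _ _ _) _.
apply: (@le_trans _ _ (\sum_(h < D) cn (Cc h) * cn (A h) * (10 ^+ k2 * save al ^+ (k2 %/ 2)))).
  apply: ler_sum => h _; rewrite !cnM mulrCA mulrC; apply: ler_pM; rewrite ?cn_ge0 ?mulr_ge0 ?cn_ge0 //.
rewrite -mulr_suml.
have -> : 2 * 10 ^+ k * save al ^+ (k2 %/ 2) = 2 * (10 ^+ k1 * 10 ^+ k3) * (10 ^+ k2 * save al ^+ (k2 %/ 2)).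
  by rewrite -kE /k' !exprD; ring.
by rewrite ler_wpM2r // mulr_ge0 ?exprn_ge0 // save_ge0.
Qed.

(** The complete blocks of 10^(4 u) integers are covered by [digital_full]; the last,
  incomplete one is bounded trivially. *)
Lemma digital_typeI (k u D s : nat) : (0 < u)%N -> (10 * u <= k)%N -> (0 < D <= 10 ^ (2 * u))%N ->
  (D * s < 10 ^ k)%N ->
  cn (\sum_(f < s) gc k (D * f.+1)%N) <= (2 * 10 ^+ k * save al ^+ u + 2 * 10 ^+ (4 * u)) / D%:R.
Proof.
move=> u0 uk /andP[D0 D1] Dk; have DR : 0 < D%:R :> R by rewrite ltr0n.
case: (boolP (coprime D 10)) => cD; last first.
  rewrite big1 ?cn0 => [|f _]; last by rewrite /gc coprimeMl (negbTE cD) mul0r.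
  by have sv := save_ge0 al; nneg.
pose F n : C := if (D %| n)%N then gc k n else 0.
have -> : \sum_(f < s) gc k (D * f.+1)%N = \sum_(n < (D * s).+1) F n.
  rewrite /F -big_mkcond (sum_multiples (D * s).+1 (gc k) D0).
  transitivity (\sum_(f < s.+1) gc k (D * f)%N).
    by rewrite big_ord_recl /= muln0 {2}/gc mul0r add0r.
  have le : (s.+1 <= (D * s).+1)%N by rewrite ltnS leq_pmull.
  rewrite (big_ord_widen _ (fun f => gc k (D * f)%N) le); apply: eq_bigl => f.
  by rewrite !ltnS leq_pmul2l.
set k' := (4 * u)%N; set N := (D * s).+1; set Q := (N %/ 10 ^ k')%N.
have k'E : (2 * u + 2 * u = k')%N by rewrite -mulnDl.
have QN : (Q * 10 ^ k' <= N)%N by exact: leq_divM.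
rewrite (big_ord_cat F QN) (sum_mul (10 ^ k') Q F) mulrDl.
apply: le_trans (cnD _ _) _; apply: lerD.
  rewrite -k'E; apply: le_trans (@digital_full k (2 * u) (2 * u) D Q _ _ _ _ _ _) _; rewrite ?D0 ?muln_gt0 //.
  - by clear - uk; lia.
  - by apply: leq_trans D1 _; rewrite leq_exp2l //; clear - uk; lia.
  - rewrite k'E /Q -ltnS ltn_divLR ?expn_gt0 // mulSn -expnD subnK; last by clear - uk; lia.
    by rewrite /N (leq_ltn_trans Dk) // -[X in (X < _)%N]add0n ltn_add2r expn_gt0.
  by rewrite mulKn.
apply: le_trans (cn_sum _ _ _) _.
set L := (N - Q * 10 ^ k')%N.
have L1 : (L <= 10 ^ k')%N.
  by rewrite /L {1}(divn_eq N (10 ^ k')) addKn ltnW // ltn_pmod // expn_gt0.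
apply: (@le_trans _ _ (\sum_(i < L | (D%:Z %| - (Q * 10 ^ k')%N%:Z - i%:Z)%Z) 1)).
  rewrite [leRHS]big_mkcond; apply: ler_sum => i _; rewrite /F -opprD -PoszD dvdzE abszN /=.
  by case: ifP => _; rewrite ?cn_gc ?cn0.
rewrite sumr_const.
apply: (@le_trans _ _ (L %/ D + 1)%:R); first by rewrite ler_nat count_congr.
rewrite ler_pdivlMr // -natrX -!natrM ler_nat mulnDl mul1n mul2n -addnn leq_add //.
  by apply: leq_trans (leq_divM _ _) _.
by apply: leq_trans D1 _; rewrite leq_exp2l // /k' leq_mul2r orbT.
Qed.

End DigitalTypeI.

Section PrimePowers.
Variable R : realType.

(** A prime p < P has at most 4 k powers below 10^k, each of weight ln p <= 3 k. *)
Lemma prime_power_mass (Q : nat -> nat -> bool) (f : nat -> R) x k P : (x <= 10 ^ k)%N ->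
  (forall n, (n < x)%N -> f n <=
     \sum_(p < x | prime p) \sum_(j < x | (p ^ j.+1 == n)%N && Q p j) ln p%:R) ->
  (forall p j, prime p -> Q p j -> (p ^ j.+1 < x)%N -> (p < P)%N) ->
  \sum_(n < x) f n <= (P * (4 * k) * (3 * k))%:R.
Proof.
move=> xk fQ QP.
apply: (@le_trans _ _ (\sum_(p < x | (p < P)%N) \sum_(j < x | (j < 4 * k)%N) (3 * k)%:R)).
  apply: (le_trans (ler_sum _ (fun (n : 'I_x) _ => fQ n (ltn_ord n)))).
  rewrite exchange_big /= big_mkcond [leRHS]big_mkcond; apply: ler_sum => p _.
  case: ifP => pp; last by case: ifP => // _; apply: sumr_ge0.
  under eq_bigr => n _ do rewrite big_mkcond.
  rewrite exchange_big /=.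
  have E (j : 'I_x) : \sum_(n < x) (if (p ^ j.+1 == n)%N && Q p j then ln p%:R else 0) =
     if Q p j && (p ^ j.+1 < x)%N then ln p%:R else 0 :> R.
    case: (boolP (Q p j)) => q /=; last by rewrite big1 // => n _; rewrite andbF.
    case: ltnP => lx.
      rewrite (bigD1 (Ordinal lx)) //= eqxx big1 ?addr0 // => n ne.
      by case: eqP => // En; case/eqP: ne; apply/val_inj.
    rewrite big1 // => n _; case: eqP => //= En.
    by have := ltn_ord n; rewrite -En ltnNge lx.
  under eq_bigr => j _ do rewrite E.
  case: ifP => pP; last first.
    rewrite big1 // => j _; case: ifP => // /andP[q lx].
    by rewrite (QP _ _ pp q lx) in pP.
  rewrite [leRHS]big_mkcond; apply: ler_sum => j _.
  case: ifP => [/andP[q lx]|_]; last by case: ifP.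
  rewrite ifT.
    apply: ln_pow10; apply: leq_trans xk; apply: leq_trans (ltnW lx).
    by rewrite -[leqLHS]expn1 leq_exp2l ?prime_gt1.
  rewrite -(ltn_exp2l _ _ (isT : 1 < 2)%N).
  apply: leq_trans (_ : p ^ j.+1 <= _)%N.
    apply: (@leq_trans (2 ^ j.+1)); first by rewrite ltn_exp2l.
    by rewrite leq_exp2r // prime_gt1.
  apply: ltnW; apply: leq_trans lx _; apply: leq_trans xk _.
  by rewrite expnM; case: (k) => // k1; rewrite leq_exp2r.
apply: le_trans (@sum_lt_le R (fun=> \sum_(j < x | (j < 4 * k)%N) (3 * k)%:R) x P _) _.
  by move=> _; apply: sumr_ge0.
rewrite -mulnA [leRHS]natrM; apply: sum_le_const => _.
apply: le_trans (@sum_lt_le R (fun=> (3 * k)%:R) x (4 * k) _) _ => //.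
by rewrite [leRHS]natrM; apply: sum_le_const.
Qed.

Lemma Lam_not_coprime x k : (x <= 10 ^ k)%N ->
  \sum_(n < x) (if coprime n 10 then 0 else Lam R n) <= (72 * k ^ 2)%:R.
Proof.
move=> xk; have -> : (72 * k ^ 2 = 6 * (4 * k) * (3 * k))%N by rewrite -mulnn; ring.
apply: (@prime_power_mass (fun p _ => ~~ coprime p 10) (fun n => if coprime n 10 then 0 else Lam R n) x k 6 xk).
  move=> n nx; have ge0 : 0 <= \sum_(p < x | prime p)
      \sum_(j < x | (p ^ j.+1 == n)%N && ~~ coprime p 10) ln p%:R :> R.
    by apply: sumr_ge0 => p _; apply: sumr_ge0 => j _; apply: ln_nat_ge0.
  case: ifP => // cn; rewrite (Lam_widen R nx); apply: ler_sum => p _.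
  rewrite le_eqVlt (eq_bigl (fun j : 'I_x => (p ^ j.+1 == n)%N && ~~ coprime p 10)) ?eqxx // => j.
  by case: eqP => //= E; move: cn; rewrite -E coprime_pexpl // => ->.
move=> p j pp; rewrite prime_coprime // negbK => d10 _.
have le := dvdn_leq (isT : 0 < 10)%N d10.
by move: p le pp d10; do 11![case=> //].
Qed.

End PrimePowers.

Lemma small_inverse (R : realFieldType) (p : R) : 36 * (4000 * p) <= 1 -> p <= 100^-1.
Proof. lra. Qed.

Section Far.
Variable R : realType.
Notation C := R[i].
Variable al : R.

(** [vaughan] is applied to the character restricted to integers coprime to 10; the
  powers of 2 and 5 that this discards have negligible mass. *)
Theorem far_sum (k t x : nat) : (0 < t)%N -> (16 * t < k %/ 2000)%N -> (36 * k + 3 <= 10 ^ t)%N ->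
  4 * save al ^+ (k %/ 2000 %/ 2) ^+ 2 * 10 ^+ (20 * t) <= 1 -> (x <= 10 ^ k)%N ->
  cn (\sum_(n < x) (Lam R n)%:C * g al k n) <= 400 * k%:R ^+ 2 * 10 ^+ k / 10 ^+ t.
Proof.
move=> t0 tW kt sv xk.
set W := (k %/ 2000)%N in tW sv; set u := (k %/ 10)%N.
have W1 : (2000 * W <= k)%N by rewrite mulnC leq_divM.
have W2 : (k < 2000 * W + 2000)%N by have := ltn_ceil k (isT : 0 < 2000)%N; rewrite -/W; clear; lia.
have u1 : (10 * u <= k)%N by rewrite mulnC leq_divM.
have u2 : (k < 10 * u + 10)%N by have := ltn_ceil k (isT : 0 < 10)%N; rewrite -/u; clear; lia.
clearbody W u.
have uW : (199 * W <= u)%N by clear - W1 u2 tW; lia.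
have T0 n : 0 < 10 ^+ n :> R by rewrite exprn_gt0.
pose p : R := (10 ^+ t)^-1; have p0 : 0 < p by rewrite invr_gt0.
have svu : save al ^+ u <= p ^+ 10.
  have s0 := save_ge0 al; have s1 := save_le1 al.
  apply: (@le_trans _ _ (save al ^+ (W %/ 2))).
    by apply: ler_wiXn2l => //; apply: leq_trans (leq_div _ _) _; clear - uW; lia.
  rewrite -(ler_pXn2r (ltn0Sn 1)) ?nnegrE ?exprn_ge0 ?(ltW p0) //.
  have -> : (p ^+ 10) ^+ 2 = (10 ^+ (20 * t))^-1 by rewrite /p -exprM !exprVn -exprM mulnC.
  rewrite -[leRHS]mul1r ler_pdivlMr //; apply: le_trans sv.
  by rewrite -mulrA -[leLHS]mul1r ler_wpM2r ?ler1n // mulr_ge0 ?sqr_ge0 ?exprn_ge0.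
have typeI D s : (0 < D <= 10 ^ (2 * u))%N -> (D * s < 10 ^ k)%N ->
    cn (\sum_(f < s) gc al k (D * f.+1)%N) <= (4 * 10 ^+ k * p ^+ 10) / D%:R.
  move=> DU Ds; apply: le_trans (digital_typeI _ _ _ DU Ds) _ => //; first by clear - uW tW; lia.
  rewrite ler_wpM2r ?invr_ge0 //.
  have -> : 4 * 10 ^+ k * p ^+ 10 = 2 * 10 ^+ k * p ^+ 10 + 2 * (10 ^+ k * p ^+ 10) :> R by ring.
  apply: lerD; first by rewrite ler_wpM2l // mulr_ge0 // ltW.
  rewrite ler_wpM2l // /p exprVn -exprM ler_pdivlMr // -exprD ler_weXn2l ?ler1n //.
  by clear - u1 uW tW; lia.
have typeII j c Y (a b : nat -> C) :
  (forall n, cn (a n) <= 1) -> (forall n, cn (b n) <= 1) ->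
  (10 ^ (4 * t) <= 10 * c)%N -> (c < 10 ^ (4 * t))%N -> (u.+1 <= j + 4 * t)%N ->
  (j + 4 * t <= k - u)%N -> (10 ^ u <= Y)%N -> (c * 10 ^ j * Y <= 10 ^ k)%N ->
  cn (\sum_(m < 10 ^ j) \sum_(n < Y) a m * b n * gc al k ((c * 10 ^ j + m) * n)%N) <=
  (10 * p) * (10 ^+ k / c%:R).
  move=> a1 b1 tc ct ju jk UY cY.
  have c0 : (0 < c)%N by move: tc; have := expn_gt0 10 (4 * t); lia.
  pose a' m : C := a m * (coprime (c * 10 ^ j + m) 10)%:R.
  pose b' n : C := b n * (coprime n 10)%:R.
  have ind (z : C) (B : bool) : cn z <= 1 -> cn (z * B%:R) <= 1.
    by case: B => z1; rewrite ?mulr1 ?mulr0 ?cn0.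
  have -> : \sum_(m < 10 ^ j) \sum_(n < Y) a m * b n * gc al k ((c * 10 ^ j + m) * n)%N =
    \sum_(m < 10 ^ j) \sum_(n < Y) a' m * b' n * g al k ((c * 10 ^ j + m) * n)%N.
    apply: eq_bigr => m _; apply: eq_bigr => n _; rewrite /a' /b' /gc coprimeMl -mulnb natrM; ring.
  apply: (le_trans (@typeII_digital R al k t W j c Y t0 tc ct _ _ _ _ _ _ sv a' b' _ _)).
  - by clear - jk uW tW u1; lia.
  - by [].
  - by clear - ju uW tW; lia.
  - apply: leq_trans (_ : 10 ^ t <= _)%N; last by rewrite leq_exp2l //; clear - tW; lia.
    by apply: leq_trans kt; rewrite leq_add2r leq_mul2l /=; clear - jk uW tW u1; lia.
  - by clear - ju uW tW; lia.
  - by apply: leq_trans UY; rewrite leq_exp2l //; clear - uW tW; lia.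
  - by move=> n; apply: ind.
  - by move=> n; apply: ind.
  rewrite -mulrA [_ / 10 ^+ t]mulrC -/p mulrA ler_wpM2l ?mulr_ge0 ?(ltW p0) //.
  by rewrite ler_pdivlMr ?ltr0n // -!natrM -natrX ler_nat mulnC mulnA.
have := @vaughan R k u (4 * t) x (gc al k) (4 * 10 ^+ k * p ^+ 10) (10 * p) (cn_gc al k) xk _ _ _ _ _ typeI typeII.
set S := cn _ => vau.
have {vau} : S <= 310 * k%:R ^+ 2 * 10 ^+ k * p.
  have u0 : (0 < u)%N by clear - uW tW; lia.
  apply: le_trans (vau _ _ _ _ _) _ => {vau} //; rewrite ?muln_gt0 ?t0 //=.
  - by clear - uW tW; lia.
  - by clear - u1; lia.
  - by nneg.
  - by nneg.
  set A : R := 10 ^+ k; have A0 : 0 < A by apply: T0.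
  have kp : (36 * k)%:R * p <= 1 :> R.
    rewrite /p ler_pdivrMr // mul1r -natrX ler_nat; apply: leq_trans kt; exact: leq_addr.
  have k1 : (4000 <= k)%N by clear - tW W1 t0; lia.
  have kR : 4000 <= k%:R :> R by rewrite ler_nat.
  have p6 : p <= 100^-1.
    have : 36 * (4000 * p) <= 1.
      by apply: le_trans kp; rewrite natrM -mulrA ler_wpM2l // ler_wpM2r ?(ltW p0).
    exact: small_inverse.
  have q1 : 10 ^+ u * (3 * k)%:R <= k%:R ^+ 2 * (A * p).
    rewrite mulrC; apply: ler_pM; rewrite ?exprn_ge0 //.
      by rewrite -natrX ler_nat -mulnn leq_mul //; clear - k1; lia.
    by rewrite /p ler_pdivlMr // -exprD ler_weXn2l ?ler1n //; clear - u1 uW tW; lia.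
  have pn (n : nat) : (0 < n)%N -> p ^+ n <= p.
    move=> n0; rewrite -[leRHS]expr1; apply: ler_wiXn2l => //; first exact: ltW.
    by apply: le_trans p6 _; rewrite invf_le1 // ler1n.
  have q2 : (9 * u)%:R * ((9 * u).+2%:R * (3 * k)%:R * (4 * A * p ^+ 10)) <= k%:R ^+ 2 * (A * p).
    have e1 : (9 * u)%:R * (9 * u).+2%:R <= k%:R ^+ 2 :> R.
      by rewrite -natrM -natrX ler_nat -mulnn leq_mul //; clear - u1 u0 k1; lia.
    have e2 : (3 * k)%:R * (4 * A * p ^+ 10) <= A * p.
      have -> : (3 * k)%:R * (4 * A * p ^+ 10) = ((12 * k)%:R * p ^+ 9) * (A * p) by rewrite !natrM; ring.
      rewrite -[leRHS]mul1r; apply: ler_wpM2r; first by nneg.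
      apply: le_trans kp; apply: ler_pM; rewrite ?exprn_ge0 ?(ltW p0) ?pn //.
      by rewrite ler_nat leq_mul2r orbT.
    have -> : (9 * u)%:R * ((9 * u).+2%:R * (3 * k)%:R * (4 * A * p ^+ 10)) =
      ((9 * u)%:R * (9 * u).+2%:R) * ((3 * k)%:R * (4 * A * p ^+ 10)) by rewrite -!mulrA.
    by apply: ler_pM => //; nneg.
  have q3 : 10 * (10 * p) + 100 / 10 ^+ (4 * t) + 2 / 10 ^+ u <= 102 * p.
    have -> : (10 ^+ (4 * t))^-1 = p * p ^+ 3 by rewrite mulnC exprM -exprVn exprS.
    have r1 : p ^+ 3 <= 100^-1.
      exact: le_trans (pn 3%N isT) p6.
    have r2 : 2 / 10 ^+ u <= p.
      rewrite ler_pdivrMr // /p ler_pdivlMl // mulrC.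
      apply: le_trans (_ : 10 ^+ t.+1 <= _); last by rewrite ler_weXn2l ?ler1n //; clear - uW tW; lia.
      by rewrite exprS ler_wpM2r ?ler_nat // ltW.
    have := ler_wpM2l (ltW p0) r1; move: r2; move: (p * p ^+ 3) (2 / 10 ^+ u) => a b; clear; lra.
  have q4 : (3 * k)%:R * (k%:R * A * (10 * (10 * p) + 100 / 10 ^+ (4 * t) + 2 / 10 ^+ u)) <=
      308 * (k%:R ^+ 2 * (A * p)).
    apply: (@le_trans _ _ ((3 * k)%:R * (k%:R * A * (102 * p)))).
      by rewrite !ler_wpM2l //; nneg.
    have -> : (3 * k)%:R * (k%:R * A * (102 * p)) = 306 * (k%:R ^+ 2 * (A * p)) by rewrite natrM; ring.
    by apply: ler_wpM2r; [nneg | rewrite ler_nat].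
  have -> : 310 * k%:R ^+ 2 * A * p = k%:R ^+ 2 * (A * p) + k%:R ^+ 2 * (A * p) + 308 * (k%:R ^+ 2 * (A * p)) by ring.
  by rewrite !lerD.
move=> {}vau.
have -> : \sum_(n < x) (Lam R n)%:C * g al k n = \sum_(n < x) (Lam R n)%:C * gc al k n +
   \sum_(n < x) (if coprime n 10 then 0 else Lam R n)%:C * g al k n.
  rewrite -big_split; apply: eq_bigr => n _ /=; rewrite /gc.
  by case: ifP => _; rewrite ?mul1r ?mul0r ?mulr0 ?add0r // addr0.
apply: le_trans (cnD _ _) _.
have -> : 400 * k%:R ^+ 2 * 10 ^+ k / 10 ^+ t = 310 * k%:R ^+ 2 * 10 ^+ k * p + 90 * k%:R ^+ 2 * (10 ^+ k * p).
  by rewrite /p; ring.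
apply: lerD => //; apply: le_trans (cn_sum _ _ _) _.
have le : \sum_(i < x) cn ((if coprime i 10 then 0 else Lam R i)%:C * g al k i) <= (72 * k ^ 2)%:R.
  apply: le_trans (Lam_not_coprime R xk); apply: ler_sum => n _.
  by rewrite cnM cn_g mulr1 cn_real ger0_norm //; case: ifP => _; rewrite ?Lam_ge0.
apply: le_trans le _; rewrite natrM natrX -[leLHS]mulr1; apply: ler_pM; rewrite ?mulr_ge0 ?exprn_ge0 //.
  by rewrite ler_wpM2r ?sqr_ge0 // ler_nat.
by rewrite /p ler_pdivlMr // mul1r ler_weXn2l ?ler1n //; clear - tW W1; lia.
Qed.

End Far.

(** * Taylor's formula for the cosine and trigonometric polynomials *)

Section CosineTaylor.
Variable R : realType.

Lemma le_of_derive (f f' : R -> R) (y : R) : (forall x : R, is_derive x 1 f (f' x)) ->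
  (forall x, 0 <= x -> 0 <= f' x) -> 0 <= y -> f 0 <= f y.
Proof.
move=> df f0; rewrite le_eqVlt => /orP[/eqP<-//|y0].
have H2 : {within `[0, y], continuous f}%classic.
  apply: continuous_subspaceT => t; apply: differentiable_continuous.
  by apply/derivable1_diffP; case: (df t).
have [c] := MVT y0 (fun t _ => df t) H2.
rewrite in_itv /= => /andP[c0 _] E; rewrite -subr_ge0 E mulr_ge0 ?f0 ?subr_ge0 ?ltW //.
Qed.

Let h r (t : R) : R := t ^+ r / r`!%:R.

Let dh r (t : R) : is_derive t 1 (h r.+1) (h r t).
Proof.
have -> : h r.+1 = (r.+1)`!%:R^-1 \*: ((@id R) ^+ r.+1).
  by apply/funext => z; rewrite /h /= mulrC exprfctE.
apply: is_derive_eq; rewrite /h /GRing.scale /= mulr1 factS natrM invfM mulrC -!mulrA.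
by rewrite mulrCA; congr (_ * _); rewrite mulrA mulfV ?mul1r // pnatr_eq0.
Qed.

(** The derivatives at 0 of a cos + b sin. *)
Fixpoint trig_coef r (a b : R) : R := if r is r'.+1 then trig_coef r' b (- a) else a.

(** The statement about all combinations a cos + b sin is stable under integration,
  which the induction on J needs. *)
Lemma trig_taylor J (a b t : R) : a ^+ 2 + b ^+ 2 = 1 -> 0 <= t ->
  a * cos t + b * sin t - \sum_(r < J) trig_coef r a b * (t ^+ r / r`!%:R) <= t ^+ J / J`!%:R.
Proof.
elim: J a b t => [|J IH] a b t ab t0.
  rewrite big_ord0 subr0 expr0 fact0 divr1.
  have := cos2Dsin2 t; set c := cos t; set s := sin t => cs.
  have : 0 <= (a * s - b * c) ^+ 2 := sqr_ge0 _.
  have : (a * c + b * s) ^+ 2 + (a * s - b * c) ^+ 2 = 1.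
    by transitivity ((a ^+ 2 + b ^+ 2) * (c ^+ 2 + s ^+ 2)); [ring | rewrite ab cs mulr1].
  move=> E E0; have {E E0} : (a * c + b * s) ^+ 2 <= 1 by lra.
  by move: (_ + _) => y; nra.
pose f (x : R) := h J.+1 x - (a * cos x + b * sin x - \sum_(r < J.+1) trig_coef r a b * h r x).
pose f' (x : R) := h J x - (b * cos x + (- a) * sin x - \sum_(r < J) trig_coef r b (- a) * h r x).
have df (x : R) : is_derive x 1 f (f' x).
  have -> : f = h J.+1 - ((a \*: @cos R) + (b \*: @sin R) -
    (cst a + \sum_(r < J) (trig_coef r b (- a) \*: h r.+1))).
    apply/funext => z; rewrite /f !fctE /=; congr (_ - (_ - _)).
    by rewrite big_ord_recl /= {1}/h expr0 fact0 divr1 mulr1 fct_sumE.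
  have D1 := is_deriveD (is_deriveZ a (is_derive_cos x)) (is_deriveZ b (is_derive_sin x)).
  have D2 := is_derive_sum (fun r : 'I_J => is_deriveZ (trig_coef r b (- a)) (dh r x)).
  have D := is_deriveB (dh J x) (is_deriveB D1 (is_deriveD (is_derive_cst a x 1) D2)).
  apply: (is_derive_eq D); rewrite /f' add0r /GRing.scale /= mulrN; congr (_ - (_ - _)).
  by rewrite mulNr addrC.
have : f 0 <= f t.
  apply: (le_of_derive df) => // x x0; rewrite /f' subr_ge0; apply: IH => //.
  by rewrite sqrrN addrC.
have -> : f 0 = 0.
  rewrite /f cos0 sin0 mulr0 addr0 mulr1 big_ord_recl /= {2}/h expr0 fact0 divr1 mulr1.
  rewrite big1 ?addr0 ?subrr ?subr0; first by rewrite /h expr0n mul0r.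
  by move=> r _; rewrite /h expr0n /= mul0r mulr0.
by rewrite subr_ge0.
Qed.

Lemma cos_taylor J (y : R) :
  `|cos y - \sum_(r < J) (-1) ^+ r * (y ^+ (2 * r) / (2 * r)`!%:R)| <= y ^+ (2 * J) / (2 * J)`!%:R.
Proof.
wlog y0 : y / 0 <= y.
  move=> H; case: (lerP 0 y) => y0; first exact: H.
  have := H (- y); rewrite cosN exprM sqrrN -exprM.
  under eq_bigr => r _ do rewrite exprM sqrrN -exprM.
  by apply; rewrite oppr_ge0 ltW.
have coefs (s : R) r : (trig_coef (2 * r) s 0 = (-1) ^+ r * s) /\ (trig_coef (2 * r).+1 s 0 = 0).
  elim: r s => [|r IH] s; first by rewrite /= expr0 mul1r.
  have -> : (2 * r.+1 = (2 * r).+2)%N by rewrite mulnS.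
  have [-> ->] : trig_coef (2 * r).+2 s 0 = trig_coef (2 * r) (- s) (- 0) /\
    trig_coef (2 * r).+3 s 0 = trig_coef (2 * r).+1 (- s) (- 0) by split.
  by rewrite oppr0; case: (IH (- s)) => -> ->; rewrite exprS mulN1r mulrN mulNr.
have sums (s : R) : \sum_(r < 2 * J) trig_coef r s 0 * (y ^+ r / r`!%:R) =
    s * \sum_(r < J) (-1) ^+ r * (y ^+ (2 * r) / (2 * r)`!%:R).
  elim: J => [|J IH]; first by rewrite muln0 !big_ord0 mulr0.
  rewrite mulnS !big_ord_recr /= {}IH mulrDr; case: (coefs s J) => -> /= E.
  by rewrite E mul0r addr0; congr (_ + _); ring.
have P1 := @trig_taylor (2 * J) 1 0 y; have P2 := @trig_taylor (2 * J) (-1) 0 y.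
rewrite !sums !mul0r !addr0 in P1 P2.
rewrite ler_norml; apply/andP; split.
  by have := P2 _ y0; rewrite sqrrN expr1n expr0n addr0 => /(_ erefl); lra.
by have := P1 _ y0; rewrite expr1n expr0n addr0 => /(_ erefl); lra.
Qed.

End CosineTaylor.

Section Wiener.
Variable R : realType.
Notation C := R[i].
Variable N : nat.
Hypothesis N0 : (0 < N)%N.

(** The Wiener algebra of trigonometric polynomials modulo N, normed by the sum of
  the moduli of the coefficients. *)
Definition wiener (A : R) (f : nat -> C) := exists s : seq (C * int),
  (forall n, f n = \sum_(i <- s) i.1 * w R N (i.2 * n%:Z)) /\ \sum_(i <- s) cn i.1 <= A.

Lemma wiener_le A B f : A <= B -> wiener A f -> wiener B f.
Proof. by move=> AB [s [sE sA]]; exists s; split => //; apply: le_trans sA AB. Qed.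

Lemma wiener_ext A f f' : (forall n, f n = f' n) -> wiener A f -> wiener A f'.
Proof. by move=> E [s [sE sA]]; exists s; split => // n; rewrite -E. Qed.

Lemma wiener_cst z : wiener (cn z) (fun=> z).
Proof.
exists [:: (z, 0)]; split => [n|]; rewrite big_seq1 //=.
by rewrite mul0r w0 mulr1.
Qed.

Lemma wienerD A B f f' : wiener A f -> wiener B f' -> wiener (A + B) (fun n => f n + f' n).
Proof.
move=> [s [sE sA]] [s' [sE' sA']]; exists (s ++ s'); split => [n|]; rewrite big_cat ?sE ?sE' //=.
exact: lerD.
Qed.

Lemma wienerM A B f f' : 0 <= A -> wiener A f -> wiener B f' -> wiener (A * B) (fun n => f n * f' n).
Proof.
move=> A0 [s [sE sA]] [s' [sE' sA']].
exists [seq (i.1 * j.1, i.2 + j.2) | i <- s, j <- s']; split => [n|].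
  rewrite big_allpairs_dep sE sE' mulr_suml; apply: eq_bigr => i _.
  rewrite mulr_sumr; apply: eq_bigr => j _ /=; rewrite mulrDl wD; ring.
rewrite big_allpairs_dep; apply: (@le_trans _ _ ((\sum_(i <- s) cn i.1) * (\sum_(j <- s') cn j.1))).
  rewrite mulr_suml; apply: ler_sum => i _; rewrite mulr_sumr; apply: ler_sum => j _ /=.
  by rewrite cnM.
by apply: ler_pM => //; apply: sumr_ge0 => i _; apply: cn_ge0.
Qed.

Lemma wienerX A f r : 0 <= A -> wiener A f -> wiener (A ^+ r) (fun n => f n ^+ r).
Proof.
move=> A0 fA; elim: r => [|r IH]; first by have := wiener_cst 1; rewrite cn1.
rewrite exprS; apply: wiener_ext (wienerM A0 fA IH) => n; by rewrite exprS.
Qed.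

Lemma wiener_sum m A (f : nat -> nat -> C) : (forall i, (i < m)%N -> wiener A (f i)) ->
  wiener (m%:R * A) (fun n => \sum_(i < m) f i n).
Proof.
elim: m => [|m IH] fA.
  exists [::]; split => [n|]; rewrite ?big_nil ?big_ord0 //; by rewrite mul0r.
rewrite mulrSr mulrDl mul1r.
apply: wiener_ext (wienerD (IH _) (fA m (ltnSn m))) => [n|i im].
  by rewrite big_ord_recr.
by apply: fA; apply: ltnW.
Qed.

Lemma wiener_hat A f : wiener A f -> \sum_(h < N) cn (hat N f h%:Z) <= A.
Proof.
move=> [s [sE sA]]; apply: le_trans sA.
have NR : N%:R != 0 :> C by rewrite pnatr_eq0 -lt0n.
have E (h : 'I_N) : hat N f h%:Z = \sum_(i <- s) (if (N%:Z %| i.2 - h%:Z)%Z then i.1 else 0).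
  rewrite /hat; under eq_bigr => x _ do rewrite sE mulr_suml.
  rewrite exchange_big mulr_sumr; apply: eq_bigr => i _ /=.
  transitivity (i.1 * (N%:R^-1 * \sum_(x < N) w R N ((i.2 - h%:Z) * x%:Z))).
    rewrite mulrCA; congr (_ * _); rewrite mulr_sumr; apply: eq_bigr => x _.
    by rewrite -mulrA -wD mulrBl.
  by rewrite sum_w //; case: ifP => _; rewrite ?mulr0 // mulVf ?mulr1.
apply: (@le_trans _ _ (\sum_(h < N) \sum_(i <- s) (if (N%:Z %| i.2 - h%:Z)%Z then cn i.1 else 0))).
  apply: ler_sum => h _; rewrite E; apply: le_trans (cn_sum _ _ _) _.
  by apply: ler_sum => i _; case: ifP; rewrite ?cn0.
rewrite exchange_big; apply: ler_sum => i _ /=.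
have [r [rN rE]] : exists r : 'I_N, (i.2 %% N%:Z)%Z = r%:Z /\ true.
  have r0 : 0 <= (i.2 %% N%:Z)%Z by rewrite modz_ge0 // -lt0n.
  have rN : ((i.2 %% N%:Z)%Z < N%:Z) by rewrite ltz_pmod.
  case: (i.2 %% N%:Z)%Z r0 rN => // n _ nN; by exists (Ordinal nN).
rewrite (bigD1 r) //= big1 ?addr0; first by case: ifP; rewrite ?cn_ge0.
move=> h hr; case: ifP => // dv; exfalso; move: dv hr; rewrite -eqz_mod_dvd rN modz_small.
  by move=> /eqP [] E'; case/eqP; apply/val_inj.
by have := ltn_ord h; lia.
Qed.

End Wiener.

(** * Moments of the digit sum of a window *)

Section DigitWiener.
Variable R : realType.
Notation C := R[i].

Let f j n : C := ((n %/ 10 ^ j) %% 10)%:R - 9 / 2.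

Lemma cn_digit j n : cn (f j n) <= 5.
Proof.
have -> : f j n = (((n %/ 10 ^ j) %% 10)%:R - 9 / 2 : R)%:C.
  by rewrite /f rmorphB fmorph_div !rmorph_nat.
have : ((n %/ 10 ^ j) %% 10 < 10)%N by rewrite ltn_pmod.
move: (_ %% 10)%N => d d10; rewrite cn_real ler_norml.
have : d%:R <= 9 :> R by rewrite ler_nat.
have : 0 <= d%:R :> R by [].
by lra.
Qed.

Lemma digit_variation j : \sum_(x < 10 ^ j.+1) cn (f j x.+1 - f j x) <= 100.
Proof.
rewrite expnS (sum_mul (10 ^ j) 10 (fun x => cn (f j x.+1 - f j x))).
have -> : 100 = 10%:R * 10 :> R by rewrite -natrM.
apply: sum_le_const => y.
have N0 : (0 < 10 ^ j)%N by rewrite expn_gt0.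
have lt : ((10 ^ j).-1 < 10 ^ j)%N by rewrite prednK.
rewrite (bigD1 (Ordinal lt)) //= big1 ?addr0 => [|z zl].
  apply: le_trans (cnB _ _) _; apply: (@le_trans _ _ (5 + 5)); first by rewrite lerD ?cn_digit.
  by rewrite -natrD.
have z1 : (z.+1 < 10 ^ j)%N.
  by rewrite ltn_neqAle ltn_ord andbT; apply: contra zl => /eqP E; apply/eqP/val_inj; exact: (congr1 predn E).
by rewrite /f -addnS !divnMDl // !divn_small // subrr cn0.
Qed.

(** A digit has bounded variation over each of its periods, so its Fourier
  coefficients decay like 1 / h and their sum is of the order of the number of
  digits. *)
Lemma wiener_digit j l : (j < l)%N -> wiener (10 ^ l) (1000 * l%:R) (f j).
Proof.
move=> jl; set N := (10 ^ j.+1)%N; have N0 : (0 < N)%N by rewrite expn_gt0.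
have NR : 0 < N%:R :> R by rewrite ltr0n.
have per : periodic N (f j).
  move=> n; rewrite /f /N expnS addnC divnMDl ?expn_gt0 // addnC modnDr //.
have lE : (10 ^ l = N * 10 ^ (l - j.+1))%N by rewrite -expnD subnKC.
exists (map (fun h : 'I_N => (hat N (f j) h%:Z, h%:Z * (10 ^ (l - j.+1))%N%:Z)) (index_enum 'I_N)); split.
  move=> n; rewrite (hat_inv n N0 per) big_map; apply: eq_bigr => h _ /=.
  by congr (_ * _); rewrite lE mulrAC w_scale // expn_gt0.
rewrite big_map /=.
apply: (@le_trans _ _ (\sum_(h < N) (50 * (minn h (N - h))%:R^-1 + (h == 0 :> nat)%:R * 5))).
  apply: ler_sum => h _; have [h0|h0] := posnP h.
    rewrite h0 min0n invr0 mulr0 add0r mul1r.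
    by apply: hat_le => // x; apply: cn_digit.
  rewrite mul0r addr0.
  have hN : (0 < h < N)%N by rewrite h0 ltn_ord.
  have nuw := @nu_w_ge R N h hN; have var := @hat_variation R N (f j) h%:Z N0 per.
  have m0 : 0 < (minn h (N - h))%:R :> R by rewrite ltr0n; case/andP: hN; clear; lia.
  set c := cn (hat _ _ _) in var *; have c0 : 0 <= c by apply: cn_ge0.
  have {var} : c * (2 * (minn h (N - h))%:R / N%:R) <= N%:R^-1 * 100.
    apply: le_trans (ler_wpM2l c0 nuw) (le_trans var _).
    by rewrite ler_wpM2l ?invr_ge0 ?(ltW NR) // digit_variation.
  rewrite mulrA ler_pdivrMr // mulrAC mulVf ?gt_eqF // mul1r => le.
  by rewrite ler_pdivlMr //; move: le; lra.
rewrite big_split /= -mulr_sumr.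
have := @harmonic_sym R j.+1; rewrite -/N => har.
have -> : \sum_(i < N) (i == 0 :> nat)%:R * 5 = 5 :> R.
  rewrite (bigD1 (Ordinal N0)) //= mul1r big1 ?addr0 // => i i0.
  by rewrite (_ : (i == 0 :> nat) = false) ?mul0r //; apply: contraNF i0 => /eqP E; apply/eqP/val_inj.
have jR : j.+1%:R <= l%:R :> R by rewrite ler_nat.
have l1 : 1 <= l%:R :> R by rewrite ler1n (leq_trans _ jl).
move: har; rewrite natrD natrM; move: (\sum_(i < N) _) => S; move: jR; clear -l1; move: (j.+1%:R) => J.
lra.
Qed.

End DigitWiener.

Section WindowMoments.
Variable R : realType.
Notation C := R[i].
Variables (T W x : nat) (wt : nat -> R) (B : R).
Let P := (10 ^ (T + W))%N.
Hypothesis wt0 : forall n, 0 <= wt n.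
Hypothesis B0 : 0 <= B.
Hypothesis W0 : (0 < W)%N.
Hypothesis freq : forall h : nat, (h < P)%N -> ~~ (10 ^ W %| h)%N ->
  cn (\sum_(n < x) (wt n)%:C * w R P (h%:Z * n%:Z)) <= B.

Definition wmean (phi : nat -> R) : R := (10 ^+ W)^-1 * \sum_(v < 10 ^ W) phi v.
Let M := \sum_(n < x) wt n.

Let P0 : (0 < P)%N. Proof. by rewrite expn_gt0. Qed.
Let T0 : (0 < 10 ^ T)%N. Proof. by rewrite expn_gt0. Qed.
Let PE : P = (10 ^ W * 10 ^ T)%N. Proof. by rewrite -expnD addnC. Qed.

(** At a multiple of 10^W the character depends only on the T lowest digits of n, and
  these are independent of n %/ 10^T. *)
Lemma window_hat (phi : nat -> R) (h : nat) : (10 ^ W %| h)%N -> (h < P)%N ->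
  hat P (fun n => (phi (n %/ 10 ^ T)%N)%:C) h%:Z = if h == 0%N then (wmean phi)%:C else 0.
Proof.
move=> /dvdnP[h' ->] hP; rewrite /hat.
have := (sum_mul (10 ^ T) (10 ^ W) (fun n => (phi (n %/ 10 ^ T)%N)%:C * w R P (- ((h' * 10 ^ W)%N%:Z * n%:Z)))).
rewrite -PE => ->.
have E (v : 'I_(10 ^ W)) : \sum_(z < 10 ^ T) (phi ((v * 10 ^ T + z) %/ 10 ^ T)%N)%:C *
    w R P (- ((h' * 10 ^ W)%N%:Z * (v * 10 ^ T + z)%N%:Z)) =
    (phi v)%:C * (if h' == 0%N then (10 ^ T)%:R else 0).
  transitivity ((phi v)%:C * \sum_(z < 10 ^ T) w R (10 ^ T) (- h'%:Z * z%:Z)).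
    rewrite mulr_sumr; apply: eq_bigr => z _; rewrite divnMDl // divn_small // addn0; congr (_ * _).
    rewrite /P expnD -(@w_scale R (10 ^ T) (10 ^ W)) ?expn_gt0 //.
    rewrite -(@w_per R _ (- h'%:Z * z%:Z * _) (- (h' * v)%N%:Z)) ?muln_gt0 ?expn_gt0 //; congr (w _ _ _).
    rewrite !PoszM !PoszD !PoszM; ring.
  congr (_ * _); rewrite sum_w // dvdzE abszN /=; case: eqP => [->|/eqP h0]; first by rewrite dvdn0.
  rewrite ifF //; apply/negP => /dvdn_leq; rewrite lt0n h0 => /(_ isT).
  by move=> le; move: hP; rewrite PE mulnC ltn_pmul2l ?expn_gt0 // ltnNge le.
under eq_bigr => v _ do rewrite E.
rewrite -mulr_suml; case: eqP => [->|h0].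
  rewrite mul0n eqxx /wmean rmorphM fmorphV rmorphXn rmorph_nat rmorph_sum PE natrM invfM !natrX /=.
  by field; rewrite !expf_neq0 // pnatr_eq0.
rewrite !mulr0 ifF //; apply/negP; rewrite muln_eq0 (negbTE (introN eqP h0)) /=.
by rewrite expn_eq0.
Qed.

(** By [window_hat] the multiples of 10^W contribute only the main term, and the
  hypothesis on frequencies bounds all the others. *)
Lemma window_equidist (A : R) (phi : nat -> R) : (forall v, phi (v + 10 ^ W)%N = phi v) ->
  wiener P A (fun n => (phi (n %/ 10 ^ T)%N)%:C) ->
  `|\sum_(n < x) wt n * phi (n %/ 10 ^ T)%N - M * wmean phi| <= A * B.
Proof.
move=> per wA; rewrite -cn_real.
pose F n : C := (phi (n %/ 10 ^ T)%N)%:C.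
have perF : periodic P F.
  move=> n; rewrite /F /P expnD mulnC addnC divnMDl // addnC per //.
have hs := wiener_hat P0 wA.
have E : \sum_(n < x) (wt n)%:C * F n = \sum_(h < P) hat P F h%:Z * (\sum_(n < x) (wt n)%:C * w R P (h%:Z * n%:Z)).
  under eq_bigr => n _ do rewrite (hat_inv n P0 perF) mulr_sumr.
  rewrite exchange_big; apply: eq_bigr => h _; rewrite mulr_sumr; apply: eq_bigr => n _ /=.
  by rewrite mulrCA.
have -> : (\sum_(n < x) wt n * phi (n %/ 10 ^ T)%N - M * wmean phi)%:C =
   \sum_(h < P) (if (10 ^ W %| h)%N then 0 else hat P F h%:Z * (\sum_(n < x) (wt n)%:C * w R P (h%:Z * n%:Z))).
  have -> : (\sum_(n < x) wt n * phi (n %/ 10 ^ T)%N - M * wmean phi)%:C =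
    \sum_(n < x) (wt n)%:C * F n - (M * wmean phi)%:C.
    by rewrite rmorphB rmorph_sum; congr (_ - _); apply: eq_bigr => n _; rewrite rmorphM.
  rewrite E (bigD1 (Ordinal P0)) //= [in RHS](bigD1 (Ordinal P0)) //= dvdn0 add0r.
  rewrite window_hat ?dvdn0 // eqxx.
  have -> : (wmean phi)%:C * (\sum_(n < x) (wt n)%:C * w R P (0%:Z * n%:Z)) = (M * wmean phi)%:C.
    have -> : \sum_(n < x) (wt n)%:C * w R P (0%:Z * n%:Z) = M%:C.
      by rewrite /M rmorph_sum; apply: eq_bigr => n _; rewrite mul0r w0 mulr1.
    by rewrite [RHS]rmorphM [LHS]mulrC.
  rewrite [X in X - _]addrC addrK; apply: eq_bigr => h h0; case: ifP => // dv.
  rewrite window_hat // ifF ?mul0r //; apply: contraNF h0 => /eqP h0; apply/eqP/val_inj => //=.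
apply: le_trans (cn_sum _ _ _) _.
apply: (@le_trans _ _ (\sum_(h < P) cn (hat P F h%:Z) * B)); last first.
  by rewrite -mulr_suml ler_wpM2r.
apply: ler_sum => h _; case: ifP => dv; first by rewrite cn0 mulr_ge0 ?cn_ge0.
by rewrite cnM ler_wpM2l ?cn_ge0 // freq // dv.
Qed.

(** The centred digit sum of the window. *)
Definition wsum (v : nat) : R := (ds W v)%:R - 9 / 2 * W%:R.
Definition wnorm : R := 1000 * ((T + W)%:R ^+ 2).

Lemma wiener_wsum : wiener P wnorm (fun n => (wsum (n %/ 10 ^ T)%N)%:C).
Proof.
have := @wiener_sum R P W (1000 * (T + W)%:R) (fun i n => ((n %/ 10 ^ (T + i)) %% 10)%:R - 9 / 2).
move=> /(_ _)/wiener_le H; apply: wiener_ext (H _ _ _).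
- move=> n; rewrite /wsum /ds rmorphB rmorph_nat natr_sum rmorphM fmorph_div !rmorph_nat sumrB.
  rewrite sumr_const card_ord -[_ *+ W]mulr_natr; congr (_ - _); apply: eq_bigr => i _.
  by rewrite expnD divnMA.
- rewrite /wnorm expr2 mulrCA ler_wpM2l // ler_wpM2r // ler_nat leq_addl //.
- by move=> i iW; apply: wiener_digit; rewrite ltn_add2l.
Qed.

Lemma window_moment r :
  `|\sum_(n < x) wt n * wsum (n %/ 10 ^ T)%N ^+ r - M * wmean (fun v => wsum v ^+ r)| <= wnorm ^+ r * B.
Proof.
apply: (@window_equidist _ (fun v => wsum v ^+ r)).
  by move=> v; rewrite /wsum ds_per.
apply: wiener_ext (wienerX r _ wiener_wsum).
  by move=> n; rewrite rmorphXn.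
by rewrite /wnorm mulr_ge0 ?sqr_ge0.
Qed.

End WindowMoments.

Section WindowAverages.
Variable R : realType.
Notation C := R[i].

Lemma sum_pow_ds (A : comNzRingType) (y : A) W :
  \sum_(v < 10 ^ W) y ^+ ds W v = (\sum_(d < 10) y ^+ d) ^+ W.
Proof.
elim: W => [|W IH]; first by rewrite expn0 big_ord1 ds0 !expr0.
rewrite expnSr (sum_mul 10 (10 ^ W) (fun v => y ^+ ds W.+1 v)) exprSr -IH mulr_suml.
apply: eq_bigr => v _; rewrite mulr_sumr; apply: eq_bigr => d _.
by rewrite dsS modnMDl modn_small // divnMDl // divn_small // addn0 exprD mulrC.
Qed.

Lemma exp_le_quadratic (y : R) : y <= 1 / 2 -> expR y <= 1 + y + 2 * y ^+ 2.
Proof.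
move=> y2; have le : 1 - y <= (expR y)^-1 by rewrite -expRN; have := expR_ge1Dx (- y).
have e0 := expR_gt0 y; have q : 0 < 1 - y by lra.
rewrite -[leLHS]invrK; apply: (@le_trans _ _ (1 - y)^-1); first by rewrite lef_pV2 ?posrE ?invr_gt0.
rewrite -[leLHS]mul1r ler_pdivrMr //; have : 0 <= y ^+ 2 * (1 - 2 * y) by rewrite mulr_ge0 ?sqr_ge0 //; lra.
by move: e0 q; clear; nra.
Qed.

(** The digits are independent, so the mean is a product over the digits, each
  factor being bounded by [exp_le_quadratic]. *)
Lemma wmean_exp W (z : R) : `|z| <= 1 / 9 ->
  wmean W (fun v => expR (z * wsum R W v)) <= expR (17 * z ^+ 2 * W%:R).
Proof.
move=> z9; have [z1 z2] : - (1 / 9) <= z /\ z <= 1 / 9 by move: z9; rewrite ler_norml => /andP.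
have -> : wmean W (fun v => expR (z * wsum R W v)) =
   (10^-1 * \sum_(d < 10) expR ((d%:R - 9 / 2) * z)) ^+ W.
  rewrite /wmean exprMn exprVn; congr (_ * _).
  transitivity (\sum_(v < 10 ^ W) expR z ^+ ds W v * expR (- (9 / 2 * z)) ^+ W).
    apply: eq_bigr => v _; rewrite -!expRM_natl -expRD; congr expR; rewrite /wsum; ring.
  rewrite -mulr_suml sum_pow_ds -exprMn; congr (_ ^+ _).
  rewrite mulr_suml; apply: eq_bigr => d _; rewrite -expRM_natl -expRD; congr expR; ring.
have -> : 17 * z ^+ 2 * W%:R = W%:R * (17 * z ^+ 2) by ring.
rewrite expRM_natl; apply: lerXn2r; rewrite ?nnegrE ?expR_ge0 //.
  by apply: mulr_ge0; rewrite ?invr_ge0 //; apply: sumr_ge0 => d _; apply: expR_ge0.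
apply: le_trans (expR_ge1Dx _); rewrite ler_pdivrMl //.
apply: (@le_trans _ _ (\sum_(d < 10) (1 + (d%:R - 9 / 2) * z + 2 * ((d%:R - 9 / 2) * z) ^+ 2))).
  apply: ler_sum => d _; apply: exp_le_quadratic.
  have : d%:R <= 9 :> R by rewrite ler_nat -ltnS.
  have : 0 <= d%:R :> R by [].
  move: (d%:R : R) => t; move: z1 z2; clear; nra.
rewrite !big_ord_recr big_ord0 /=; have := sqr_ge0 z; move: z1 z2; clear; nra.
Qed.

(** The mean is the W-th power of the mean over one centred digit, which is real by
  the symmetry of the digits and at least 1 - 11 v^2; then Bernoulli's inequality
  applies. *)
Lemma wmean_cos W (v : R) : `|v| <= 1 / 10 ->
  let D := wmean W (fun t => cos (v * wsum R W t)) in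
  0 <= D /\ 1 - 11 * v ^+ 2 * W%:R <= D.
Proof.
move=> v10 D.
have [v1 v2] : - (1 / 10) <= v /\ v <= 1 / 10 by move: v10; rewrite ler_norml => /andP.
pose th : R := v / (2 * pi).
have pi0 := @pi_gt0 R.
have thE : 2 * pi * th = v by rewrite /th mulrC divfK // mulf_neq0 // gt_eqF.
pose c : R := 10^-1 * \sum_(d < 10) cos ((d%:R - 9 / 2) * v).
have sin0 : \sum_(d < 10) sin ((d%:R - 9 / 2) * v) = 0.
  have E : \sum_(d < 10) sin ((d%:R - 9 / 2) * v) = - \sum_(d < 10) sin ((d%:R - 9 / 2) * v).
    rewrite -sumrN (reindex_inj rev_ord_inj) /=; apply: eq_bigr => d _.
    rewrite -sinN; congr sin.
    have -> : (10 - d.+1)%:R = 9 - d%:R :> R by rewrite subSS natrB // -ltnS.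
    by field.
  by move: E; set S := \sum_(_ < _) _; lra.
have DE : D = c ^+ W.
  have : \sum_(t < 10 ^ W) e (th * wsum R W t) = ((10 * c)%:C) ^+ W.
    transitivity (\sum_(t < 10 ^ W) e th ^+ ds W t * e (- (9 / 2 * th)) ^+ W).
      apply: eq_bigr => t _; rewrite -!e_muln -eD; congr e; rewrite /wsum; ring.
    rewrite -mulr_suml sum_pow_ds -exprMn; congr (_ ^+ _).
    rewrite mulr_suml; under eq_bigr => d _ do rewrite -e_muln -eD.
    have c10 : 10 * c = \sum_(d < 10) cos ((d%:R - 9 / 2) * v).
      by rewrite /c mulrA divff ?mul1r // pnatr_eq0.
    apply/eqP; rewrite eq_complex !raddf_sum /= c10.
    apply/andP; split; apply/eqP.
      by apply: eq_bigr => d _; rewrite Re_e; congr cos; rewrite -thE; ring.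
    by rewrite -[RHS]sin0; apply: eq_bigr => d _; rewrite Im_e; congr sin; rewrite -thE; ring.
  move/(congr1 (@complex.Re R)); rewrite raddf_sum /= -rmorphXn /= => E.
  rewrite /D /wmean; have -> : \sum_(t < 10 ^ W) cos (v * wsum R W t) = (10 * c) ^+ W.
    by rewrite -E; apply: eq_bigr => t _; rewrite Re_e mulrA thE.
  have t0 : (10 : R) ^+ W != 0 by rewrite expf_neq0 // pnatr_eq0.
  by rewrite exprMn mulrA mulVf // mul1r.
have c_lo : 1 - 11 * v ^+ 2 <= c.
  have lo (y : R) : 1 - y ^+ 2 / 2 <= cos y.
    have := cos_taylor 1 y; rewrite big_ord1 expr0 mul1r muln0 expr0 muln1 /= divr1 (_ : 2`! = 2)%N // ler_norml => /andP[+ _].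
    by lra.
  rewrite /c ler_pdivlMl //.
  apply: (@le_trans _ _ (\sum_(d < 10) (1 - ((d%:R - 9 / 2) * v) ^+ 2 / 2))); last by apply: ler_sum => d _; apply: lo.
  by rewrite !big_ord_recr big_ord0 /=; have := sqr_ge0 v; clear; nra.
have c_hi : c <= 1.
  rewrite /c ler_pdivrMl // mulr1; have -> : 10 = 10%:R * 1 :> R by rewrite mulr1.
  by apply: sum_le_const => d; apply: cos_le1.
have v11 : 11 * v ^+ 2 <= 1 by move: v1 v2; clear; nra.
have c0 : 0 <= c by move: c_lo v11; clear; lra.
split; first by rewrite DE exprn_ge0.
rewrite DE; elim: (W) => [|n IH]; first by rewrite mulr0 subr0 expr0.
have vv := sqr_ge0 v.
have cn0 : 0 <= c ^+ n by rewrite exprn_ge0.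
have cn1 : c ^+ n <= 1 by rewrite exprn_ile1.
rewrite [c ^+ n.+1]exprS -[n.+1%:R]natr1; move: IH c_lo c0 c_hi vv cn0 cn1; move: (c ^+ n) (v ^+ 2) (n%:R : R) => a q r l1 l2 l3 l4 l5 l6 l7.
have : 0 <= (1 - c) * (1 - a) by rewrite mulr_ge0 ?subr_ge0.
by move: l1 l2; clear; lra.
Qed.

End WindowAverages.

Section NearSum.
Variable R : realType.
Notation C := R[i].

Lemma even_power_le J (z : R) : z ^+ (2 * J) / (2 * J)`!%:R <= expR z + expR (- z).
Proof.
have ez : expR `|z| <= expR z + expR (- z).
  have e1 := expR_ge0 z; have e2 := expR_ge0 (- z).
  by have [z0|z0] := leP 0 z; [rewrite ger0_norm // lerDl | rewrite ltr0_norm // lerDr].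
apply: le_trans ez; case: J => [|J].
  rewrite muln0 expr0 fact0 divr1; apply: le_trans (expR_ge1Dx _); by rewrite lerDl.
apply: le_trans (expR_ge1Dxn (2 * J).+1 (normr_ge0 z)).
have -> : z ^+ (2 * J.+1) = `|z| ^+ (2 * J.+1) by rewrite !exprM real_normK ?num_real.
rewrite mulnS add2n.
by rewrite lerDr.
Qed.

Lemma wmean_le W (phi psi : nat -> R) : (forall t, phi t <= psi t) -> wmean W phi <= wmean W psi.
Proof.
move=> le; rewrite /wmean ler_wpM2l ?invr_ge0 ?exprn_ge0 //; apply: ler_sum => t _; exact: le.
Qed.

(** The exponential moment is used at 2 v, and the ratio (1 / 2)^(2 J) is the
  saving. *)
Lemma tail_moment W J (v : R) : `|v| <= 1 / 20 ->
  wmean W (fun t => (v * wsum R W t) ^+ (2 * J) / (2 * J)`!%:R) <=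
  2 * (4 ^+ J)^-1 * expR (68 * v ^+ 2 * W%:R).
Proof.
move=> v20; have v9 : `|2 * v| <= 1 / 9 by rewrite normrM ger0_norm //; move: v20; lra.
have e1 := wmean_exp W v9; have e2 := @wmean_exp R W (- (2 * v)).
rewrite normrN in e2; move/(_ v9) in e2.
have E : 17 * (2 * v) ^+ 2 * W%:R = 68 * v ^+ 2 * W%:R by ring.
rewrite sqrrN E in e2; rewrite E in e1.
apply: (@le_trans _ _ (wmean W (fun t => (4 ^+ J)^-1 * (expR (2 * v * wsum R W t) + expR (- (2 * v) * wsum R W t))))).
  apply: wmean_le => t; rewrite ler_pdivlMl ?exprn_gt0 // mulNr.
  apply: le_trans (even_power_le J _); rewrite mulrA ler_wpM2r ?invr_ge0 //.
  by rewrite -mulrA [leRHS]exprMn [2 ^+ _]exprM -[2 ^+ 2]natrX.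
rewrite /wmean -mulr_sumr big_split /= mulrCA mulrDr.
have -> : 2 * (4 ^+ J)^-1 * expR (68 * v ^+ 2 * W%:R) =
  (4 ^+ J)^-1 * (expR (68 * v ^+ 2 * W%:R) + expR (68 * v ^+ 2 * W%:R)) by ring.
by rewrite ler_wpM2l ?invr_ge0 ?exprn_ge0 // lerD.
Qed.

Variables (T W x : nat) (wt : nat -> R) (B : R).
Let P := (10 ^ (T + W))%N.
Hypothesis wt0 : forall n, 0 <= wt n.
Hypothesis B0 : 0 <= B.
Hypothesis W0 : (0 < W)%N.
Hypothesis freq : forall h : nat, (h < P)%N -> ~~ (10 ^ W %| h)%N ->
  cn (\sum_(n < x) (wt n)%:C * w R P (h%:Z * n%:Z)) <= B.
Let M := \sum_(n < x) wt n.

(** Replacing the cosine by its Taylor polynomial turns the comparison into one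
  of moments; the remainder is itself controlled by a moment. *)
Theorem near_cos J (v : R) : `|v| <= 1 / 20 ->
  `|\sum_(n < x) wt n * cos (v * wsum R W (n %/ 10 ^ T)%N) -
    M * wmean W (fun t => cos (v * wsum R W t))| <=
  J.+1%:R * wnorm R T W ^+ (2 * J) * B + M * (4 * (4 ^+ J)^-1 * expR (68 * v ^+ 2 * W%:R)).
Proof.
move=> v20; set A := wnorm R T W.
have A1 : 1 <= A.
  rewrite /A /wnorm -natrX -natrM ler1n muln_gt0 expn_gt0 /= addn_gt0 W0 orbT //.
have M0 : 0 <= M by apply: sumr_ge0.
pose a r : R := (-1) ^+ r * (v ^+ (2 * r) / (2 * r)`!%:R).
pose q : R := v ^+ (2 * J) / (2 * J)`!%:R.
have q0 : 0 <= q by rewrite divr_ge0 // exprM exprn_ge0 ?sqr_ge0.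
have fact1 r : 1 <= r`!%:R :> R by rewrite ler1n fact_gt0.
have v1 : `|v| <= 1 by move: v20; lra.
have q_le1 r : `|v ^+ r / r`!%:R| <= 1.
  rewrite normrM normrX normfV [`|r`!%:R|]ger0_norm // ler_pdivrMr ?(lt_le_trans ltr01) // mul1r.
  by apply: le_trans (fact1 r); rewrite exprn_ile1.
pose U n := wsum R W (n %/ 10 ^ T)%N.
have mom r := @window_moment R T W x wt B B0 freq r.
rewrite -/M -/A in mom.
have tay u : `|cos (v * u) - \sum_(r < J) a r * u ^+ (2 * r)| <= q * u ^+ (2 * J).
  have := cos_taylor J (v * u).
  rewrite (eq_bigr (fun r : 'I_J => a r * u ^+ (2 * r))) => [|r _]; last by rewrite exprMn /a; ring.
  by rewrite exprMn mulrAC.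
have X1 : `|\sum_(n < x) wt n * cos (v * U n) - \sum_(r < J) a r * (\sum_(n < x) wt n * U n ^+ (2 * r))| <=
    q * (\sum_(n < x) wt n * U n ^+ (2 * J)).
  have -> : \sum_(r < J) a r * (\sum_(n < x) wt n * U n ^+ (2 * r)) =
     \sum_(n < x) wt n * (\sum_(r < J) a r * U n ^+ (2 * r)).
    under eq_bigr => r _ do rewrite mulr_sumr.
    rewrite exchange_big; apply: eq_bigr => n _; rewrite mulr_sumr; apply: eq_bigr => r _ /=.
    by rewrite mulrCA.
  rewrite -sumrB mulr_sumr; apply: le_trans (ler_norm_sum _ _ _) _; apply: ler_sum => n _.
  by rewrite -mulrBr normrM ger0_norm // mulrCA ler_wpM2l // tay.
have Y1 : `|wmean W (fun t => cos (v * wsum R W t)) - \sum_(r < J) a r * wmean W (fun t => wsum R W t ^+ (2 * r))| <=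
    q * wmean W (fun t => wsum R W t ^+ (2 * J)).
  have i0 : 0 <= (10 ^+ W : R)^-1 by rewrite invr_ge0 exprn_ge0.
  have -> : \sum_(r < J) a r * wmean W (fun t => wsum R W t ^+ (2 * r)) =
     wmean W (fun t => \sum_(r < J) a r * wsum R W t ^+ (2 * r)).
    rewrite /wmean exchange_big mulr_sumr; apply: eq_bigr => r _ /=.
    by rewrite -mulr_sumr mulrCA.
  rewrite /wmean -mulrBr -sumrB normrM ger0_norm // mulrCA ler_wpM2l //.
  apply: le_trans (ler_norm_sum _ _ _) _; rewrite mulr_sumr; apply: ler_sum => t _; exact: tay.
set X := \sum_(n < x) wt n * cos _ in X1 *; set Y := wmean W (fun t => cos _) in Y1 *.
set X' := \sum_(r < J) _ in X1; set Y' := \sum_(r < J) _ in Y1.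
have XY : `|X' - M * Y'| <= J%:R * (A ^+ (2 * J) * B).
  rewrite /X' /Y' mulr_sumr -sumrB; apply: le_trans (ler_norm_sum _ _ _) _.
  apply: sum_le_const => r; rewrite mulrCA -mulrBr normrM -[leRHS]mul1r.
  apply: ler_pM; rewrite ?normr_ge0 //.
    by rewrite /a normrM normrX normrN1 expr1n mul1r q_le1.
  apply: le_trans (mom (2 * r)%N) _; rewrite ler_wpM2r //.
  by apply: ler_weXn2l => //; rewrite leq_mul2l /= ltnW.
have tail : q * wmean W (fun t => wsum R W t ^+ (2 * J)) <= 2 * (4 ^+ J)^-1 * expR (68 * v ^+ 2 * W%:R).
  apply: le_trans (tail_moment W J v20); rewrite /wmean mulrCA ler_wpM2l ?invr_ge0 ?exprn_ge0 //.
  by rewrite mulr_sumr; apply: ler_sum => t _; rewrite exprMn mulrAC.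
have X2 : q * (\sum_(n < x) wt n * U n ^+ (2 * J)) <=
    M * (q * wmean W (fun t => wsum R W t ^+ (2 * J))) + A ^+ (2 * J) * B.
  have m := mom (2 * J)%N; have {m} := ler_normlW m; rewrite -/U lerBlDr => m.
  apply: le_trans (ler_wpM2l q0 m) _; rewrite mulrDr [X in _ + X]mulrCA addrC lerD2l.
  apply: ler_piMl; first by rewrite mulr_ge0 // exprn_ge0 // (le_trans ler01).
  by have := q_le1 (2 * J)%N; rewrite -/q ger0_norm.
have -> : X - M * Y = (X - X') + (X' - M * Y') - M * (Y - Y') by ring.
apply: le_trans (ler_normB _ _) _; rewrite normrM (ger0_norm M0).
have X3 := ler_normD (X - X') (X' - M * Y').
have {Y1} Y2 := ler_wpM2l M0 (le_trans Y1 tail).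
have tM := ler_wpM2l M0 tail.
have -> : J.+1%:R * A ^+ (2 * J) * B = J%:R * (A ^+ (2 * J) * B) + A ^+ (2 * J) * B.
  by rewrite -natr1; ring.
have -> : M * (4 * (4 ^+ J)^-1 * expR (68 * v ^+ 2 * W%:R)) =
  M * (2 * (4 ^+ J)^-1 * expR (68 * v ^+ 2 * W%:R)) + M * (2 * (4 ^+ J)^-1 * expR (68 * v ^+ 2 * W%:R)).
  by ring.
apply: le_trans (lerD (le_trans X3 (lerD (le_trans X1 X2) XY)) Y2) _.
move: tM; move: (M * (q * _)) (M * (2 * _ * _)) (A ^+ _ * B) => r1 r2 r3.
by move: (J%:R * r3) => r4; lra.
Qed.

End NearSum.

(** * Chebyshev and Mertens estimates *)

Section Chebyshev.
Variable R : realType.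

Lemma Lam0 : Lam R 0 = 0.
Proof. by rewrite /Lam big1 // => p; case: p => [[|p] //]. Qed.

Lemma count_multiples d n : (0 < d)%N -> (\sum_(i < n.+1) ((0 < i) && (d %| i)) = n %/ d)%N.
Proof.
move=> d0; rewrite big_mkcond /=.
have -> : (\sum_(i < n.+1) (if true then ((0 < i) && (d %| i) : nat) else 0) =
   \sum_(i < n.+1 | (d %| i)%N) (0 < i))%N.
  by rewrite [RHS]big_mkcond; apply: eq_bigr => i _; case: (d %| i)%N; rewrite ?andbT ?andbF.
rewrite (sum_multiples n.+1 (fun i => (0 < i)%N : nat) d0).
have le : ((n %/ d).+1 <= n.+1)%N by rewrite ltnS leq_div.
rewrite (eq_bigl (fun f : 'I_n.+1 => (f < (n %/ d).+1)%N)) => [|f]; last first.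
  by rewrite !ltnS leq_divRL // mulnC.
rewrite -(big_ord_widen _ (fun f => (0 < d * f)%N : nat) le).
elim: (n %/ d)%N => [|q IH]; first by rewrite big_ord1 muln0.
by rewrite big_ord_recr /= IH muln_gt0 d0; exact: addn1.
Qed.

Lemma ln_fact n : ln n`!%:R = \sum_(d < n.+1) Lam R d * (n %/ d)%:R :> R.
Proof.
have -> : ln n`!%:R = \sum_(i < n.+1) (if (0 < i)%N then ln i%:R else 0) :> R.
  elim: n => [|n IH]; first by rewrite fact0 ln1 big_ord1.
  rewrite factS natrM lnM ?posrE ?ltr0n ?fact_gt0 // IH [RHS]big_ord_recr /= addrC //.
transitivity (\sum_(i < n.+1) \sum_(d < n.+1) Lam R d * ((0 < i) && (d %| i))%N%:R).
  apply: eq_bigr => i _; case: posnP => i0; first by rewrite big1 // => d _; rewrite mulr0.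
  rewrite -(@sum_Lam R i n.+1) ?i0 ?ltn_ord // big_mkcond; apply: eq_bigr => d _.
  by case: ifP => _; rewrite ?mulr1 ?mulr0.
rewrite exchange_big; apply: eq_bigr => d _; rewrite -mulr_sumr; have [d0|d0] := posnP d.
  by rewrite d0 Lam0 !mul0r.
by rewrite -count_multiples // natr_sum.
Qed.

Lemma bin_le_2exp n m : ('C(n, m) <= 2 ^ n)%N.
Proof.
have [mn|nm] := leqP m n; last by rewrite bin_small.
have := expnDn 1 1 n; rewrite addn1 => ->.
rewrite (bigD1 (Ordinal (mn : m < n.+1)%N)) //= !exp1n !muln1; exact: leq_addr.
Qed.

Lemma ln2_le1 : ln 2 <= 1 :> R.
Proof.
have := @le_ln1Dx R 1; have -> : 1 + 1 = 2 :> R by [].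
by apply; lra.
Qed.

(** Induction by halving n. With m = n / 2 and l = n - m, the weight
  floor (n / d) - floor (m / d) - floor (l / d) of Lam d in the logarithm of the
  binomial coefficient (n, m) is at least 1 for l < d <= n. *)
Lemma chebyshev_upper n : \sum_(d < n.+1) Lam R d <= 3 * n%:R.
Proof.
have [N] := ubnP n; elim: N n => // N IH n nN.
have [n1|n1] := leqP n 1.
  have l0 : \sum_(d < n.+1) Lam R d = 0.
    have L1 : Lam R 1 = 0.
      apply/eqP; rewrite eq_le Lam_ge0 andbT -[leRHS](@ln1 R) -(@sum_Lam R 1 2) //.
      by rewrite (bigD1 ord_max) //= lerDl; apply: sumr_ge0 => d _; apply: Lam_ge0.
    apply: big1 => [[[|[|d]] dn] _] //=; first exact: Lam0.
    by exfalso; move: dn n1; clear; lia.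
  by rewrite l0 mulr_ge0.
set m := (n %/ 2)%N; set l := (n - m)%N.
have mn : (2 * m <= n < 2 * m + 2)%N by rewrite /m; clear; lia.
have lE : (l + m = n)%N by rewrite /l; move: mn; clear; lia.
have bin : ln n`!%:R - ln m`!%:R - ln l`!%:R <= n%:R :> R.
  have -> : ln n`!%:R = ln 'C(n, m)%:R + (ln m`!%:R + ln l`!%:R) :> R.
    rewrite -(@bin_fact n m); last by move: lE; clear; lia.
    rewrite !natrM !lnM ?posrE ?mulr_gt0 ?ltr0n ?fact_gt0 ?bin_gt0 //; move: lE; clear; lia.
  have -> (a b c : R) : a + (b + c) - b - c = a by ring.
  have b0 : (0 < 'C(n, m))%N by rewrite bin_gt0; move: lE; clear; lia.
  apply: le_trans (ln_nat_le R b0 (bin_le_2exp n m)) _.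
  by rewrite natrX lnXn // -[leLHS]mulr_natr -[leRHS]mul1r ler_wpM2r // ln2_le1.
have widen k : (k <= n)%N -> ln k`!%:R = \sum_(d < n.+1) Lam R d * (k %/ d)%:R :> R.
  move=> kn; rewrite ln_fact (big_ord_widen _ (fun d => Lam R d * (k %/ d)%:R) (kn : k.+1 <= n.+1)%N).
  rewrite big_mkcond; apply: eq_bigr => d _; case: ifP => // /negbT; rewrite -leqNgt => kd.
  by rewrite divn_small ?mulr0.
have dle j : (m %/ j + l %/ j <= n %/ j)%N.
  case: j => [|j]; first by rewrite !divn0.
  by rewrite leq_divRL // mulnDl -lE addnC leq_add // leq_divM.
have ps : \sum_(d < n.+1) Lam R d <= \sum_(d < l.+1) Lam R d + (ln n`!%:R - ln m`!%:R - ln l`!%:R).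
  have ln1 : (l.+1 <= n.+1)%N by move: lE; clear; lia.
  rewrite (big_ord_widen _ (fun d => Lam R d) ln1) [X in _ <= X + _]big_mkcond /=.
  have ml : (m <= n)%N by move: lE; clear; lia.
  have ll : (l <= n)%N by move: lE; clear; lia.
  rewrite (widen n (leqnn n)) (widen m ml) (widen l ll).
  rewrite -!sumrB -big_split /=; apply: ler_sum => d _.
  rewrite -!mulrBr; have [d0|d0] := posnP d; first by rewrite d0 Lam0 !mul0r !addr0 ?if_same.
  have := dle d; move=> {}dle.
  case: ifP => dl.
    rewrite lerDl mulr_ge0 ?Lam_ge0 //.
    have : (m %/ d)%:R + (l %/ d)%:R <= (n %/ d)%:R :> R by rewrite -natrD ler_nat.
    by lra.
  have ld : (l < d)%N by rewrite ltnNge -ltnS dl.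
  have md : (m < d)%N by move: ld lE mn; clear; lia.
  rewrite (divn_small ld) (divn_small md) !subr0 add0r -[leLHS]mulr1 ler_wpM2l ?Lam_ge0 //.
  by rewrite ler1n divn_gt0 // -ltnS.
have IHl : \sum_(d < l.+1) Lam R d <= 3 * l%:R.
  by apply: IH; move: nN mn lE n1; clear; lia.
apply: le_trans ps _; apply: le_trans (lerD IHl bin) _.
rewrite -!natrM -natrD ler_nat; move: mn lE n1; clear; lia.
Qed.

Lemma ln_fact_lower n : n%:R * ln n%:R - n%:R <= ln n`!%:R :> R.
Proof.
case: n => [|n]; first by rewrite !mul0r subr0 fact0 ln1.
have n0 : 0 < n.+1%:R :> R by [].
have f0 : 0 < (n.+1)`!%:R :> R by rewrite ltr0n fact_gt0.
have := expR_ge1Dxn n (ltW n0); have le0 : 0 < n.+1%:R ^+ n.+1 / (n.+1)`!%:R :> R by rewrite divr_gt0 ?exprn_gt0.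
move=> le1; have {le1} : n.+1%:R ^+ n.+1 / (n.+1)`!%:R <= expR n.+1%:R :> R.
  by apply: le_trans le1; rewrite lerDr.
rewrite -ler_ln ?posrE ?expR_gt0 // expRK lnM ?posrE ?invr_gt0 ?exprn_gt0 // lnV ?posrE // lnXn //.
by rewrite -[ln _ *+ _]mulr_natl; lra.
Qed.

Lemma ln_fact_upper n : ln n`!%:R <= n%:R * ln n%:R :> R.
Proof.
rewrite mulr_natl; have [->|n0] := posnP n; first by rewrite fact0 ln1 mulr0n.
rewrite -lnXn ?ltr0n // -natrX; apply: ln_nat_le; rewrite ?fact_gt0 //.
elim: n {n0} => // n IH; rewrite factS expnS leq_mul //.
by apply: leq_trans IH _; case: n => // n; rewrite leq_exp2r.
Qed.

(** The sum of Lam d * floor (n / d) is ln n!, and replacing floor (n / d) by n / d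
  costs at most the sum of Lam, bounded by [chebyshev_upper]. *)
Lemma mertens n : (0 < n)%N ->
  ln n%:R - 1 <= \sum_(d < n.+1) Lam R d / d%:R <= ln n%:R + 3.
Proof.
move=> n0; have nR : 0 < n%:R :> R by rewrite ltr0n.
have l1 := ln_fact_lower n; have l2 := ln_fact_upper n; rewrite ln_fact in l1 l2.
apply/andP; split; rewrite -(ler_pM2l nR) mulr_sumr.
  rewrite mulrBr mulr1; apply: le_trans l1 _; apply: ler_sum => d _.
  rewrite mulrCA ler_wpM2l ?Lam_ge0 //; have [d0|d0] := posnP d; first by rewrite d0 divn0 invr0 mulr0.
  by rewrite ler_pdivlMr ?ltr0n // -natrM ler_nat leq_divM.
rewrite mulrDr [n%:R * 3]mulrC; apply: le_trans (lerD l2 (chebyshev_upper n)).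
rewrite -big_split /=; apply: ler_sum => d _; rewrite mulrCA -[X in _ + X]mulr1 -mulrDr ler_wpM2l ?Lam_ge0 //.
have [d0|d0] := posnP d; first by rewrite d0 invr0 mulr0 addr_ge0.
by rewrite ler_pdivrMr ?ltr0n // natr1 -natrM ler_nat ltnW // ltn_ceil.
Qed.

End Chebyshev.

(** * Primes in a fixed residue class modulo 9 *)

Section Mertens9.
Variable R : realType.
Notation C := R[i].

(** Weights of sum zero over a period, for which the series of f9 (a e) / e is
  positive at a = 1 and negative at the other units a modulo 9. They replace the
  nonvanishing at 1 of the Dirichlet L-functions modulo 9 by a finite computation
  ([ser_values]). *)
Definition f9 (n : nat) : int := nth 0 [:: 0; 6; -1; 0; -1; -4; 0; 0; 0] (n %% 9).

Definition ser (a Y : nat) : R := \sum_(e < Y) (f9 (a * e))%:~R / e%:R.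

Lemma f9_mod n : f9 n = f9 (n %% 9).
Proof. by rewrite /f9 modn_mod. Qed.

Lemma ser_mod a Y : ser a Y = ser (a %% 9) Y.
Proof. by apply: eq_bigr => e _; rewrite f9_mod [in RHS]f9_mod modnMml. Qed.

Lemma f9_block (a Y t : nat) : `|\sum_(e < t) f9 (a * (Y + e))| <= 6.
Proof.
pose h e := f9 (a %% 9 * (Y %% 9 + e)).
have hE e : f9 (a * (Y + e)) = h e by rewrite f9_mod -modnMm -modnDml modnMmr -f9_mod.
under eq_bigr => e _ do rewrite hE.
have per : periodic 9 h.
  by move=> e; rewrite /h addnA mulnDr f9_mod -modnDmr modnMl addn0 -f9_mod.
have iotaE (F : nat -> int) k : \sum_(e < k) F e = foldr +%R 0 (map F (iota 0 k)).
  by rewrite foldrE big_map -[in RHS](subn0 k) -/(index_iota 0 k) big_mkord.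
have chk : all (fun a => all (fun y => (foldr +%R 0 [seq f9 (a * (y + e)) | e <- iota 0 9] == 0) &&
   all (fun t => `|foldr +%R 0 [seq f9 (a * (y + e)) | e <- iota 0 t]| <= 6) (iota 0 9)) (iota 0 9)) (iota 0 9).
  by vm_compute.
have a9 : (a %% 9)%N \in iota 0 9 by rewrite mem_iota /= ltn_pmod.
have Y9 : (Y %% 9)%N \in iota 0 9 by rewrite mem_iota /= ltn_pmod.
have t9 : (t %% 9)%N \in iota 0 9 by rewrite mem_iota /= ltn_pmod.
have /allP/(_ _ a9)/allP/(_ _ Y9)/andP[/eqP z /allP/(_ _ t9)] := chk.
rewrite -(iotaE h) in z; rewrite -(iotaE h).
rewrite (big_ord_cat h (leq_divM t 9)) (sum_blocks (t %/ 9) per) z mul0rn add0r.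
have -> : (t - t %/ 9 * 9 = t %% 9)%N by rewrite {1}(divn_eq t 9) addKn.
move=> le; rewrite (eq_bigr (fun e : 'I__ => h e)) // => e _.
rewrite addnC; elim: (t %/ 9)%N => [|k IH]; first by rewrite addn0.
by rewrite mulSn addnCA addnC per IH.
Qed.

Lemma f9_abel a Y N (g : nat -> R) : (forall n, g (Y + n.+1)%N <= g (Y + n)%N) ->
  (forall n, 0 <= g (Y + n)%N) ->
  `|\sum_(e < N) (f9 (a * (Y + e)))%:~R * g (Y + e)%N| <= 6 * g Y.
Proof.
move=> gm g0; case: N => [|N]; first by rewrite big_ord0 normr0 mulr_ge0 // -[Y]addn0.
have lm n : - g (Y + n)%N <= - g (Y + n.+1)%N by rewrite lerN2.
have hB t : cn (\sum_(n < t) ((f9 (a * (Y + n)))%:~R : R)%:C) <= 6.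
  rewrite -rmorph_sum /= cn_real -rmorph_sum /= -intr_norm (_ : 6 = 6%:~R) // ler_int; exact: f9_block.
have := @abel R (fun n => - g (Y + n)%N) (fun n => ((f9 (a * (Y + n)))%:~R)%:C) N 6 lm hB.
set S := \sum_(n < N.+1) ((f9 _)%:~R)%:C; set A := \sum_(n < N.+1) _ => le.
have -> : `|\sum_(i < N.+1) (f9 (a * (Y + i)))%:~R * g (Y + i)%N| = cn A.
  rewrite -cn_real -[RHS]cnN /A -sumrN rmorph_sum; congr cn; apply: eq_bigr => i _.
  by rewrite rmorphM rmorphN mulNr opprK mulrC.
have -> : A = (A - (- g (Y + N)%N)%:C * S) + (- g (Y + N)%N)%:C * S by rewrite subrK.
apply: le_trans (cnD _ _) _; rewrite cnM cn_real normrN ger0_norm //.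
have := ler_wpM2l (g0 N) (hB N.+1).
by move: le; rewrite -/S addn0; lra.
Qed.

Lemma ser_tail a Y Z : (0 < Y <= Z)%N -> `|ser a Z - ser a Y| <= 6 / Y%:R.
Proof.
move=> /andP[Y0 YZ].
rewrite /ser (big_ord_cat (fun e => (f9 (a * e))%:~R / e%:R) YZ) addrC addKr.
apply: (@f9_abel a Y (Z - Y) (fun n => n%:R^-1)) => n; last by rewrite invr_ge0.
by rewrite lef_pV2 ?posrE ?ltr0n ?addn_gt0 ?Y0 // ler_nat leq_add2l.
Qed.

(** In this form the residues of the first 28 terms are computed before the real
  arithmetic starts. *)
Lemma serE a Y : ser a Y = \sum_(p <- [seq ((a * e) %% 9, e)%N | e <- iota 0 Y])
  nth 0 [:: 0; 6; -1; 0; -1; -4; 0; 0; 0] p.1 / p.2%:R.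
Proof.
rewrite big_map -[in RHS](subn0 Y) -/(index_iota 0 Y) big_mkord.
apply: eq_bigr => e _; congr (_ / _); rewrite /f9 /=.
have : ((a * e) %% 9 < 9)%N by rewrite ltn_pmod.
by case: (_ %% 9)%N => [|[|[|[|[|[|[|[|[|]]]]]]]]].
Qed.

Ltac eval_ser := rewrite serE; match goal with |- context [map ?f (iota 0 28)] =>
  let l := eval vm_compute in (map f (iota 0 28)) in change (map f (iota 0 28)) with l end;
  rewrite !big_cons big_nil /= ?mul0r ?add0r.

Lemma ser_values Z : (28 <= Z)%N ->
  [/\ ser 1 Z <= 7 & forall a, a \in [:: 2; 4; 5; 7; 8]%N -> ser a Z <= - (9 / 20)].
Proof.
move=> Z28; have t a : ser a Z <= ser a 28 + 6 / 28.
  by have /ler_normlW := @ser_tail a 28 Z Z28; lra.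
split; first by apply: le_trans (t 1%N) _; eval_ser; lra.
move=> a; rewrite !inE => /or4P[/eqP->|/eqP->|/eqP->|/orP[]/eqP->];
  by apply: le_trans (t _) _; eval_ser; lra.
Qed.

Lemma ser_3 a Z : (3 %| a)%N -> ser a Z = 0.
Proof.
move=> /dvdnP[b ->]; rewrite ser_mod /ser big1 // => e _.
rewrite f9_mod modnMml -[(9)%N]/(3 * 3)%N mulnAC -muln_modl.
by have : (b * e %% 3 < 3)%N by [rewrite ltn_pmod]; case: (_ %% 3)%N => [|[|[|]]] //=; rewrite mul0r.
Qed.

Lemma ln10_ge2 : 2 <= ln 10 :> R.
Proof.
rewrite -[leLHS]expRK ler_ln ?posrE ?expR_gt0 //.
have -> : 2 = 32%:R * (1 / 16) :> R by lra.
rewrite expRM_natl (_ : 32%N = (2 * (2 * (2 * (2 * 2))))%N) // !exprM.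
have sq (z c d : R) : 0 <= z -> z <= c -> c ^+ 2 <= d -> z ^+ 2 <= d.
  by move=> z0 zc; apply: le_trans; rewrite lerXn2r // ?nnegrE // (le_trans z0).
have z0 := expR_ge0 (1 / 16 : R).
have z1 : expR (1 / 16 : R) <= 107 / 100 + 1 / 1000.
  by apply: le_trans (exp_le_quadratic _) _; lra.
apply: (sq _ (304 / 100)); rewrite ?sqr_ge0 //; last by lra.
apply: (sq _ (174 / 100)); rewrite ?sqr_ge0 //; last by lra.
apply: (sq _ (1318 / 1000)); rewrite ?sqr_ge0 //; last by lra.
apply: (sq _ (1148 / 1000)); rewrite ?sqr_ge0 //; last by lra.
by apply: (sq _ _ _ z0 z1); lra.
Qed.

Lemma ln_over_decr n : (10 <= n)%N -> ln n.+1%:R / n.+1%:R <= ln n%:R / n%:R :> R.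
Proof.
move=> n10; have n0 : 0 < n%:R :> R by rewrite ltr0n; lia.
rewrite ler_pdivrMr // mulrAC ler_pdivlMr //.
have l2 : 2 <= ln n%:R :> R by apply: le_trans ln10_ge2 _; apply: ln_nat_le.
have E : ln n.+1%:R = ln n%:R + ln (1 + n%:R^-1) :> R.
  rewrite -lnM ?posrE // ?addr_gt0 ?invr_gt0 //; congr ln.
  by rewrite mulrDr mulr1 mulfV ?gt_eqF // natr1.
have l1 : ln (1 + n%:R^-1) <= n%:R^-1 :> R by apply: le_ln1Dx; rewrite (lt_trans (ltrN10 _)) // invr_gt0.
rewrite E -natr1; have := ler_wpM2r (ltW n0) l1; rewrite mulVf ?gt_eqF //; nra.
Qed.

Section Class.
Variable b : nat.

Let F n : R := (f9 (b * n))%:~R.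
Let A X : R := \sum_(n < X) ln n%:R * (F n / n%:R).

(** Writing ln as the divisor sum of Lam turns A X into a sum of Lam d / d times the
  partial sums of the series at b d, whose tails are bounded by [ser_tail]. *)
Lemma class_sum X Z : (0 < X <= Z)%N ->
  `|A X - \sum_(d < X) Lam R d / d%:R * ser (b * d) Z| <= 18.
Proof.
move=> /andP[X0 XZ]; pose Phi n : R := if (n < X)%N then F n / n%:R else 0.
have Phi0 : Phi 0%N = 0 by rewrite /Phi invr0 mulr0 if_same.
have PhiX n : (X <= n)%N -> Phi n = 0 by rewrite /Phi ltnNge => ->.
have -> : A X = \sum_(d < X) Lam R d / d%:R * ser (b * d) (X.-1 %/ d).+1.
  transitivity (\sum_(c < X) Lam R c * (\sum_(f < X) Phi (c * f)%N)).
    rewrite (@dirichlet _ X (Lam R) Phi) //; apply: eq_bigr => n _.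
    have [n0|n0] := posnP n; first by rewrite n0 invr0 Phi0 !mulr0.
    by rewrite sum_Lam ?n0 ?ltn_ord // /Phi ltn_ord.
  apply: eq_bigr => c _; have [c0|c0] := posnP c; first by rewrite c0 Lam0 !mul0r.
  rewrite -mulrA; congr (_ * _).
  have le : ((X.-1 %/ c).+1 <= X)%N by rewrite -[X in (_ <= X)%N](prednK X0) ltnS leq_div.
  rewrite /ser (big_ord_widen _ (fun e => (f9 (b * c * e))%:~R / e%:R) le) mulr_sumr [RHS]big_mkcond.
  have E f : (f < (X.-1 %/ c).+1)%N = (c * f < X)%N.
    by rewrite ltnS leq_divRL // mulnC -ltnS prednK.
  apply: eq_bigr => f _; rewrite /Phi E.
  by case: ifP => // _; rewrite /F mulnA natrM invfM; ring.
rewrite -sumrB; apply: le_trans (ler_norm_sum _ _ _) _.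
apply: (@le_trans _ _ (\sum_(d < X) Lam R d * (6 / X%:R))).
  apply: ler_sum => d _; have [d0|d0] := posnP d; first by rewrite d0 Lam0 !mul0r subrr normr0.
  rewrite -mulrBr normrM ger0_norm ?divr_ge0 ?Lam_ge0 // -mulrA ler_wpM2l ?Lam_ge0 // distrC.
  have YZ : (0 < (X.-1 %/ d).+1 <= Z)%N.
    by apply: leq_trans XZ; rewrite -[X in (_ <= X)%N](prednK X0) ltnS leq_div.
  have t := @ser_tail (b * d) _ _ YZ.
  have dR : 0 < d%:R :> R by rewrite ltr0n.
  apply: le_trans (ler_wpM2l (_ : 0 <= d%:R^-1) t) _; first by rewrite invr_ge0.
  rewrite mulrCA ler_wpM2l // -invfM lef_pV2 ?posrE ?mulr_gt0 ?ltr0n //.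
  rewrite -natrM ler_nat mulnC; have := ltn_ceil X.-1 d0; rewrite prednK //.
rewrite -mulr_suml; have := chebyshev_upper R X.-1; rewrite prednK // => ch.
have XR : 0 < X%:R :> R by rewrite ltr0n.
rewrite mulrA ler_pdivrMr //; have : X.-1%:R <= X%:R :> R by rewrite ler_nat leq_pred.
by move: ch; lra.
Qed.

(** The function ln n / n decreases and f9 has sum zero over a period. *)
Lemma class_diff k1 K : (10 <= k1)%N -> (k1 <= K)%N -> `|A (10 ^ K) - A (10 ^ k1)| <= 1.
Proof.
move=> k10 kK; have le : (10 ^ k1 <= 10 ^ K)%N by rewrite leq_exp2l.
rewrite /A (big_ord_cat (fun n => ln n%:R * (F n / n%:R)) le) addrC addKr.
have k1e : (10 ^ 1 <= 10 ^ k1)%N by rewrite leq_exp2l //; move: k10; clear; lia.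
rewrite (eq_bigr (fun i : 'I__ => (f9 (b * (10 ^ k1 + i)))%:~R * (ln (10 ^ k1 + i)%:R / (10 ^ k1 + i)%:R))); last first.
  by move=> i _; rewrite /F; ring.
apply: le_trans (@f9_abel b (10 ^ k1) _ (fun n => ln n%:R / n%:R) _ _) _.
- by move=> n; rewrite addnS ln_over_decr // (leq_trans k1e) // leq_addr.
- by move=> n; rewrite divr_ge0 // ln_nat_ge0.
rewrite mulrA ler_pdivrMr ?ltr0n ?expn_gt0 // mul1r.
apply: le_trans (ler_wpM2l (ler0n R 6) (ln_pow10 R (leqnn (10 ^ k1)))) _.
rewrite -natrM ler_nat; apply: (@leq_trans (18 * 2 ^ k1)).
  by rewrite mulnA leq_mul2l /= ltnW // ltn_expl.
apply: (@leq_trans (5 ^ k1 * 2 ^ k1)); last by rewrite -expnMn.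
rewrite leq_mul2r; apply/orP; right; apply: (@leq_trans (5 ^ 2)) => //.
by rewrite leq_exp2l //; move: k10; clear; lia.
Qed.

Let cls d := (d %% 9 == 1)%N.

(** Fifty decades carry a mass of at least 95 by [mertens], while the sum of
  Lam d / d * ser (b d) over them is bounded below by [class_sum]. As the series is
  at most - 9 / 20 on the other units and the multiples of 3 are negligible, the class
  b d = 1 must contribute. *)
Theorem class_mass K : (100 <= K)%N -> coprime b 9 ->
  1 / 2 <= \sum_(d < 10 ^ K) (if (10 ^ (K - 50) <= d)%N && cls (b * d) then Lam R d / d%:R else 0).
Proof.
move=> K100 cb; set k1 := (K - 50)%N; set X1 := (10 ^ k1)%N; set X2 := (10 ^ K)%N.
have k1K : (k1 <= K)%N by rewrite leq_subr.
have k10 : (50 <= k1)%N by rewrite /k1; move: K100; clear; lia.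
have X10 : (0 < X1)%N by rewrite expn_gt0.
have X20 : (0 < X2)%N by rewrite expn_gt0.
have X12 : (X1 <= X2)%N by rewrite leq_exp2l.
have Z28 : (28 <= X2)%N.
  by apply: (@leq_trans (10 ^ 2)) => //; rewrite leq_exp2l //; move: K100; clear; lia.
pose L d : R := Lam R d / d%:R.
have L0 d : 0 <= L d by rewrite divr_ge0 ?Lam_ge0.
pose S (P : pred nat) := \sum_(d < X2) (if (X1 <= d)%N && P d then L d else 0).
have split (h : nat -> R) : \sum_(d < X2) h d - \sum_(d < X1) h d = \sum_(d < X2) (if (X1 <= d)%N then h d else 0).
  rewrite (big_ord_cat h X12) addrC addKr (big_ord_cat (fun d => if (X1 <= d)%N then h d else 0) X12).
  rewrite [X in _ = X + _]big1 ?add0r => [|d _]; last by rewrite leqNgt ltn_ord.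
  by apply: eq_bigr => d _; rewrite leq_addr.
have weighted : - 37 <= \sum_(d < X2) (if (X1 <= d)%N then L d * ser (b * d) X2 else 0).
  rewrite -(split (fun d => L d * ser (b * d) X2)).
  have s1 := @class_sum X1 X2; rewrite X10 X12 in s1; move: (s1 isT) => {}s1.
  have s2 := @class_sum X2 X2; rewrite X20 leqnn in s2; move: (s2 isT) => {}s2.
  have k1' : (10 <= k1)%N by move: k10; clear; lia.
  have s3 := class_diff k1' k1K; rewrite -/X1 -/X2 in s3.
  move: s1 s2 s3; rewrite /L; move: (A X1) (A X2) (\sum_(d < X1) _) (\sum_(d < X2) _) => a1 a2 t1 t2.
  rewrite !ler_norml => /andP[u1 u2] /andP[u3 u4] /andP[u5 u6]; lra.
have [v1 v2] := ser_values Z28.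
have pointwise : \sum_(d < X2) (if (X1 <= d)%N then L d * ser (b * d) X2 else 0) <=
   7 * S (fun d => cls (b * d)) - 9 / 20 * (S xpredT - S (fun d => cls (b * d)) - S (fun d => 3 %| d)%N).
  have -> : 7 * S (fun d => cls (b * d)) - 9 / 20 * (S xpredT - S (fun d => cls (b * d)) - S (fun d => 3 %| d)%N) =
    \sum_(d < X2) (7 * (if (X1 <= d)%N && cls (b * d) then L d else 0) - 9 / 20 *
     ((if (X1 <= d)%N && true then L d else 0) - (if (X1 <= d)%N && cls (b * d) then L d else 0)
      - (if (X1 <= d)%N && (3 %| d)%N then L d else 0))).
    by rewrite sumrB -!mulr_sumr !sumrB.
  apply: ler_sum => d _; case: (X1 <= d)%N => /=; last by lra.
  have Ld := L0 d; case: (boolP (3 %| d)%N) => d3.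
    rewrite ser_3 ?dvdn_mull // mulr0.
    have -> : cls (b * d) = false; last by lra.
    apply/negbTE; rewrite /cls; apply: contraL (dvdn_mull b d3) => /eqP E.
    by rewrite (divn_eq (b * d) 9) E dvdn_addr ?dvdn_mull.
  have b3 : ~~ (3 %| b)%N.
    by move: cb; rewrite -[9%N]/(3 * 3)%N coprimeMr -prime_coprime // coprime_sym => /andP[].
  have bd3 : ~~ (3 %| b * d)%N by rewrite Euclid_dvdM // negb_or b3.
  rewrite ser_mod /cls; have : ((b * d) %% 9 < 9)%N by rewrite ltn_pmod.
  have : ~~ (3 %| (b * d) %% 9)%N.
    by rewrite /dvdn modn_dvdm.
  move: ((b * d) %% 9)%N => r r3 r9.
  have [->|r1] := eqVneq r 1%N; first by have := ler_wpM2l Ld v1; lra.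
  have : r \in [:: 2; 4; 5; 7; 8]%N by move: r r3 r9 r1; do 9![case=> //].
  move=> /v2 v; have := ler_wpM2l Ld v; lra.
have total : 95 <= S xpredT.
  have -> : S xpredT = \sum_(d < X2) L d - \sum_(d < X1) L d.
    by rewrite split; apply: eq_bigr => d _; rewrite andbT.
  have /andP[m2 _] := mertens R X20; have /andP[_ m1] := mertens R X10.
  have h1 : \sum_(d < X1) L d <= \sum_(d < X1.+1) L d by rewrite big_ord_recr lerDl.
  have h2 : L X2 <= 1.
    rewrite /L ler_pdivrMr ?ltr0n // mul1r.
    apply: le_trans (_ : (3 * K)%:R <= _); first exact: (@Lam_le R K X2).
    rewrite ler_nat; apply: (@leq_trans (5 ^ K * 2 ^ K)); last by rewrite -expnMn.
    apply: leq_mul; last by apply: ltnW; apply: ltn_expl.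
    apply: (@leq_trans (5 ^ 1)) => //; rewrite leq_exp2l //; move: K100; clear; lia.
  rewrite big_ord_recr /= in m2.
  have lnE : ln X2%:R = ln X1%:R + 50 * ln 10 :> R.
    have lnp k : ln (10 ^ k)%N%:R = k%:R * ln 10 :> R by rewrite natrX lnXn // mulr_natl.
    rewrite /X2 /X1 !lnp; have -> : K = (k1 + 50)%N by rewrite /k1; move: K100; clear; lia.
    by rewrite natrD mulrDl.
  have := ln10_ge2; move: m1 m2 h1 h2; rewrite lnE /L.
  move: (ln X1%:R) (ln 10) (\sum_(d < X1) _) (\sum_(d < X1.+1) _) (\sum_(d < X2) _) (_ / X2%:R) => r1 r2 r3 r4 r5 r6.
  lra.
have three : S (fun d => 3 %| d)%N <= 1.
  apply: (@le_trans _ _ (X1%:R^-1 * \sum_(d < X2) (if (3 %| d)%N then Lam R d else 0))).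
    rewrite mulr_sumr; apply: ler_sum => d _; case: ifP => [/andP[Xd ->]|_].
      rewrite /L mulrC ler_wpM2r ?Lam_ge0 // lef_pV2 ?posrE ?ltr0n // ?ler_nat //.
      exact: leq_trans Xd.
    by case: ifP => _; rewrite ?mulr0 // mulr_ge0 ?Lam_ge0 ?invr_ge0.
  have mass := @prime_power_mass R (fun p _ => p == 3) (fun d => if (3 %| d)%N then Lam R d else 0) X2 K 4 (leqnn _).
  apply: le_trans (ler_wpM2l _ (mass _ _)) _; first by rewrite invr_ge0.
  - move=> n nX; have ge0 : 0 <= \sum_(p < X2 | prime p)
        \sum_(j < X2 | (p ^ j.+1 == n)%N && ((p : nat) == 3)) ln p%:R :> R.
      by apply: sumr_ge0 => p _; apply: sumr_ge0 => j _; apply: ln_nat_ge0.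
    case: ifP => // n3; rewrite (Lam_widen R nX); apply: ler_sum => p pp.
    rewrite le_eqVlt (eq_bigl (fun j : 'I_X2 => (p ^ j.+1 == n)%N && ((p : nat) == 3))) ?eqxx // => j.
    case: eqP => //= En; move: n3; rewrite -En Euclid_dvdX // dvdn_prime2 // => /andP[/eqP <- _].
    by rewrite eqxx.
  - by move=> p j _ /eqP ->.
  rewrite mulrC ler_pdivrMr ?ltr0n // mul1r ler_nat.
  apply: (@leq_trans (2 ^ k1 * (2 ^ k1 * 2 ^ k1))); last first.
    by rewrite -!expnMn leq_exp2r //; move: k10; clear; lia.
  have kk : (k1 <= 2 ^ k1)%N by apply: ltnW; apply: ltn_expl.
  have c192 : (192 <= 2 ^ k1)%N.
    by apply: (@leq_trans (2 ^ 8)) => //; rewrite leq_exp2l //; move: k10; clear; lia.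
  apply: leq_trans (leq_mul c192 (leq_mul kk kk)).
  have K2 : (K <= 2 * k1)%N by rewrite /k1; move: K100; clear; lia.
  apply: (@leq_trans (48 * (K * K))); first by rewrite (_ : 4 * (4 * K) * (3 * K) = 48 * (K * K))%N //; ring.
  apply: leq_trans (_ : 48 * ((2 * k1) * (2 * k1)) <= _)%N; first by rewrite leq_mul2l /= leq_mul.
  by rewrite (_ : 48 * (2 * k1 * (2 * k1)) = 192 * (k1 * k1))%N //; ring.
have E : S (fun d => cls (b * d)) = \sum_(d < X2) (if (X1 <= d)%N && cls (b * d) then L d else 0) by [].
rewrite -E; move: weighted pointwise total three; clear.
move: (S xpredT) (S (fun d => cls (b * d))) (S (fun d => 3 %| d)%N) (\sum_(d < X2) _) => r1 r2 r3 r4.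
lra.
Qed.

End Class.

End Mertens9.

(** * Primes congruent to m modulo 9 and their exponential sums *)

Lemma ReZ (R : realType) (r : R) z : complex.Re (r%:C * z) = r * complex.Re z.
Proof. by case: z => a b /=; rewrite mul0r subr0. Qed.

Section Weights.
Variable R : realType.
Notation C := R[i].
Variables (k m : nat).
Hypothesis k0 : (0 < k)%N.

Definition wt (n : nat) : R :=
  if (10 ^ k.-1 <= n)%N && (n %% 9 == m %% 9)%N then Lam R n else 0.

Lemma wt_ge0 n : 0 <= wt n.
Proof. by rewrite /wt; case: ifP => // _; apply: Lam_ge0. Qed.

(** The congruence modulo 9 is detected by additive characters. *)
Lemma wt_bound (h : nat -> C) E :
  (forall j x, (j < 9)%N -> (x <= 10 ^ k)%N ->
     cn (\sum_(n < x) (Lam R n)%:C * (w R 9 (j%:Z * n%:Z) * h n)) <= E) ->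
  cn (\sum_(n < 10 ^ k) (wt n)%:C * h n) <= 2 * E.
Proof.
move=> hE.
have le : (10 ^ k.-1 <= 10 ^ k)%N by rewrite leq_exp2l // leq_pred.
pose S j x := \sum_(n < x) (Lam R n)%:C * (w R 9 (j%:Z * n%:Z) * h n).
have -> : \sum_(n < 10 ^ k) (wt n)%:C * h n =
  \sum_(j < 9) 9%:R^-1 * w R 9 (- (j%:Z * m%:Z)) * (S j (10 ^ k)%N - S j (10 ^ k.-1)%N).
  have SE j : S j (10 ^ k)%N - S j (10 ^ k.-1)%N = \sum_(n < 10 ^ k)
     (if (10 ^ k.-1 <= n)%N then (Lam R n)%:C * (w R 9 (j%:Z * n%:Z) * h n) else 0).
    pose G n := (Lam R n)%:C * (w R 9 (j%:Z * n%:Z) * h n).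
    rewrite /S (big_ord_cat G le) (big_ord_cat (fun n => if (10 ^ k.-1 <= n)%N then G n else 0) le).
    rewrite addrC addKr [X in _ = X + _]big1 ?add0r => [|n _]; last by rewrite leqNgt ltn_ord.
    by apply: eq_bigr => n _; rewrite leq_addr.
  under [in RHS]eq_bigr => j _ do rewrite SE mulr_sumr.
  rewrite exchange_big; apply: eq_bigr => n _ /=; rewrite /wt.
  case: leqP => kn /=; last by rewrite mul0r big1 // => j _; rewrite mulr0.
  transitivity ((Lam R n)%:C * h n * (9%:R^-1 * \sum_(j < 9) w R 9 ((n%:Z - m%:Z) * j%:Z))).
    rewrite sum_w // dvdz_subn.
    by case: ifP => _; rewrite ?mulr0 ?mul0r // mulVf ?mulr1 // pnatr_eq0.
  rewrite mulrCA mulr_sumr mulr_sumr; apply: eq_bigr => j _.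
  have -> : (n%:Z - m%:Z) * j%:Z = - (j%:Z * m%:Z) + j%:Z * n%:Z by ring.
  rewrite wD; ring.
apply: le_trans (cn_sum _ _ _) _.
have -> : 2 * E = 9%:R * (9^-1 * (2 * E)) by rewrite mulrA mulfV ?mul1r // pnatr_eq0.
apply: sum_le_const => j; rewrite !cnM cn_w mulr1 cnV cn_nat ler_wpM2l ?invr_ge0 //.
apply: le_trans (cnB _ _) _; rewrite mulr_natl mulr2n; apply: lerD; apply: hE => //; exact: ltn_ord.
Qed.

(** Twisting by a character modulo 9 leaves a frequency of denominator at least
  2^(32 s), because 10^W does not divide h. *)
Lemma wt_linear (s W h : nat) : (0 < s)%N -> (64 * s + W = k)%N -> (0 < W)%N ->
  ~~ (10 ^ W %| h)%N ->
  cn (\sum_(n < 10 ^ k) (wt n)%:C * w R (10 ^ (32 * s + W)) (h%:Z * n%:Z)) <=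
  200 * k%:R ^+ 2 * 10 ^+ k / 10 ^+ s.
Proof.
move=> s0 kE W0 ndv; set P := (10 ^ (32 * s + W))%N.
have P0 : (0 < P)%N by rewrite expn_gt0.
have -> : 200 * k%:R ^+ 2 * 10 ^+ k / 10 ^+ s = 2 * (100 * k%:R ^+ 2 * 10 ^+ k / 10 ^+ s) :> R.
  by ring.
apply: (@wt_bound (fun n => w R P (h%:Z * n%:Z))) => j x j9 xk.
pose u : int := 9%:Z * h%:Z + j%:Z * P%:Z; pose N := (9 * P)%N.
have N0 : (0 < N)%N by rewrite muln_gt0.
have -> : \sum_(n < x) (Lam R n)%:C * (w R 9 (j%:Z * n%:Z) * w R P (h%:Z * n%:Z)) =
  \sum_(n < x) (Lam R n)%:C * w R N (u * n%:Z).
  apply: eq_bigr => n _; congr (_ * _).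
  rewrite -(@w_scale R 9 P) // -(@w_scale R P 9) // [(P * 9)%N]mulnC -wD; congr (w _ _ _).
  rewrite /u; ring.
have uW : ~~ ((10 ^ W)%N%:Z %| u)%Z.
  have PW : ((10 ^ W)%N%:Z %| j%:Z * P%:Z)%Z by rewrite dvdz_mull // dvdzE /= /P expnD dvdn_mull.
  rewrite /u rpredDr // Gauss_dvdzr ?dvdzE //= coprimezE /= coprimeXl //.
pose q := (N %/ gcdn `|u| N)%N.
have qlo : (2 ^ (32 * s) <= q)%N.
  have := @pow10_quotient u W (32 * s + W) (leq_addl _ _) uW; rewrite addnK -/P => le.
  apply: leq_trans le _; rewrite /q /N.
  have g0 : (0 < gcdn `|u| P)%N by rewrite gcdn_gt0 P0 orbT.
  have g1 : (0 < gcdn `|u| (9 * P))%N by rewrite gcdn_gt0 muln_gt0 P0 orbT.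
  rewrite leq_divRL //; apply: (@leq_trans (P %/ gcdn `|u| P * (9 * gcdn `|u| P))).
    rewrite leq_mul2l; apply/orP; right; apply: dvdn_leq; first by rewrite muln_gt0.
    by rewrite muln_gcdr dvdn_gcd dvdn_gcdr dvdn_mull // dvdn_gcdl.
  by rewrite mulnCA divnK // dvdn_gcdr.
apply: (@linear_exp_sum R k s N q x u s0 _ N0 (erefl q) _ _ xk).
- by move: kE W0; clear; lia.
- apply: leq_trans qlo; have -> : (2 ^ (32 * s) = (2 ^ 4) ^ (8 * s))%N by rewrite -expnM; congr expn; ring.
  have e0 : (0 < 8 * s)%N by rewrite muln_gt0.
  by rewrite (ltn_exp2r _ _ e0).
- apply: leq_trans (leq_mul (leq_div _ _) (leqnn _)) _.
  rewrite /N /P; apply: (@leq_trans (10 ^ 1 * 10 ^ (32 * s + W) * 10 ^ (30 * s))).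
    by rewrite !leq_mul.
  by rewrite -!expnD leq_exp2l //; move: kE s0; clear; lia.
Qed.

Lemma save_shift (al : R) j : save (al + j%:R / 9) = save al.
Proof.
rewrite /save; congr (1 - _ ^+ 2 / _).
have -> : 9 * (al + j%:R / 9) = 9 * al + j%:R by field.
exact: (nuDint (9 * al) j%:Z).
Qed.

(** A character modulo 9 of n is a character of its digit sum: it shifts al by j / 9,
  which does not affect save. *)
Lemma wt_far (t : nat) (al : R) : (0 < t)%N -> (16 * t < k %/ 2000)%N -> (36 * k + 3 <= 10 ^ t)%N ->
  4 * save al ^+ (k %/ 2000 %/ 2) ^+ 2 * 10 ^+ (20 * t) <= 1 ->
  `|\sum_(n < 10 ^ k) wt n * cos (2 * pi * (al * ((ds k n)%:R - m%:R)))| <= 800 * k%:R ^+ 2 * 10 ^+ k / 10 ^+ t.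
Proof.
move=> t0 tk kt sv; rewrite -cn_real.
have -> : 800 * k%:R ^+ 2 * 10 ^+ k / 10 ^+ t = 2 * (400 * k%:R ^+ 2 * 10 ^+ k / 10 ^+ t) :> R.
  by ring.
have := @wt_bound (fun n => g al k n * e (- (al * m%:R))) (400 * k%:R ^+ 2 * 10 ^+ k / 10 ^+ t).
set S := cn (\sum_(n < _) _) => le.
apply: (@le_trans _ _ S); last first.
  apply: le => j x j9 xk.
  have -> : \sum_(n < x) (Lam R n)%:C * (w R 9 (j%:Z * n%:Z) * (g al k n * e (- (al * m%:R)))) =
    e (- (al * m%:R)) * \sum_(n < x) (Lam R n)%:C * g (al + j%:R / 9) k n.
    rewrite mulr_sumr; apply: eq_bigr => n _.
    have -> : g (al + j%:R / 9) k n = g al k n * w R 9 (j%:Z * n%:Z).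
      rewrite /g mulrDl eD; congr (_ * _).
      have nk : (n < 10 ^ k)%N by apply: leq_trans xk.
      have -> : w R 9 (j%:Z * n%:Z) = w R 9 (j%:Z * (ds k n)%:Z).
        have [z zE] : exists z : int, n%:Z = (ds k n)%:Z + z * 9%:Z.
          have : (9%:Z %| n%:Z - (ds k n)%:Z)%Z by rewrite dvdz_subn; apply/eqP; rewrite ds_mod9.
          by case/dvdzP => z E; exists z; rewrite -E addrC subrK.
        by rewrite zE mulrDr mulrA w_per.
      by rewrite /w rmorphM /= -!pmulrn; congr (e _); ring.
    ring.
  rewrite cnM cn_e mul1r; apply: far_sum => //; by rewrite save_shift.
have -> : (\sum_(n < 10 ^ k) wt n * cos (2 * pi * (al * ((ds k n)%:R - m%:R))))%:C =
  (complex.Re (\sum_(n < 10 ^ k) (wt n)%:C * (g al k n * e (- (al * m%:R)))))%:C.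
  congr (_%:C); rewrite raddf_sum; apply: eq_bigr => n _ /=.
  rewrite /g -eD -mulrN -mulrDr ReZ Re_e //.
rewrite cn_real ler_norml; apply/andP; split; last exact: Re_le_cn.
rewrite lerNl -raddfN; apply: le_trans (Re_le_cn _) _; by rewrite cnN.
Qed.

End Weights.

(** * Parameters, and the exponential sum near the origin *)

Lemma growth_aux b E : (0 < E)%N -> (E <= 5 ^ 9)%N -> (9 * E <= b)%N -> (b ^ E <= 10 ^ b)%N.
Proof.
move=> E0 E5 bE; set Y := (b %/ E)%N; have Y9 : (9 <= Y)%N by rewrite leq_divRL.
have bY : (b <= 10 ^ Y)%N.
  apply: ltnW; apply: leq_trans (ltn_ceil b E0) _; rewrite -/Y (_ : 10 = 2 * 5)%N // expnMn.
  apply: leq_mul; first exact: ltn_expl.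
  by apply: leq_trans E5 _; rewrite leq_exp2l.
apply: (@leq_trans (10 ^ (Y * E))); first by rewrite expnM leq_exp2r.
by rewrite leq_exp2l // leq_divM.
Qed.

Lemma growth b : (10 ^ 8 <= b)%N -> exists2 E, (300 * 1000 <= E)%N & (b ^ E <= 10 ^ b)%N.
Proof.
move=> hb; exists (300 * 1000)%N; first exact: leqnn.
have a1 : (0 < 300)%N by []. have a2 : (0 < 1000)%N by [].
have a3 : (300 <= 5 ^ 4)%N by []. have a4 : (1000 <= 5 ^ 5)%N by [].
have a5 : (27 <= 10 ^ 2)%N by []. have a6 : (1000 <= 10 ^ 3)%N by [].
have a7 : (100 <= 10 ^ 3)%N by [].
apply: growth_aux; first by rewrite muln_gt0 a1 a2.
  have -> : (5 ^ 9 = 5 ^ 4 * 5 ^ 5)%N by rewrite -expnD.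
  exact: (leq_mul a3 a4).
apply: leq_trans hb; have -> : (10 ^ 8 = 10 ^ 2 * (10 ^ 3 * 10 ^ 3))%N by rewrite -!expnD.
have -> : (9 * (300 * 1000) = 27 * (100 * 1000))%N by rewrite mulnA mulnA.
exact: (leq_mul a5 (leq_mul a7 a6)).
Qed.

Section NearValue.
Variable R : realType.
(* With b of the order of k^(1/12), the window is obtained by removing 32 b^3 digits at
   each end, and every error is compared with a power of b. *)
Variables (k m b : nat).
Hypothesis hb : (10 ^ 8 <= b)%N.
Hypothesis hk1 : (b ^ 12 <= k)%N.
Hypothesis hk2 : (k < b.+1 ^ 12)%N.
Hypothesis hm1 : (9 * k <= 2 * m)%N.
Hypothesis hm2 : (2 * m <= 9 * k + 450)%N.
Let be : R := b%:R.

Lemma be_large : 1000 * (1000 * 100) <= be.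
Proof.
rewrite /be; apply: (@le_trans _ _ (10 ^ 8)%:R); last by rewrite ler_nat.
by rewrite natrX !exprS expr0; lra.
Qed.

Lemma b_ge c : (c <= 10 ^ 4)%N -> (c <= b)%N.
Proof. by move=> c4; apply: leq_trans hb; apply: leq_trans c4 _; rewrite leq_exp2l. Qed.

Lemma b_gt0 : (0 < b)%N. Proof. by apply: b_ge; rewrite expn_gt0. Qed.

Lemma be_gt0 : 0 < be. Proof. by rewrite ltr0n b_gt0. Qed.

Lemma growth_pow e : (e <= 300 * 1000)%N -> (b ^ e <= 10 ^ b)%N.
Proof.
move=> le; have [E hE] := growth hb; apply: leq_trans.
by rewrite leq_pexp2l ?b_gt0 // (leq_trans le).
Qed.

Lemma k_le : (k <= b ^ 13)%N.
Proof.
apply: ltnW; apply: leq_trans hk2 _.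
apply: (@leq_trans ((2 * b) ^ 12)).
  by rewrite leq_exp2r // mul2n -addnn -addn1 leq_add2l b_gt0.
rewrite expnMn [(b ^ 13)%N]expnS leq_mul2r; apply/orP; right; apply: b_ge.
apply: (@leq_trans (2 ^ 12 * 2 ^ 1)); first by rewrite leq_pmulr.
have -> : (10 ^ 4 = (2 ^ 4 * 5 ^ 4))%N by rewrite -expnMn.
have -> : (2 ^ 12 * 2 ^ 1 = 2 ^ 4 * 2 ^ 9)%N by rewrite -!expnD.
by rewrite leq_mul2l; apply/orP; right.
Qed.

Lemma k_upper : k%:R <= 11 / 10 * be ^+ 12 :> R.
Proof.
apply: (@le_trans _ _ ((be + 1) ^+ 12)).
  by rewrite /be natr1 -natrX ler_nat ltnW.
have be0 := be_gt0; have bl := be_large.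
have x1 : be + 1 <= 1001 / 1000 * be by move: bl; move: be => z; lra.
apply: (@le_trans _ _ ((1001 / 1000 * be) ^+ 12)).
  have z1 : 0 <= be + 1 by rewrite addr_ge0 // ltW.
  by rewrite lerXn2r ?nnegrE // (le_trans z1).
rewrite exprMn; apply: ler_wpM2r; first by rewrite exprn_ge0 // ltW.
have sq (z c d : R) : 0 <= z -> z <= c -> c ^+ 2 <= d -> z ^+ 2 <= d.
  by move=> z0 zc; apply: le_trans; rewrite lerXn2r // ?nnegrE // (le_trans z0).
have p0 : 0 <= (1001 / 1000 : R) by rewrite divr_ge0.
have p3 : (1001 / 1000) ^+ 3 <= 101 / 100 :> R by rewrite !exprS expr0; lra.
have p30 : 0 <= (1001 / 1000 : R) ^+ 3 by rewrite exprn_ge0.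
have -> : (1001 / 1000 : R) ^+ 12 = (((1001 / 1000) ^+ 3) ^+ 2) ^+ 2 by rewrite -!exprM.
apply: (sq _ (103 / 100)); rewrite ?sqr_ge0 //; last by lra.
by apply: (sq _ _ _ p30 p3); lra.
Qed.

Let s := (b ^ 3)%N.
Let T := (32 * s)%N.
Let W := (k - 64 * s)%N.
Let M := \sum_(n < 10 ^ k) wt R k m n.
Hypothesis hM : 10 ^+ k / 1000 <= M.

Lemma s_small : (64 * s < k)%N.
Proof.
apply: leq_trans hk1; rewrite /s (_ : b ^ 12 = b ^ 9 * b ^ 3)%N; last by rewrite -expnD.
rewrite ltn_mul2r expn_gt0 b_gt0 /=; apply: (@leq_trans (b ^ 1)).
  by apply: b_ge; rewrite (_ : 10 ^ 4 = 10 ^ 2 * 10 ^ 2)%N ?leq_pmulr //; rewrite -expnD.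
by rewrite leq_pexp2l ?b_gt0.
Qed.

Lemma window_k : (T + W + T = k)%N.
Proof. by rewrite /W /T; have := s_small; clear; lia. Qed.

(** The degree 2 J of the Taylor polynomial is small enough for (1000 k^2)^(2 J) to
  stay below 10^s, since s = b^3, and large enough for [tail_error]. *)
Lemma linear_error (J : nat) : (J = 5 * 1000 * b ^ 2)%N ->
  J.+1%:R * wnorm R T W ^+ (2 * J) * (200 * k%:R ^+ 2 * 10 ^+ k / 10 ^+ s) <= M / be ^+ 2.
Proof.
move=> JE; have be0 := be_gt0; have b0 := b_gt0.
have q0 : (0 < b ^ 2)%N by rewrite expn_gt0 b0.
have c1000 : (1000 <= b)%N by apply: b_ge; rewrite (_ : 10 ^ 4 = 10 ^ 3 * 10)%N ?leq_pmulr // -expnSr.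
have key : (J.+1 * (1000 * (T + W) ^ 2) ^ (2 * J) * (200 * k ^ 2) * 1000 * b ^ 2 <= 10 ^ s)%N.
  have k13 := k_le.
  have Jb : (J.+1 <= b ^ 3)%N.
    rewrite JE; apply: (@leq_trans ((5 * 1000).+1 * b ^ 2)); first by rewrite mulSn -addn1 addnC leq_add2r.
    rewrite [(b ^ 3)%N]expnS leq_mul2r; apply/orP; right; apply: b_ge.
    apply: (@leq_trans (10 * 1000)); first by rewrite ltn_mul2r.
    by rewrite (_ : 10 ^ 4 = 10 * 10 ^ 3)%N ?leq_mul2l // -expnS.
  have b27 : (b ^ 27 = b * (b ^ 13) ^ 2)%N by rewrite -expnM -expnS.
  have Ab : (1000 * (T + W) ^ 2 <= b ^ 27)%N.
    by rewrite b27; apply: leq_mul => //; rewrite leq_exp2r // (leq_trans _ k13) // -window_k leq_addr.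
  have Kb : (200 * k ^ 2 <= b ^ 27)%N.
    rewrite b27; apply: leq_mul; last by rewrite leq_exp2r.
    by apply: leq_trans c1000; rewrite (_ : 1000 = 200 * 5)%N ?leq_pmulr.
  apply: (@leq_trans (b ^ 3 * (b ^ 27) ^ (2 * J) * b ^ 27 * b * b ^ 2)).
    apply: leq_mul => //; apply: leq_mul => //; apply: leq_mul => //; apply: leq_mul => //.
    by case: (2 * J)%N => // n; rewrite leq_exp2r.
  have -> : (b ^ 3 * (b ^ 27) ^ (2 * J) * b ^ 27 * b * b ^ 2 = b ^ (33 + 27 * (2 * J)))%N.
    by rewrite -expnM -!expnD -expnSr -expnD; congr (b ^ _)%N; ring.
  have [E hE gE] := growth hb.
  apply: (@leq_trans (b ^ (E * b ^ 2))); last first.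
    by rewrite expnM /s (_ : b ^ 3 = b * b ^ 2)%N ?expnM ?leq_exp2r // -expnS.
  rewrite leq_pexp2l // JE; move: (b ^ 2)%N q0 hE => q; clear; nia.
have keyR : J.+1%:R * wnorm R T W ^+ (2 * J) * (200 * k%:R ^+ 2) * 1000 * be ^+ 2 <= 10 ^+ s :> R.
  by rewrite /wnorm /be -!natrX -!natrM -!natrX -!natrM ler_nat.
have s10 : 0 < 10 ^+ s :> R by rewrite exprn_gt0.
rewrite ler_pdivlMr ?exprn_gt0 //; apply: le_trans hM.
rewrite ler_pdivlMr //.
have -> : J.+1%:R * wnorm R T W ^+ (2 * J) * (200 * k%:R ^+ 2 * 10 ^+ k / 10 ^+ s) * be ^+ 2 * 1000 =
   (J.+1%:R * wnorm R T W ^+ (2 * J) * (200 * k%:R ^+ 2) * 1000 * be ^+ 2) * (10 ^+ k / 10 ^+ s) :> R.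
  by ring.
apply: le_trans (ler_wpM2r _ keyR) _; first by rewrite divr_ge0 ?exprn_ge0.
by rewrite mulrC divfK ?gt_eqF.
Qed.

Lemma expR1_le4 : expR 1 <= 4 :> R.
Proof.
have le := @exp_le_quadratic R (1 / 2) (lexx _).
have -> : expR 1 = expR (1 / 2) ^+ 2 :> R by rewrite -expRM_natl; congr expR; lra.
have e0 := expR_ge0 (1 / 2 : R).
have h : expR (1 / 2 : R) <= 2 by apply: le_trans le _; rewrite expr2; lra.
have -> : 4 = 2 ^+ 2 :> R by rewrite expr2; lra.
by rewrite lerXn2r ?nnegrE.
Qed.

Lemma tail_error (J : nat) (v : R) : (J = 5 * 1000 * b ^ 2)%N -> 0 <= v -> v <= 8 / be ^+ 5 ->
  4 * (4 ^+ J)^-1 * expR (68 * v ^+ 2 * W%:R) <= 1 / be ^+ 2.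
Proof.
move=> JE v0 vb; have be0 := be_gt0; have q0 : (0 < b ^ 2)%N by rewrite expn_gt0 b_gt0.
have v2 : v ^+ 2 <= 64 / be ^+ 10.
  have -> : 64 / be ^+ 10 = (8 / be ^+ 5) ^+ 2 :> R by rewrite exprMn exprVn -exprM; congr (_ / _); ring.
  by rewrite lerXn2r ?nnegrE // (le_trans v0).
have Wk : W%:R <= 11 / 10 * be ^+ 12 :> R by apply: le_trans k_upper; rewrite ler_nat leq_subr.
have ex : 68 * v ^+ 2 * W%:R <= (4800 * b ^ 2)%N%:R.
  apply: (@le_trans _ _ (68 * (64 / be ^+ 10) * (11 / 10 * be ^+ 12))).
    by apply: ler_pM => //; rewrite ?mulr_ge0 ?sqr_ge0 // ler_wpM2l.
  have -> : be ^+ 12 = be ^+ 10 * be ^+ 2 by rewrite -exprD.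
  have -> : 68 * (64 / be ^+ 10) * (11 / 10 * (be ^+ 10 * be ^+ 2)) = 68 * 64 * 11 / 10 * be ^+ 2.
    by field; rewrite gt_eqF.
  by rewrite natrM natrX; apply: ler_wpM2r; [rewrite exprn_ge0 // ltW | lra].
have e4 : expR (68 * v ^+ 2 * W%:R) <= 4 ^+ (4800 * b ^ 2)%N.
  apply: le_trans (_ : expR (4800 * b ^ 2)%N%:R <= _); first by rewrite ler_expR.
  rewrite -[X in expR X]mulr1 expRM_natl; apply: lerXn2r; rewrite ?nnegrE ?expR_ge0 //; exact: expR1_le4.
have q4 : 4 * be ^+ 2 * 4 ^+ (4800 * b ^ 2)%N <= 4 ^+ J.
  have -> : 4 ^+ J = 4 ^+ (200 * b ^ 2)%N * 4 ^+ (4800 * b ^ 2)%N :> R.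
    by rewrite -exprD JE; congr (_ ^+ _); rewrite -mulnDl.
  rewrite ler_wpM2r ?exprn_ge0 // /be -!natrX -natrM ler_nat.
  apply: (@leq_trans (4 ^ (b ^ 2).+1)).
    by rewrite [leqRHS]expnS leq_mul // ltnW // ltn_expl.
  by rewrite leq_exp2l //; move: (b ^ 2)%N q0 => q; clear; lia.
have J0 : 0 < 4 ^+ J :> R by rewrite exprn_gt0.
apply: (@le_trans _ _ (4 * (4 ^+ J)^-1 * 4 ^+ (4800 * b ^ 2)%N)).
  by rewrite ler_wpM2l // mulr_ge0 // invr_ge0 ltW.
rewrite ler_pdivlMr ?exprn_gt0 //.
have -> : 4 * (4 ^+ J)^-1 * 4 ^+ (4800 * b ^ 2)%N * be ^+ 2 = 4 * be ^+ 2 * 4 ^+ (4800 * b ^ 2)%N / 4 ^+ J.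
  by ring.
by rewrite ler_pdivrMr // mul1r.
Qed.

Lemma cos_lip (x y : R) : `|cos (2 * pi * x) - cos (2 * pi * y)| <= 8 * `|x - y|.
Proof.
apply: le_trans (nu_upper (x - y)).
have -> : nu (x - y) = cn (e x - e y).
  have -> : e x - e y = - e y * (1 - e (x - y)) by rewrite eD eN mulrBr mulr1 mulNr mulrCA eJ mulr1 opprK addrC.
  by rewrite cnM cnN cn_e mul1r.
rewrite -!Re_e -raddfB ler_norml; apply/andP; split; last exact: Re_le_cn.
rewrite lerNl -raddfN; apply: le_trans (Re_le_cn _) _; by rewrite cnN.
Qed.

(** The digits outside the window change the phase by at most a multiple of b^-5 b^3;
  the rest is [near_cos]. *)
Lemma near_value (al : R) : 0 <= al -> al <= 1 / be ^+ 5 ->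
  `|\sum_(n < 10 ^ k) wt R k m n * cos (2 * pi * (al * ((ds k n)%:R - m%:R))) -
    M * wmean W (fun t => cos (2 * pi * al * wsum R W t))| <= M * (2500 / be ^+ 2).
Proof.
set D := wmean _ _ => al0 alb; have be0 := be_gt0; have bl := be_large; have M0 : 0 <= M.
  by apply: sumr_ge0 => n _; apply: wt_ge0.
have sR : s%:R = be ^+ 3 :> R by rewrite natrX.
pose U n := wsum R W (n %/ 10 ^ T)%N.
have s1 : `|\sum_(n < 10 ^ k) wt R k m n * cos (2 * pi * (al * ((ds k n)%:R - m%:R))) -
   \sum_(n < 10 ^ k) wt R k m n * cos (2 * pi * al * U n)| <= M * (2400 / be ^+ 2).
  rewrite -sumrB; apply: le_trans (ler_norm_sum _ _ _) _; rewrite mulr_suml; apply: ler_sum => n _.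
  rewrite -mulrBr normrM ger0_norm ?wt_ge0 // ler_wpM2l ?wt_ge0 //.
  rewrite -[2 * pi * al * _]mulrA.
  apply: le_trans (cos_lip _ _) _; rewrite -mulrBr normrM ger0_norm //.
  have dev : `|(ds k n)%:R - m%:R - U n| <= 300 * be ^+ 3.
    case: n => n /= _; have kE := window_k.
    have -> : ds k n = (ds T n + ds W (n %/ 10 ^ T) + ds T (n %/ 10 ^ T %/ 10 ^ W))%N.
      by rewrite -kE (ds_add (T + W)) (ds_add T W) (expnD 10 T W) divnMA.
    have d1 := ds_le T n; have d2 := ds_le T (n %/ 10 ^ T %/ 10 ^ W).
    rewrite /U /wsum !natrD; move: d1 d2.
    rewrite -(ler_nat R) -[(ds T (n %/ 10 ^ T %/ 10 ^ W) <= _)%N](ler_nat R) (natrM R 9 T) => d1 d2.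
    have g1 : 0 <= (ds T n)%:R :> R by [].
    have g2 : 0 <= (ds T (n %/ 10 ^ T %/ 10 ^ W))%:R :> R by [].
    have hm1R : 9 * k%:R <= 2 * m%:R :> R by rewrite -!natrM ler_nat.
    have hm2R : 2 * m%:R <= 9 * k%:R + 450 :> R by rewrite -!natrM -natrD ler_nat.
    have kER : T%:R + W%:R + T%:R = k%:R :> R by rewrite -!natrD kE.
    have TR : T%:R = 32 * be ^+ 3 :> R by rewrite natrM sR.
    have b3 : 100 <= be ^+ 3.
      apply: (@le_trans _ _ (be ^+ 1)); first by rewrite expr1; move: bl; lra.
      by rewrite ler_weXn2l //; move: bl; lra.
    move: d1 d2 g1 g2 hm1R hm2R kER TR b3.
    move: ((ds T n)%:R : R) ((ds T _)%:R : R) ((ds W _)%:R : R) (T%:R : R) (W%:R : R) (k%:R : R) (m%:R : R) (be ^+ 3).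
    move=> x1 x2 x3 x4 x5 x6 x7 x8.
    by move=> *; rewrite ler_norml; apply/andP; split; lra.
  apply: (@le_trans _ _ (8 * (1 / be ^+ 5 * (300 * be ^+ 3)))).
    by rewrite ler_wpM2l //; apply: ler_pM.
  have -> : be ^+ 5 = be ^+ 3 * be ^+ 2 by rewrite -exprD.
  rewrite le_eqVlt; apply/orP; left; apply/eqP; field; by rewrite gt_eqF.
pose J := (5 * 1000 * b ^ 2)%N.
have v0 : 0 <= 2 * pi * al by rewrite !mulr_ge0 ?pi_ge0.
have pi4 : pi < 4 :> R by have := @pihalf_lt2 R; lra.
have vb : 2 * pi * al <= 8 / be ^+ 5.
  have -> : 8 / be ^+ 5 = 8 * (1 / be ^+ 5) by rewrite mul1r.
  by apply: ler_pM; rewrite ?mulr_ge0 ?pi_ge0 //; move: pi4; lra.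
have b5 : 8 / be ^+ 5 <= 1 / 20.
  rewrite ler_pdivrMr ?exprn_gt0 //.
  have : be ^+ 1 <= be ^+ 5 by rewrite ler_weXn2l //; move: bl; lra.
  by rewrite expr1; move: bl; lra.
have v20 : `|2 * pi * al| <= 1 / 20 by rewrite ger0_norm // (le_trans vb).
have B0 : 0 <= 200 * k%:R ^+ 2 * 10 ^+ k / 10 ^+ s :> R by nneg.
have W0 : (0 < W)%N by rewrite subn_gt0 s_small.
have k0 : (0 < k)%N by apply: leq_trans hk1; rewrite expn_gt0 b_gt0.
have fr (h : nat) : (h < 10 ^ (T + W))%N -> ~~ (10 ^ W %| h)%N ->
  cn (\sum_(n < 10 ^ k) (wt R k m n)%:C * w R (10 ^ (T + W)) (h%:Z * n%:Z)) <= 200 * k%:R ^+ 2 * 10 ^+ k / 10 ^+ s.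
  move=> _ ndv; apply: wt_linear => //; first by rewrite expn_gt0 b_gt0.
  by rewrite subnKC // ltnW // s_small.
have := @near_cos R T W (10 ^ k) (wt R k m) _ (wt_ge0 R k m) B0 W0 fr J (2 * pi * al) v20.
rewrite -/M -/D => s2.
have le1 := linear_error (erefl J); have le2 := ler_wpM2l M0 (tail_error (erefl J) v0 vb).
set X := \sum_(n < _) _ * cos _ in s1 *; set X' := \sum_(n < _) _ * cos _ in s1.
have -> : X - M * D = (X - X') + (X' - M * D) by rewrite subrKA.
apply: le_trans (ler_normD _ _) _.
have {le1 le2} s3 := le_trans s2 (lerD le1 le2).
apply: le_trans (lerD s1 s3) _.
have Mb : 0 <= M / be ^+ 2 by rewrite divr_ge0 // exprn_ge0 // ltW.
have -> : M * (2400 / be ^+ 2) = 2400 * (M / be ^+ 2) by ring.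
have -> : M * (2500 / be ^+ 2) = 2500 * (M / be ^+ 2) by ring.
have -> : M * (1 / be ^+ 2) = M / be ^+ 2 by rewrite mul1r.
by move: Mb; move: (M / be ^+ 2) => r; lra.
Qed.

End NearValue.

(** * The exponential sum on the three ranges of frequencies *)

Section Peak.
Variable R : realType.
Variables (k m b : nat).
Hypothesis hb : (10 ^ 8 <= b)%N.
Hypothesis hk1 : (b ^ 12 <= k)%N.
Hypothesis hk2 : (k < b.+1 ^ 12)%N.
Hypothesis hm1 : (9 * k <= 2 * m)%N.
Hypothesis hm2 : (2 * m <= 9 * k + 450)%N.
Let be : R := b%:R.
Let M := \sum_(n < 10 ^ k) wt R k m n.
Hypothesis hM : 10 ^+ k / 1000 <= M.

Let be0 : 0 < be := be_gt0 R hb.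
Let bl : 1000 * (1000 * 100) <= be := be_large R hb.

Let M0 : 0 <= M.
Proof. by apply: sumr_ge0 => n _; apply: wt_ge0. Qed.

(** The Fourier transform of the distribution of s(n) - m under the weights wt. *)
Definition peak (al : R) : R := \sum_(n < 10 ^ k) wt R k m n * cos (2 * pi * (al * ((ds k n)%:R - m%:R))).

Let be1 : 1 <= be. Proof. by move: bl; lra. Qed.

Lemma be_sqr : 1000 * 1000 * be <= be ^+ 2.
Proof. by rewrite expr2 ler_pM2r //; move: bl; lra. Qed.

Let Wk : (k - 64 * b ^ 3)%N%:R <= 11 / 10 * be ^+ 12 :> R.
Proof. by apply: le_trans (k_upper R hb hk2); rewrite ler_nat leq_subr. Qed.

Lemma peak_bound (al : R) : 0 <= al -> al <= 1 / be ^+ 5 ->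
  - (M * (2500 / be ^+ 2)) <= peak al /\
  M * (1 - 11 * (8 * al) ^+ 2 * (11 / 10 * be ^+ 12)) - M * (2500 / be ^+ 2) <= peak al.
Proof.
move=> al0 al5; have := near_value hb hk1 hk2 hm1 hm2 hM al0 al5; rewrite -/(peak al) -/M -/be.
have pi8 : 2 * pi * al <= 8 * al.
  by rewrite ler_wpM2r //; have := @pihalf_lt2 R; lra.
have v0 : 0 <= 2 * pi * al by rewrite !mulr_ge0 ?pi_ge0.
have v10 : `|2 * pi * al| <= 1 / 10.
  rewrite ger0_norm //; apply: le_trans pi8 _; apply: le_trans (ler_wpM2l _ al5) _ => //.
  rewrite mulrA mulr1 ler_pdivrMr ?exprn_gt0 //.
  have : be ^+ 1 <= be ^+ 5 by rewrite ler_weXn2l.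
  by rewrite expr1; move: bl; lra.
have [D0 D1] := wmean_cos (k - 64 * b ^ 3) v10.
set D := wmean _ _ in D0 D1 *.
have D2 : 1 - 11 * (8 * al) ^+ 2 * (11 / 10 * be ^+ 12) <= D.
  apply: le_trans D1; rewrite lerD2l lerN2; apply: ler_pM => //.
    by rewrite mulr_ge0 ?sqr_ge0.
  by rewrite ler_wpM2l // lerXn2r ?nnegrE // (le_trans v0).
move: (mulr_ge0 M0 D0) (ler_wpM2l M0 D2); move: (M * D) (M * _) (M * _) (peak al) => x y z u x0 xy.
by rewrite ler_norml => /andP[+ _]; split; lra.
Qed.

(** Here al is well within the inverse of the standard deviation of the digit sum,
  which is of order sqrt k, that is b^6. *)
Lemma peak_core (al : R) : 0 <= al -> al <= 1 / (40 * be ^+ 6) -> M / 4 <= peak al.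
Proof.
move=> al0 alb; have al5 : al <= 1 / be ^+ 5.
  apply: le_trans alb _; rewrite !div1r lef_pV2 ?posrE ?mulr_gt0 ?exprn_gt0 //.
  apply: (@le_trans _ _ (be ^+ 6)); first by rewrite ler_weXn2l.
  have : 0 <= be ^+ 6 by rewrite exprn_ge0 // ltW.
  by move: (be ^+ 6) => z; lra.
have [_ le] := peak_bound al0 al5; apply: le_trans le; rewrite -mulrBr; apply: (ler_wpM2l M0).
have sq : (8 * al) ^+ 2 * be ^+ 12 <= 1 / 25.
  have le8 : (8 * al) ^+ 2 <= (8 * (1 / (40 * be ^+ 6))) ^+ 2.
    by rewrite lerXn2r ?nnegrE ?mulr_ge0 ?invr_ge0 ?mulr_ge0 ?exprn_ge0 ?ler_wpM2l // ltW.
  apply: le_trans (ler_wpM2r _ le8) _; first by rewrite exprn_ge0 // ltW.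
  have -> : be ^+ 12 = (be ^+ 6) ^+ 2 by rewrite -exprM.
  rewrite le_eqVlt; apply/orP; left; apply/eqP; field.
  by rewrite gt_eqF // exprn_gt0.
have be2 : 2500 / be ^+ 2 <= 1 / 400.
  by rewrite ler_pdivrMr ?exprn_gt0 //; have := be_sqr; move: bl; lra.
have -> : 11 * (8 * al) ^+ 2 * (11 / 10 * be ^+ 12) = 121 / 10 * ((8 * al) ^+ 2 * be ^+ 12) by ring.
by move: sq be2; move: (_ * be ^+ 12) (_ / be ^+ 2) => x y; lra.
Qed.

(** One factor save is at most 1 - 1 / (15 b^10), so 15 b^10 of them halve the
  product, and the exponent, of order k, hence of b^12, exceeds 15 b^10 * 82 b. *)
Lemma save_power (al : R) : 1 / be ^+ 5 < al -> al <= 1 / 18 ->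
  4 * save al ^+ (k %/ 2000 %/ 2) ^+ 2 * 10 ^+ (20 * b) <= 1.
Proof.
move=> al5 al18; have b0 := b_gt0 hb.
have al0 : 0 < al by apply: lt_trans al5; rewrite divr_gt0 ?exprn_gt0.
have nu1 : 18 * (1 / be ^+ 5) <= nu (9 * al).
  have : 2 * `|9 * al| <= nu (9 * al).
    by apply: nu_lower; rewrite ger0_norm ?mulr_ge0 // ?(ltW al0) //; move: al18; lra.
  rewrite ger0_norm; last by rewrite mulr_ge0 // ltW.
  by move: al5; move: (1 / _) (nu _) => x y; lra.
pose N := (15 * b ^ 10)%N.
have N0 : (0 < N)%N by rewrite muln_gt0 expn_gt0 b0.
have NR : N%:R = 15 * be ^+ 10 :> R by rewrite natrM natrX.
have sv : save al <= expR (- (N%:R)^-1).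
  apply: le_trans (expR_ge1Dx _); rewrite /save lerD2l lerN2 NR.
  have : (18 * (1 / be ^+ 5)) ^+ 2 <= nu (9 * al) ^+ 2.
    by rewrite lerXn2r ?nnegrE ?nu_ge0 // mulr_ge0 // divr_ge0 // exprn_ge0 // ltW.
  have -> : (18 * (1 / be ^+ 5)) ^+ 2 = 324 * (be ^+ 10)^-1.
    rewrite exprMn div1r exprVn -exprM; congr (_ * _); rewrite expr2; lra.
  rewrite [(15 * _)^-1]invfM; have : 0 <= (be ^+ 10)^-1 by rewrite invr_ge0 exprn_ge0 // ltW.
  by move: (_ ^-1) (nu _ ^+ 2) => x y; lra.
have halfN : save al ^+ N <= 1 / 2.
  apply: (@le_trans _ _ (expR (- 1))).
    have -> : -1 = - (N%:R)^-1 * N%:R :> R by rewrite mulNr mulVf // pnatr_eq0 -lt0n.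
    by rewrite expRM_natr lerXn2r // ?nnegrE ?expR_ge0 ?save_ge0.
  rewrite expRN div1r lef_pV2 ?posrE ?expR_gt0 //.
  by apply: le_trans (expR_ge1Dx _); lra.
pose h := (k %/ 2000 %/ 2)%N.
have kh : (N * (82 * b) <= h * 2)%N.
  have k1 : (1250 * b ^ 11 <= h)%N.
    have E4 : (10 ^ 4 = 10 ^ 2 * 10 ^ 2)%N by rewrite -expnD.
    have c1 : (1250 <= 10 ^ 4)%N by rewrite E4; apply: (@leq_mul 25 50).
    have c2 : (4000 <= 10 ^ 4)%N by rewrite E4; apply: (@leq_mul 40 100).
    rewrite /h -divnMA leq_divRL //; apply: leq_trans hk1.
    rewrite mulnAC [(b ^ 12)%N]expnS leq_mul2r; apply/orP; right.
    apply: leq_trans hb; rewrite (_ : 10 ^ 8 = 10 ^ 4 * 10 ^ 4)%N; last by rewrite -expnD.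
    exact: leq_mul.
  apply: (@leq_trans (1250 * b ^ 11 * 2)); last by rewrite leq_mul2r k1.
  rewrite /N.
  have -> : (15 * b ^ 10 * (82 * b) = (15 * 82) * (b ^ 10 * b))%N by ring.
  by rewrite -expnSr [leqRHS]mulnAC leq_mul2r; apply/orP; right.
have svh : save al ^+ h ^+ 2 <= (1 / 2) ^+ (82 * b).
  rewrite -exprM; apply: (@le_trans _ _ (save al ^+ (N * (82 * b)))).
    by apply: ler_wiXn2l => //; [exact: save_ge0 | exact: save_le1].
  by rewrite exprM; apply: lerXn2r; rewrite ?nnegrE ?exprn_ge0 ?save_ge0 ?divr_ge0 //; exact: halfN.
apply: (@le_trans _ _ (4 * (1 / 2) ^+ (82 * b) * 10 ^+ (20 * b))).
  by rewrite ler_wpM2r ?exprn_ge0 // ler_wpM2l.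
rewrite expr_div_n expr1n mulrAC mulrA mulr1 ler_pdivrMr ?exprn_gt0 // mul1r.
rewrite -!natrX -natrM ler_nat.
apply: (@leq_trans (2 ^ (2 * b) * (2 ^ 4) ^ (20 * b))).
  by apply: leq_mul; rewrite ?leq_exp2r ?muln_gt0 // expnM -[leqLHS](expn1 4) leq_exp2l.
by rewrite -expnM -expnD leq_exp2l //; clear; lia.
Qed.

Lemma peak_far (al : R) : 1 / be ^+ 5 < al -> al <= 1 / 18 -> - (M / be ^+ 20) <= peak al.
Proof.
move=> al5 al18; have b0 := b_gt0 hb; have k13 := k_le hb hk2.
have c100 : (100 <= b)%N by apply: (b_ge hb); rewrite (_ : 10 ^ 4 = 10 ^ 2 * 10 ^ 2)%N ?leq_pmulr // -expnD.
have c40 : (40 <= b)%N by apply: leq_trans c100.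
have k0 : (0 < k)%N by apply: leq_trans hk1; rewrite expn_gt0 b0.
have kb : (36 * k + 3 <= 10 ^ b)%N.
  apply: (@leq_trans (b ^ 14)); last by apply: (growth_pow hb); clear; lia.
  rewrite [(b ^ 14)%N]expnS; apply: (@leq_trans (40 * k)); first by move: k0; clear; lia.
  exact: leq_mul.
have bk : (16 * b < k %/ 2000)%N.
  rewrite leq_divRL //; apply: leq_trans hk1.
  apply: (@leq_trans (b * (b * (b * b)))); last first.
    by rewrite (_ : b * (b * (b * b)) = b ^ 4)%N ?leq_pexp2l //; ring.
  rewrite mulnC; have c20 : (20 <= b)%N by apply: leq_trans c40.
  apply: (@leq_trans (20 * (100 * (17 * b)))).
    by rewrite mulnA leq_mul2l; apply/orP; right; move: b0; clear; lia.
  by apply: leq_mul => //; apply: leq_mul => //; rewrite leq_mul2r (leq_trans _ c40) ?orbT.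
have := wt_far m b0 bk kb (save_power al5 al18); rewrite -/(peak al) ler_norml => /andP[+ _].
apply: le_trans; rewrite lerN2.
rewrite ler_pdivlMr ?exprn_gt0 //; apply: le_trans hM; rewrite ler_pdivlMr //.
have key : (800 * k ^ 2 * b ^ 20 * 1000 <= 10 ^ b)%N.
  apply: (@leq_trans (b ^ 60)); last by apply: (growth_pow hb); clear; lia.
  apply: (@leq_trans ((b * b) * (b ^ 13) ^ 2 * b ^ 20 * (b * b))).
    apply: leq_mul; last by rewrite (_ : 1000 = 25 * 40)%N // leq_mul // (leq_trans _ c40).
    apply: leq_mul => //; apply: leq_mul; last by rewrite leq_exp2r.
    by rewrite (_ : 800 = 20 * 40)%N // leq_mul // (leq_trans _ c40).
  by rewrite !mulnn -!expnM -!expnD leq_pexp2l.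
have keyR : 800 * k%:R ^+ 2 * be ^+ 20 * 1000 <= 10 ^+ b :> R.
  by rewrite /be -!natrX -!natrM ler_nat.
have -> : 800 * k%:R ^+ 2 * 10 ^+ k / 10 ^+ b * be ^+ 20 * 1000 =
  (800 * k%:R ^+ 2 * be ^+ 20 * 1000) * (10 ^+ k / 10 ^+ b) :> R by ring.
apply: le_trans (ler_wpM2r _ keyR) _; first by rewrite divr_ge0 ?exprn_ge0.
by rewrite mulrC divfK ?gt_eqF ?exprn_gt0.
Qed.

End Peak.

(** * Fourier inversion *)

Section Orthogonality.
Variable R : realType.

Lemma sum_below Q a (x : R) : (a <= Q)%N -> \sum_(t < Q) (if (t < a)%N then x else 0) = a%:R * x.
Proof.
move=> aQ; rewrite (@big_ord_cat R (fun t => if (t < a)%N then x else 0) _ _ aQ).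
rewrite [X in _ + X]big1 ?addr0 => [|t _]; last by rewrite ltnNge leq_addr.
by rewrite (eq_bigr (fun=> x)) ?sumr_const ?card_ord ?mulr_natl // => t _; rewrite ltn_ord.
Qed.

Lemma sum_above Q c (x : R) : (c <= Q)%N -> \sum_(t < Q) (if (Q - c <= t)%N then x else 0) = c%:R * x.
Proof.
move=> cQ; rewrite (@big_ord_cat R (fun t => if (Q - c <= t)%N then x else 0) _ _ (leq_subr c Q)).
rewrite big1 ?add0r => [|t _]; last by rewrite leqNgt ltn_ord.
rewrite (eq_bigr (fun=> x)) => [|t _]; last by rewrite leq_addr.
by rewrite sumr_const card_ord subKn // mulr_natl.
Qed.

Lemma quotient9 d m : d = m %[mod 9] -> exists z : int, d%:R - m%:R = 9 * z%:~R :> R.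
Proof.
move=> dm; exists ((d %/ 9)%N%:Z - (m %/ 9)%N%:Z).
rewrite {1}(divn_eq d 9) {1}(divn_eq m 9) dm rmorphB /= !natrD !natrM.
by rewrite opprD addrACA subrr addr0 -mulrBl mulrC.
Qed.

Let phase (Q t : nat) (y : R) := t%:R / (9 * Q)%:R * y.

Lemma phase_w (Q t : nat) (z : int) : (0 < Q)%N ->
  cos (2 * pi * phase Q t (9 * z%:~R)) = complex.Re (w R Q (z * t%:Z)).
Proof.
move=> Q0; rewrite /w Re_e /phase; congr cos; congr (_ * _).
rewrite rmorphM /= natrM; field; by rewrite pnatr_eq0 -lt0n.
Qed.

(** As d - m is a multiple of 9, the frequencies t / (9 Q) already form a complete
  system of characters. *)
Lemma cos_orthogonal (Q d m : nat) : (0 < Q)%N -> d = m %[mod 9] ->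
  (d < m + 9 * Q)%N -> (m < d + 9 * Q)%N ->
  \sum_(t < Q) cos (2 * pi * (t%:R / (9 * Q)%:R * (d%:R - m%:R))) = if d == m then Q%:R else 0 :> R.
Proof.
move=> Q0 dm h1 h2; have [z zE] := quotient9 dm.
rewrite zE (eq_bigr (fun t : 'I_Q => complex.Re (w R Q (z * t%:Z)))) => [|t _]; last exact: phase_w.
rewrite -raddf_sum sum_w //.
have zb : `|z| < Q%:Z.
  rewrite -(ltr_int R) intr_norm -(ltr_pM2l (ltr0n _ 9)) -[X in X * _ < _]normr_nat -normrM -zE.
  move: h1 h2; rewrite -!(ltr_nat R) (natrD _ m) (natrD _ d) !(natrM _ 9) ltr_norml => h1 h2; apply/andP; split.
    by move: h2; rewrite -[Q%:~R]/(Q%:R); lra.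
  by move: h1; rewrite -[Q%:~R]/(Q%:R); lra.
have [E|ne] := eqVneq d m.
  have -> : z = 0.
    by apply/eqP; rewrite -(intr_eq0 R); move: zE; rewrite E subrr => /esym/eqP; rewrite mulf_eq0 pnatr_eq0.
  by rewrite dvdz0 raddfMn.
rewrite ifF //; apply/negP => /dvdzP[q qE].
case: (eqVneq q 0) => [q0|q0].
  move/eqP: ne; apply; apply/eqP; rewrite -(eqr_nat R) -subr_eq0 zE qE q0 mul0r mulr0 //.
move: zb; rewrite qE normrM => /lt_geF/negP; apply; rewrite [X in _ <= _ * X]ger0_norm //.
by rewrite ler_peMl // -gtz0_ge1 normr_gt0.
Qed.

Lemma cos_reflect (Q d m t : nat) : (0 < Q)%N -> d = m %[mod 9] -> (t <= Q)%N ->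
  cos (2 * pi * ((Q - t)%N%:R / (9 * Q)%:R * (d%:R - m%:R))) =
  cos (2 * pi * (t%:R / (9 * Q)%:R * (d%:R - m%:R))) :> R.
Proof.
move=> Q0 dm tQ; have [z ->] := quotient9 dm; rewrite !phase_w //.
rewrite -subzn // mulrBr wB w_dvd ?mul1r ?dvdz_mull //.
Qed.

End Orthogonality.

Section PrimeFromPeak.
Variable R : realType.
Variables (k m b : nat).
Hypothesis hb : (10 ^ 8 <= b)%N.
Hypothesis hk1 : (b ^ 12 <= k)%N.
Hypothesis hk2 : (k < b.+1 ^ 12)%N.
Hypothesis hm1 : (9 * k <= 2 * m)%N.
Hypothesis hm2 : (2 * m <= 9 * k + 450)%N.
Let be : R := b%:R.
Let M := \sum_(n < 10 ^ k) wt R k m n.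
Hypothesis hM : 10 ^+ k / 1000 <= M.

Let be0 : 0 < be := be_gt0 R hb.
Let bl : 1000 * (1000 * 100) <= be := be_large R hb.
Let M0 : 0 <= M.
Proof. by apply: sumr_ge0 => n _; apply: wt_ge0. Qed.
Let b0 : (0 < b)%N := b_gt0 hb.
Let b100 : (100 <= b)%N.
Proof. by apply: (b_ge hb); rewrite (_ : 10 ^ 4 = 10 ^ 2 * 10 ^ 2)%N ?leq_pmulr // -expnD. Qed.
Let k0 : (0 < k)%N.
Proof. by apply: leq_trans hk1; rewrite expn_gt0 b0. Qed.

(* Fine enough for the congruence s(n) = m modulo 9 Q to be an equality, as k < Q, and
   chosen so that t = 9 b^9 and t = 360 b^10 correspond to the two thresholds for al. *)
Let Q := (40 * b ^ 15)%N.
Let F (t : nat) := @peak R k m (t%:R / (9 * Q)%:R).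

Let Q0 : (0 < Q)%N. Proof. by rewrite muln_gt0 expn_gt0 b0. Qed.

Let kQ : (k < Q)%N.
Proof.
apply: leq_ltn_trans (k_le hb hk2) _; rewrite /Q; apply: (@leq_ltn_trans (b ^ 15)).
  by rewrite leq_pexp2l.
by rewrite ltn_Pmull // expn_gt0 b0.
Qed.

Lemma wt_mod9 n : (n < 10 ^ k)%N -> wt R k m n != 0 -> ds k n = m %[mod 9].
Proof.
move=> nk; rewrite /wt; case: ifP => [/andP[_ /eqP E] _|_]; last by rewrite eqxx.
by rewrite (ds_mod9 nk).
Qed.

Lemma peak_orthogonal : \sum_(t < Q) F t =
  Q%:R * \sum_(n < 10 ^ k) (if ds k n == m then wt R k m n else 0).
Proof.
rewrite exchange_big /= mulr_sumr; apply: eq_bigr => n _; rewrite -mulr_sumr.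
have [->|ne] := eqVneq (wt R k m n) 0; first by rewrite mul0r; case: ifP; rewrite mulr0.
rewrite cos_orthogonal ?(wt_mod9 _ ne) //.
- by case: ifP => _; rewrite ?mulr0 // mulrC.
- by apply: leq_ltn_trans (ds_le k n) _; apply: ltn_addl; rewrite ltn_mul2l.
apply: leq_ltn_trans (_ : 9 * k < _)%N; last by apply: ltn_addl; rewrite ltn_mul2l.
have k50 : (50 <= k)%N.
  by apply: leq_trans hk1; apply: (@leq_trans b); [exact: leq_trans b100 | rewrite -[leqLHS]expn1 leq_pexp2l].
by move: hm2 k50; clear; lia.
Qed.

Lemma peak_reflect t : (t <= Q)%N -> F (Q - t) = F t.
Proof.
move=> tQ; apply: eq_bigr => n _.
have [->|ne] := eqVneq (wt R k m n) 0; first by rewrite !mul0r.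
by rewrite cos_reflect // (wt_mod9 _ ne).
Qed.

Let c := (360 * b ^ 10)%N.

Let QR : (9 * Q)%:R = 360 * be ^+ 15 :> R.
Proof. by rewrite /Q mulnA natrM natrX. Qed.

Lemma half_bound t : (t <= 20 * b ^ 15)%N ->
  [/\ (t < 9 * b ^ 9)%N -> M / 4 <= F t, (t <= c)%N -> - (M * (2500 / be ^+ 2)) <= F t
    & (c < t)%N -> - (M / be ^+ 20) <= F t].
Proof.
move=> th; have al0 : 0 <= t%:R / (9 * Q)%:R :> R by rewrite divr_ge0.
have be15 : 0 < 360 * be ^+ 15 by rewrite mulr_gt0 ?exprn_gt0.
split=> ht.
- apply: (peak_core hb) => //; rewrite QR ler_pdivrMr //.
  have -> : 1 / (40 * be ^+ 6) * (360 * be ^+ 15) = (9 * b ^ 9)%:R.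
    rewrite natrM natrX -/be (_ : be ^+ 15 = be ^+ 9 * be ^+ 6) -?exprD //.
    by field; rewrite gt_eqF.
  by rewrite ler_nat ltnW.
- apply: (proj1 (peak_bound hb hk1 hk2 hm1 hm2 hM al0 _)); rewrite QR ler_pdivrMr //.
  have -> : 1 / be ^+ 5 * (360 * be ^+ 15) = c%:R.
    rewrite /c natrM natrX -/be (_ : be ^+ 15 = be ^+ 10 * be ^+ 5) -?exprD //.
    by field; rewrite gt_eqF.
  by rewrite ler_nat.
apply: (peak_far hb) => //; rewrite QR; last first.
  rewrite ler_pdivrMr //; apply: (@le_trans _ _ (20 * b ^ 15)%:R); first by rewrite ler_nat.
  by rewrite natrM natrX -/be; move: (be ^+ 15) => x; lra.
rewrite ltr_pdivlMr //.
have -> : 1 / be ^+ 5 * (360 * be ^+ 15) = c%:R.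
  rewrite /c natrM natrX -/be (_ : be ^+ 15 = be ^+ 10 * be ^+ 5) -?exprD //.
  by field; rewrite gt_eqF.
by rewrite ltr_nat.
Qed.

Let A := M * (2500 / be ^+ 2).
Let B := M / be ^+ 20.
Let A0 : 0 <= A. Proof. by rewrite mulr_ge0 // divr_ge0 // exprn_ge0 // ltW. Qed.
Let B0 : 0 <= B. Proof. by rewrite divr_ge0 // exprn_ge0 // ltW. Qed.

Lemma point_bound t : (t < Q)%N ->
  (if (t < 9 * b ^ 9)%N then M / 4 else 0) - (if (t < c.+1)%N then A else 0) -
  (if (Q - c <= t)%N then A else 0) - B <= F t.
Proof.
move=> tQ; set x := (if (t < 9 * _)%N then _ else _).
set y := (if (t < _)%N then A else _); set z := (if (_ <= t)%N then _ else _).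
have y0 : 0 <= y by rewrite /y; case: ifP.
have z0 : 0 <= z by rewrite /z; case: ifP.
have core9 : (9 * b ^ 9 <= 20 * b ^ 15)%N by apply: leq_mul => //; rewrite leq_pexp2l.
have QE : Q = (20 * b ^ 15 + 20 * b ^ 15)%N by rewrite /Q -mulnDl.
have M4 : 0 <= M / 4 by rewrite divr_ge0.
have [th|th] := leqP t (20 * b ^ 15).
  have [h1 h2 h3] := half_bound th; rewrite -/A -/B in h2 h3.
  move: A0 B0 y0 z0; rewrite /x; case: ifP => [/h1|_].
    by move: M4; move: (F t) (M / 4) A B y z => f1 f2 f3 f4 f5 f6 *; lra.
  have : y = A /\ - A <= F t \/ - B <= F t.
    rewrite /y ltnS; case: leqP => [/h2|/h3]; first by left.
    by right.
  by move: (F t) A B y z => f1 f3 f4 f5 f6 [[]|] *; lra.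
have th' : (Q - t <= 20 * b ^ 15)%N by rewrite QE; move: th; clear; lia.
have [_ h2 h3] := half_bound th'; rewrite -/A -/B (peak_reflect (ltnW tQ)) in h2 h3.
have -> : x = 0 by rewrite /x ifF //; apply/negbTE; rewrite -leqNgt (leq_trans core9) // ltnW.
have : z = A /\ - A <= F t \/ - B <= F t.
  case: (leqP (Q - t) c) => tc; last by right; apply: h3.
  by left; split; [rewrite /z ifT // leq_subCl | apply: h2].
by move: A0 B0 y0 z0; move: (F t) A B y z => f1 f3 f4 f5 f6 ? ? ? ? [[]|] *; lra.
Qed.

(** The 9 b^9 frequencies of [peak_core] contribute b^9 M, up to constants. The
  negative part is at most 720 b^10 * 2500 / b^2 * M on the frequencies up to b^-5,
  and of order b^-5 M on the others. *)
Lemma peak_sum_lower : M * be ^+ 9 / 2 <= \sum_(t < Q) F t.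
Proof.
have le : \sum_(t < Q) ((if (t < 9 * b ^ 9)%N then M / 4 else 0) - (if (t < c.+1)%N then A else 0) -
  (if (Q - c <= t)%N then A else 0) - B) <= \sum_(t < Q) F t.
  by apply: ler_sum => t _; apply: point_bound.
have b15 j : (j <= 15)%N -> (b ^ j <= b ^ 15)%N by move=> ?; rewrite leq_pexp2l.
have cQ : (c.+1 <= Q)%N.
  have b_40 : (360 <= 40 * b)%N.
    by rewrite (_ : 360 = 40 * 9)%N // leq_mul2l; exact: leq_trans b100.
  apply: (@leq_ltn_trans (40 * b ^ 11)).
    by rewrite /c [(b ^ 11)%N]expnS mulnA leq_mul2r b_40 orbT.
  rewrite /Q ltn_mul2l /= ltn_exp2l //; exact: leq_trans b100.
apply: le_trans le; rewrite !sumrB sumr_const card_ord.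
have c9 : (9 * b ^ 9 <= Q)%N by apply: leq_mul => //; apply: b15.
rewrite (sum_below (M / 4) c9) (sum_below A cQ) (sum_above A (ltnW cQ)).
rewrite -[B *+ Q]mulr_natl -(addn1 c) (natrD _ c).
have cR : c%:R = 360 * be ^+ 10 by rewrite natrM natrX.
have QR' : Q%:R = 40 * be ^+ 15 by rewrite natrM natrX.
have nR : (9 * b ^ 9)%:R = 9 * be ^+ 9 :> R by rewrite natrM natrX.
have be1 : 1 <= be by move: bl; lra.
have m10 : M <= M * be ^+ 8 by apply: ler_peMr => //; rewrite exprn_ege1.
have A10 : be ^+ 10 * A = 2500 * (M * be ^+ 8).
  rewrite /A (_ : be ^+ 10 = be ^+ 8 * be ^+ 2) -?exprD //; field; by rewrite gt_eqF.
have A1 : A <= 2500 * (M * be ^+ 8).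
  by rewrite -A10 ler_peMl // exprn_ege1.
have B15 : be ^+ 15 * B <= M * be ^+ 8.
  rewrite /B mulrA [be ^+ 15 * M]mulrC ler_pdivrMr ?exprn_gt0 // -mulrA; apply: (ler_wpM2l M0).
  by rewrite -exprD ler_weXn2l.
have nine : M * be ^+ 9 = be * (M * be ^+ 8) by rewrite exprS mulrCA.
have big8 : 1000 * (1000 * 100) * (M * be ^+ 8) <= M * be ^+ 9.
  by rewrite nine ler_wpM2r // mulr_ge0 // exprn_ge0 // ltW.
rewrite cR QR' nR.
have -> : 9 * be ^+ 9 * (M / 4) = 9 / 4 * (M * be ^+ 9) by field.
have -> : (360 * be ^+ 10 + 1) * A = 360 * (be ^+ 10 * A) + A by ring.
have -> : 360 * be ^+ 10 * A = 360 * (be ^+ 10 * A) by ring.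
have -> : 40 * be ^+ 15 * B = 40 * (be ^+ 15 * B) by ring.
have : 0 <= M * be ^+ 8 by rewrite mulr_ge0 // exprn_ge0 // ltW.
move: A10 A1 B15 big8; move: A (be ^+ 10 * A) (be ^+ 15 * B) (M * be ^+ 9) (M * be ^+ 8) => x1 x2 x3 x4 x5.
by move=> *; lra.
Qed.

Lemma weight_at_digit_sum :
  10 ^+ k / (80 * 1000 * be ^+ 6) <= \sum_(n < 10 ^ k) (if ds k n == m then wt R k m n else 0).
Proof.
have := peak_sum_lower; rewrite peak_orthogonal; move: (\sum_(n < _) _) => S.
have -> : Q%:R = 40 * be ^+ 15 :> R by rewrite natrM natrX.
have -> : be ^+ 15 = be ^+ 9 * be ^+ 6 by rewrite -exprD.
have b9 : 0 < be ^+ 9 by rewrite exprn_gt0.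
have b6 : 0 < be ^+ 6 by rewrite exprn_gt0.
have -> : M * be ^+ 9 / 2 = be ^+ 9 * (M / 2) by ring.
have -> : 40 * (be ^+ 9 * be ^+ 6) * S = be ^+ 9 * (40 * (S * be ^+ 6)) by ring.
rewrite ler_pM2l // ler_pdivrMr ?mulr_gt0 // => h.
have : 10 ^+ k / 1000 <= 80 * (S * be ^+ 6).
  by apply: (le_trans hM); move: h; move: (S * _) => y; move: M => x; lra.
rewrite ler_pdivrMr // => h2; rewrite ler_pdivrMr; last by rewrite !mulr_gt0.
apply: (le_trans h2).
by rewrite le_eqVlt; apply/orP; left; apply/eqP; ring.
Qed.

Lemma few_prime_powers :
  \sum_(n < 10 ^ k) (if prime n then 0 else Lam R n) < 10 ^+ k / (80 * 1000 * be ^+ 6).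
Proof.
apply: (@le_lt_trans _ _ (10 ^ (k %/ 2).+1 * (4 * k) * (3 * k))%:R).
  apply: (@prime_power_mass R (fun _ j => (0 < j)%N) (fun n => if prime n then 0 else Lam R n)) => //.
    move=> n nx; have ge0 : 0 <= \sum_(p < 10 ^ k | prime p)
        \sum_(j < 10 ^ k | (p ^ j.+1 == n)%N && (0 < j)%N) ln p%:R :> R.
      by apply: sumr_ge0 => p _; apply: sumr_ge0 => j _; apply: ln_nat_ge0.
    case: ifP => // np; rewrite (Lam_widen R nx); apply: ler_sum => p pp.
    rewrite le_eqVlt (eq_bigl (fun j : 'I_(10 ^ k) => (p ^ j.+1 == n)%N && (0 < j)%N)) ?eqxx // => j.
    case: eqP => //= E; case: (posnP j) => // j0.
    by move: np; rewrite -E j0 expn1 pp.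
  move=> p j pp j0 lt; rewrite -(@ltn_exp2r _ _ 2) //.
  apply: (@leq_ltn_trans (p ^ j.+1)); first by rewrite leq_pexp2l ?prime_gt0.
  apply: leq_trans lt _; rewrite -expnM leq_exp2l //.
  by have := ltn_ceil k (isT : 0 < 2)%N; clear; lia.
have be6 : 0 < 80 * 1000 * be ^+ 6 by rewrite !mulr_gt0 // exprn_gt0.
have b2 : (100 <= b ^ 2)%N by apply: (leq_trans b100); rewrite -[leqLHS]expn1 leq_pexp2l.
have b22 x : (x <= 100 * 100)%N -> (x <= b ^ 2)%N.
  by move=> hx; apply: leq_trans hx _; rewrite -mulnn leq_mul.
have key : (10 ^ (k %/ 2).+1 * (4 * k) * (3 * k) * (80 * 1000 * b ^ 6) < 10 ^ k)%N.
  have -> : (10 ^ (k %/ 2).+1 * (4 * k) * (3 * k) * (80 * 1000 * b ^ 6) =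
     10 ^ (k %/ 2) * (120 * k ^ 2 * (80 * 1000 * b ^ 6)))%N by rewrite expnS; ring.
  apply: (@leq_trans (10 ^ (k %/ 2) * 10 ^ (k %/ 2))); last first.
    by rewrite -expnD leq_exp2l // addnn -muln2 leq_divM.
  rewrite ltn_mul2l expn_gt0 /=.
  apply: (@leq_ltn_trans (b ^ 2 * (b ^ 13) ^ 2 * (b ^ 2 * b ^ 2 * b ^ 6))).
    apply: leq_mul; first by apply: leq_mul; [apply: b22; apply: (@leq_mul 2 60) | rewrite leq_exp2r // k_le].
    apply: leq_mul => //; apply: leq_mul; apply: b22; first exact: (@leq_mul 1 80).
    exact: (@leq_mul 10 100).
  have -> : (b ^ 2 * (b ^ 13) ^ 2 * (b ^ 2 * b ^ 2 * b ^ 6) = b ^ 38)%N by rewrite -!expnM -!expnD.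
  apply: (@leq_ltn_trans (10 ^ b)); first by apply: (growth_pow hb); clear; lia.
  rewrite ltn_exp2l // leq_divRL //; apply: leq_trans hk1.
  apply: (@leq_trans (b * b ^ 2)); last by rewrite -expnS leq_pexp2l.
  apply: (@leq_trans (b * 100)); last by rewrite leq_mul2l b2 orbT.
  by move: b0; clear; lia.
rewrite ltr_pdivlMr // /be; apply: (@lt_le_trans _ _ (10 ^ k)%N%:R); last by rewrite natrX.
by move: key; rewrite -(ltr_nat R) [X in X < _]natrM (natrM _ (80 * 1000)) (natrM _ 80 1000) (natrX _ b).
Qed.

(** If no prime had digit sum m, all the weight there would sit on higher prime
  powers, of which there are only about 10^(k/2). *)
Theorem prime_with_digit_sum : exists p, [/\ prime p, (10 ^ k.-1 <= p < 10 ^ k)%N & digit_sum p = m].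
Proof.
have lt := lt_le_trans few_prime_powers weight_at_digit_sum.
have [n|none] := pickP (fun n : 'I_(10 ^ k) => [&& prime n, (10 ^ k.-1 <= n)%N & ds k n == m]).
  by case/and3P=> pn ln /eqP E; exists n; rewrite pn ln ltn_ord (ds_digit_sum (ltn_ord n)).
suff : \sum_(n < 10 ^ k) (if ds k n == m then wt R k m n else 0) <=
  \sum_(n < 10 ^ k) (if prime n then 0 else Lam R n) by rewrite leNgt lt.
apply: ler_sum => n _; have := none n; rewrite /wt; case: eqP => _; last first.
  by move=> _; case: ifP => // _; apply: Lam_ge0.
rewrite andbT; case: (prime n) => /= [->//|_]; case: ifP => // _; exact: Lam_ge0.
Qed.

End PrimeFromPeak.

(** * From a dense block to the largest prime *)

Lemma integer_root k : (0 < k)%N -> exists2 b, (b ^ 12 <= k)%N & (k < b.+1 ^ 12)%N.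
Proof.
move=> k0; have ex : exists b, (b ^ 12 <= k)%N by exists 0.
have bd b : (b ^ 12 <= k)%N -> (b <= k)%N.
  by apply: leq_trans; case: b => // b; rewrite -[leqLHS]expn1 leq_pexp2l.
case: (ex_maxnP ex bd) => b hb mx; exists b => //.
by rewrite ltnNge; apply/negP => /mx; rewrite ltnn.
Qed.

Lemma pow6_mod9 m : coprime m 9 -> m ^ 6 = 1 %[mod 9].
Proof.
rewrite -coprime_modl -modnXm; have := ltn_pmod m (isT : 0 < 9)%N.
by move: (m %% 9)%N; do 9![case=> //].
Qed.

Section Block.
Variable R : realType.
Variables (m a : nat).
Hypothesis cop : coprime m 9.
Hypothesis a50 : (50 <= a)%N.

Let F d : R := if (10 ^ a <= d)%N && ((m ^ 5 * d) %% 9 == 1)%N then Lam R d / d%:R else 0.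

Lemma in_class d : ((m ^ 5 * d) %% 9 == 1)%N -> (d %% 9 == m %% 9)%N.
Proof.
move=> /eqP E; have : m * (m ^ 5 * d) = m * 1 %[mod 9] by rewrite -modnMmr E.
by rewrite mulnA -expnS -modnMml (pow6_mod9 cop) modnMml mul1n muln1 => ->.
Qed.

(** If each of the fifty decades had a mass below 10^k / 1000, its part of the sum in
  [class_mass] would be below 1 / 100. Multiplication by m^5 inverts m modulo 9. *)
Lemma exists_block : exists2 k, (a < k <= a + 50)%N & 10 ^+ k / 1000 <= \sum_(n < 10 ^ k) wt R k m n.
Proof.
have mass : 1 / 2 <= \sum_(d < 10 ^ (a + 50)) F d.
  have cop5 : coprime (m ^ 5) 9 by rewrite coprimeXl.
  have := @class_mass R _ (a + 50) (leq_add a50 (leqnn 50)) cop5.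
  by rewrite addnK.
pose bad j := `[< 10 ^+ (a + j) / 1000 <= \sum_(n < 10 ^ (a + j)) wt R (a + j) m n >].
have [[j bj]|none] := pickP (fun j : 'I_51 => (0 < j)%N && bad j).
  move=> /andP[j0 /asboolP h]; exists (a + j)%N => //.
  by rewrite -[X in (X < _)%N]addn0 ltn_add2l j0 leq_add2l.
exfalso; have le j : (10 ^ (a + j) <= 10 ^ (a + j.+1))%N by rewrite leq_exp2l // leq_add2l.
have step j : (j < 50)%N -> \sum_(i < 10 ^ (a + j.+1) - 10 ^ (a + j)) F (10 ^ (a + j) + i)%N < 1 / 100.
  move=> jk; have := none (Ordinal (jk : (j.+1 < 51)%N)); rewrite /= => /negbT/asboolPn/negP.
  rewrite -ltNge (big_ord_cat (wt R (a + j.+1) m) (le j)) => lt.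
  have p0 : 0 < 10 ^+ (a + j) :> R by rewrite exprn_gt0.
  have Fw i : F (10 ^ (a + j) + i)%N <= wt R (a + j.+1) m (10 ^ (a + j) + i) / 10 ^+ (a + j).
    rewrite /F; case: ifP => [/andP[_ /in_class cl]|_]; last first.
      by rewrite divr_ge0 ?wt_ge0 ?(ltW p0).
    rewrite /wt addnS /= leq_addr cl /=; apply: ler_wpM2l; first exact: Lam_ge0.
    by rewrite lef_pV2 ?posrE ?ltr0n ?addn_gt0 ?expn_gt0 // -natrX ler_nat leq_addr.
  apply: (le_lt_trans (ler_sum _ (fun (i : 'I__) _ => Fw i))).
  rewrite -mulr_suml ltr_pdivrMr //.
  have g0 : 0 <= \sum_(i < 10 ^ (a + j)) wt R (a + j.+1) m i.
    by apply: sumr_ge0 => i _; apply: wt_ge0.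
  have pE : 10 ^+ (a + j.+1) = 10 * 10 ^+ (a + j) :> R by rewrite addnS exprS.
  by move: lt g0; rewrite pE; move: (10 ^+ _) => z; lra.
have S j : (j <= 50)%N -> \sum_(d < 10 ^ (a + j)) F d <= j%:R / 100.
  elim: j => [|j IH] jk.
    rewrite addn0 mul0r big1 // => d _; rewrite /F ifF //.
    by apply/negbTE; rewrite negb_and -ltnNge ltn_ord.
  rewrite (big_ord_cat F (le j)) -[j.+1]addn1 natrD mulrDl; apply: lerD; first exact: IH (ltnW jk).
  by rewrite addn1 ltW ?step.
move: mass; rewrite (big_ord_cat F (le 49)).
have := S 49 isT; have := step 49 isT.
by lra.
Qed.
End Block.

Definition scale (m : nat) := (2 * m %/ 9)%N.

(** 9 k / 2 is the mean digit sum of the integers with k digits, and the k of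
  [exists_block] keeps 2 m within 450 of 9 k. *)
Lemma prime_near_scale (R : realType) m : (10 ^ 100 <= m)%N -> coprime m 9 ->
  exists p, [/\ prime p, (10 ^ (scale m - 50) <= p < 10 ^ scale m)%N & digit_sum p = m].
Proof.
move=> hm cop; set K := scale m.
have K1 : (9 * K <= 2 * m)%N by rewrite mulnC leq_divM.
have K2 : (2 * m < 9 * K + 9)%N by have := ltn_ceil (2 * m) (isT : 0 < 9)%N; rewrite -/(scale m) -/K; clear; lia.
have Kbig : (10 * 10 ^ 96 <= K)%N.
  rewrite -expnS leq_divRL //; apply: leq_trans (_ : 10 ^ 100 <= _)%N; last by apply: (leq_trans hm); rewrite leq_pmull.
  rewrite (_ : 10 ^ 100 = 10 ^ 97 * 10 ^ 3)%N; last by rewrite -expnD.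
  by rewrite leq_mul2l; apply/orP; right.
have big : (100 <= 10 ^ 96)%N.
  by apply: (@leq_trans (10 ^ 2)); [exact: leqnn | rewrite leq_exp2l].
have K96 : (10 ^ 96 + 100 <= K)%N.
  by apply: leq_trans Kbig; move: big; move: (10 ^ 96)%N => x; clear; lia.
have [k /andP[k1 k2] hM] := @exists_block R m (K - 50) cop (ltac:(move: K96; clear; lia)).
have kK : (k <= K)%N by move: k2 K96; clear; lia.
have k96 : (10 ^ 96 <= k)%N by move: k1 K96; move: (10 ^ 96)%N => x; clear; lia.
have k0 : (0 < k)%N by apply: leq_trans k96; rewrite expn_gt0.
have [b b1 b2] := integer_root k0.
have b8 : (10 ^ 8 <= b)%N.
  rewrite -ltnS -(@ltn_exp2r _ _ 12) //; apply: leq_ltn_trans b2.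
  by rewrite -expnM.
have hm1 : (9 * k <= 2 * m)%N by apply: leq_trans K1; rewrite leq_mul2l kK orbT.
have hm2 : (2 * m <= 9 * k + 450)%N by move: K2 k1; clear; lia.
have [p [pp /andP[p1 p2] ds]] := prime_with_digit_sum b8 b1 b2 hm1 hm2 hM.
exists p; split=> //; apply/andP; split.
  by apply: leq_trans p1; rewrite leq_exp2l //; move: k1; clear; lia.
by apply: leq_trans p2 _; rewrite leq_exp2l.
Qed.

Section Cutoff.
Variable R : realType.

Lemma cutoff_ge m : 10 ^+ scale m <= cutoff R m.
Proof.
rewrite /cutoff -powR_mulrn //; apply: ler_powR => //; first by rewrite ler1n.
by rewrite ler_pdivlMr // -!natrM ler_nat leq_divM.
Qed.

Lemma cutoff_le m : cutoff R m <= 10 ^+ (scale m).+1.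
Proof.
rewrite /cutoff -powR_mulrn //; apply: ler_powR => //; first by rewrite ler1n.
by rewrite ler_pdivrMr // -!natrM ler_nat ltnW // ltn_ceil.
Qed.

Lemma exists_largest m p : admissible_prime R m p ->
  exists2 q, largest_admissible_prime R m q & (p <= q)%N.
Proof.
move=> ap; pose P q := `[< admissible_prime R m q >].
have ex : exists q, P q by exists p; apply/asboolP.
have bd q : P q -> (q <= 10 ^ (scale m).+1)%N.
  by move=> /asboolP[_ le _]; rewrite -(ler_nat R) natrX (le_trans le) ?cutoff_le.
case: (ex_maxnP ex bd) => q /asboolP aq mx; exists q; last by apply: mx; apply/asboolP.
by split=> // r ar; apply: mx; apply/asboolP.
Qed.

Lemma sqrt_large m : (10 ^ 100 <= m)%N -> 10 ^+ 50 <= Num.sqrt m%:R :> R.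
Proof.
move=> hm; rewrite -[X in X <= _]ger0_norm ?exprn_ge0 // -sqrtr_sqr ler_wsqrtr //.
by rewrite -exprM -natrX ler_nat.
Qed.

Lemma large_prime_exists m : (10 ^ 100 <= m)%N -> coprime m 9 -> large_prime_bound R m.
Proof.
move=> hm cop; have [p [pp /andP[p1 p2] ds]] := prime_near_scale R hm cop.
have ap : admissible_prime R m p.
  by split=> //; apply: le_trans (cutoff_ge m); rewrite -natrX ler_nat ltnW.
have [q lq pq] := exists_largest ap; exists q; split=> //.
have s50 := sqrt_large hm.
have s0 : 0 < 24 * Num.sqrt m%:R :> R by rewrite mulr_gt0 // (lt_le_trans _ s50) ?exprn_gt0.
rewrite ler_pdivrMr //; apply: le_trans (cutoff_le m) _.
have E : (10 ^ (scale m).+1 <= 10 ^ (scale m - 50) * 10 ^ 51)%N.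
  by rewrite -expnD leq_exp2l //; clear; lia.
move: E; rewrite -(ler_nat R) natrM !natrX => E; apply: le_trans E _.
apply: ler_pM; rewrite ?exprn_ge0 //.
  by rewrite -natrX ler_nat (leq_trans p1).
rewrite exprS; apply: ler_pM; rewrite ?exprn_ge0 //.
by rewrite ler_nat.
Qed.
End Cutoff.

(** After division by powers of two this follows from 5^3 <= 2^7, since
  5^131 = 25 * (5^3)^43 and 25 * 2^6 <= 4027. *)
Lemma explicit_large : (10 ^ 131 <= 4027 * 2 ^ 426)%N.
Proof.
have -> : (10 ^ 131 = 5 ^ 131 * 2 ^ 131)%N by rewrite -expnMn.
have -> : (2 ^ 426 = 2 ^ 295 * 2 ^ 131)%N by rewrite -expnD.
rewrite mulnA leq_mul2r; apply/orP; right.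
apply: (@leq_trans (25 * (2 ^ 7) ^ 43)).
  have -> : (5 ^ 131 = 25 * (5 ^ 3) ^ 43)%N.
    have E : (25 = 5 ^ 2)%N by [].
    by rewrite E -expnM -expnD.
  by rewrite leq_mul2l leq_exp2r.
have -> : ((2 ^ 7) ^ 43 = 2 ^ 6 * 2 ^ 295)%N by rewrite -expnM -expnD.
by rewrite mulnA leq_mul2r; apply/orP; right.
Qed.

Lemma coprime9 n : (n %% 3 != 0)%N -> coprime n 9.
Proof.
by move=> n3; rewrite (_ : 9 = 3 ^ 2)%N // coprime_pexpr // coprime_sym prime_coprime // /dvdn.
Qed.

Lemma pow2_mod3 e : (2 ^ (2 * e) = 1 %[mod 3])%N.
Proof. by rewrite expnM -modnXm exp1n. Qed.

Lemma explicit_value A r h e : e = (2 * h)%N -> (4027 <= A)%N -> (213 <= h)%N ->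
  (A = r %[mod 3])%N -> ((r + 1) %% 3 != 0)%N ->
  (10 ^ 131 <= A * 2 ^ e + 1)%N /\ coprime (A * 2 ^ e + 1) 9.
Proof.
move=> -> hA hh Ar r3; split.
  rewrite addn1; apply: leqW; apply: leq_trans explicit_large _; apply: leq_mul => //.
  by rewrite leq_exp2l // (@leq_mul 2 213).
by apply: coprime9; rewrite -modnDml -modnMm pow2_mod3 modnMm muln1 modnDml -modnDml Ar modnDml.
Qed.

Lemma explicit_values m : m = (43917 * 2 ^ 430 + 1)%N \/ m = (3557 * 2 ^ 431 + 1)%N \/ m = (4027 * 2 ^ 426 + 1)%N ->
  (10 ^ 131 <= m)%N /\ coprime m 9.
Proof.
have c1 : (4027 <= 43917)%N by vm_compute.
have c2 : (4027 <= 3557 * 2)%N by vm_compute.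
have r1 : (43917 = 0 %[mod 3])%N by vm_compute.
have r2 : (3557 * 2 = 1 %[mod 3])%N by vm_compute.
have r3 : (4027 = 1 %[mod 3])%N by vm_compute.
have e1 : (430 = 2 * 215)%N by []. have e3 : (426 = 2 * 213)%N by [].
have l1 : (213 <= 215)%N by [].
have E : (3557 * 2 ^ 431 = 3557 * 2 * 2 ^ 430)%N by rewrite -mulnA -expnS.
have v1 := explicit_value e1 c1 l1 r1 isT.
have v2 := explicit_value e1 c2 l1 r2 isT.
have v3 := explicit_value e3 (leqnn _) (leqnn _) r3 isT.
move=> [->|[->|->]]; [exact: v1 | rewrite E; exact: v2 | exact: v3].
Qed.

Lemma size_digits m : (10 ^ 131 <= m)%N -> (132 <= size (digits m))%N.
Proof. by move=> hm; rewrite /digits size_mkseq ltnS trunc_log_max. Qed.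

Local Open Scope nat_scope.

Theorem theorem7 (R : realType) :
  [/\ exists M_LP : nat, M_LP <= 10 ^ 100 /\
        forall m : nat, M_LP <= m -> gcdn m 9 = 1 -> large_prime_bound R m,
      forall m : nat, 10 ^ 100 <= m -> gcdn m 9 = 1 -> large_prime_bound R m
    & forall m : nat,
        m = 43917 * 2 ^ 430 + 1 \/
        m = 3557 * 2 ^ 431 + 1 \/
        m = 4027 * 2 ^ 426 + 1 ->
        132 <= size (digits m) /\ large_prime_bound R m].
Proof.
have main m : 10 ^ 100 <= m -> gcdn m 9 = 1 -> large_prime_bound R m.
  by move=> hm /eqP cop; apply: large_prime_exists.
split; [by exists (10 ^ 100); split; [exact: leqnn | exact: main] | exact: main |].
move=> m /explicit_values[big cop]; split; first exact: size_digits.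
have le : 10 ^ 100 <= 10 ^ 131 by rewrite leq_exp2l.
exact: (large_prime_exists R (leq_trans le big) cop).
Qed.
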